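(* Let $N\ge1$, $m\ge 0$, $n_1,\dots,n_N\geq 1$ be integers and $n=n_1+\dots+n_N$. Let $U$ be a linear Galois algebra in $(L*\mathcal{M})^G$ such that: (1) $L=\mathbb{C}(t_{ij},\ i=1,\dots,N,\ j=1,\dots,n_i;\ z_1,\dots,z_m)$; (2) $G=G_1\times\dots\times G_N$, where each $G_s$ is a classical reflection group acting naturally on the variables $t_{s1},\dots,t_{s,n_s}$ and trivially on all the other variables, $s=1,\dots,N$; (3) $\mathcal{M}\simeq\mathbb{Z}^n$ acts by shifts on $t_{11},\dots,t_{N,n_N}$. Then $U$ admits a skew field of fractions $F(U)$ and $F(U)\simeq F_{n,m}$.
   Context: All algebras are over $\mathbb{C}$. $F_{n,m}$ denotes the skew field of fractions of $A_{n,m}$, the $n$-th Weyl algebra over the field of rational functions $\mathbb{C}(z_1,\dots,z_m)$. Galois algebras: let $\Gamma$ be an integral domain with field of fractions $K$, $K\subset L$ a finite Galois extension with Galois group $G$, and $\mathcal{M}\subset\mathrm{Aut}_{\mathbb{C}}(L)$ a monoid on which $G$ acts by conjugation. $L*\mathcal{M}$ is the skew monoid algebra (free left $L$-module on $\mathcal{M}$, with $\sigma a=\sigma(a)\sigma$ for $\sigma\in\mathcal{M}$, $a\in L$), with the induced action of $G$ (on $L$ as Galois group, on $\mathcal{M}$ by conjugation). An associative algebra $U\supset\Gamma$ is a Galois $\Gamma$-algebra if it is a finitely generated $\Gamma$-subalgebra of $(L*\mathcal{M})^G$ (generated by $\Gamma$ and finitely many elements) and $KU=UK=(L*\mathcal{M})^G$.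 Linear Galois algebras: suppose $L$ is a field of rational functions $\mathbb{C}(V)$, i.e. the field of fractions of the symmetric algebra $S(V)$ of a finite-dimensional vector space $V$; $G\subset\mathrm{Aut}(L)$ is a classical reflection group (here, a product of such groups) whose action on $L$ is induced by its action by reflections on $V$; and $\mathcal{M}\subset\mathrm{Aut}(L)$ is a subgroup normalized by $G$. Put $K=L^G$. A Galois algebra $U$ in $(L*\mathcal{M})^G$ with respect to a polynomial subalgebra $\Gamma$ whose field of fractions is isomorphic to $K$ is called a linear Galois algebra. A classical reflection group $G_s$ acting on $r=n_s$ variables is $S_r$, $B_r=S_r\ltimes(\mathbb{Z}/2\mathbb{Z})^r$ or $D_r=S_r\ltimes(\mathbb{Z}/2\mathbb{Z})^{r-1}$ (even sign changes), acting on $t_{s1},\dots,t_{s,r}$ by permutations and sign changes. The group $\mathcal{M}=\mathbb{Z}^n$, free abelian on $\sigma_{ij}$ ($1\le i\le N$, $1\le j\le n_i$), acts by shifts if $\sigma_{ij}(t_{kl})=t_{kl}-\delta_{ik}\delta_{jl}$ and $\sigma_{ij}(z_k)=z_k$. The natural action of $G$ on $L*\mathcal{M}$ is the one given by this action on $L$ together with conjugation on $\mathcal{M}$: permutations permute the $\sigma_{sj}$ correspondingly, and the sign change of $t_{sj}$ sends $\sigma_{sj}$ to $\sigma_{sj}^{-1}$ and fixes the other generators. *)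

(* Defs.v *)
From HB Require Import structures.
From mathcomp Require Import all_boot all_order all_algebra all_fingroup.
From mathcomp Require Import generic_quotient ring_quotient fraction.
From mathcomp Require Import boolp finmap.
(* monalg has its own {mpoly _[_]}; only the one of mpoly is used here. *)
From mathcomp Require Import -(notations) monalg.
From mathcomp Require Import mpoly.

Set Implicit Arguments.
Unset Strict Implicit.
Unset Printing Implicit Defensive.

Import GRing.Theory.
Local Open Scope ring_scope.

Local Notation "x %:F" := (@FracField.tofrac _ x).

Definition ratfun (k : fieldType) (n : nat) : Type := {fraction {mpoly k[n]}}.

Section RatFun.
Context {k : fieldType} {n : nat}.
Implicit Types (c : k) (f : ratfun k n) (p q : {mpoly k[n]}).

HB.instance Definition _ := GRing.Field.on (ratfun k n).

Definition ratfun_scale c f : ratfun k n := (c%:MP_[n])%:F * f.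

Fact ratfun_scaleA c d f :
  ratfun_scale c (ratfun_scale d f) = ratfun_scale (c * d) f.
Proof. by rewrite /ratfun_scale mulrA -!rmorphM. Qed.

Fact ratfun_scale1 : left_id 1 ratfun_scale.
Proof. by move=> f; rewrite /ratfun_scale !rmorph1 mul1r. Qed.

Fact ratfun_scaleDr : right_distributive ratfun_scale +%R.
Proof. by move=> c f g; rewrite /ratfun_scale mulrDr. Qed.

Fact ratfun_scaleDl f : {morph ratfun_scale^~ f : c d / c + d}.
Proof. by move=> c d; rewrite /ratfun_scale !rmorphD /= mulrDl. Qed.

HB.instance Definition _ := GRing.Zmodule_isLmodule.Build k (ratfun k n)
  ratfun_scaleA ratfun_scale1 ratfun_scaleDr ratfun_scaleDl.

Fact ratfun_scaleAl c f g : c *: (f * g) = (c *: f) * g.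
Proof. exact: mulrA. Qed.

HB.instance Definition _ :=
  GRing.Lmodule_isLalgebra.Build k (ratfun k n) ratfun_scaleAl.
HB.instance Definition _ := GRing.Lalgebra_isComAlgebra.Build k (ratfun k n).

Definition to_ratfun p : ratfun k n := p%:F.

Fact to_ratfun_is_zmod_morphism : zmod_morphism to_ratfun.
Proof. exact: rmorphB. Qed.
Fact to_ratfun_is_monoid_morphism : monoid_morphism to_ratfun.
Proof. by split; [exact: rmorph1 | exact: rmorphM]. Qed.
Fact to_ratfun_is_scalable : scalable to_ratfun.
Proof. by move=> c p; rewrite /to_ratfun -mul_mpolyC rmorphM. Qed.

HB.instance Definition _ := GRing.isZmodMorphism.Build _ _ to_ratfun
  to_ratfun_is_zmod_morphism.
HB.instance Definition _ := GRing.isMonoidMorphism.Build _ _ to_ratfun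
  to_ratfun_is_monoid_morphism.
HB.instance Definition _ := GRing.isScalable.Build k _ _ _ to_ratfun
  to_ratfun_is_scalable.

Lemma to_ratfun_eq0 p : (to_ratfun p == 0) = (p == 0).
Proof. exact: tofrac_eq0. Qed.

Definition numer f : {mpoly k[n]} := \n_(repr (f : {fraction {mpoly k[n]}})).
Definition denom f : {mpoly k[n]} := \d_(repr (f : {fraction {mpoly k[n]}})).

Lemma denom_neq0 f : denom f != 0.
Proof. exact: denom_ratioP. Qed.

Lemma numer_div_denom f : f = to_ratfun (numer f) / to_ratfun (denom f).
Proof.
apply: (canRL (mulfK _)); first by rewrite to_ratfun_eq0 denom_neq0.
rewrite /to_ratfun /numer /denom.
rewrite -[X in X * _ = _](@reprK _ {fraction {mpoly k[n]}}).
move: (repr _) => r.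
unlock FracField.tofrac.
rewrite -[LHS]FracField.pi_mul; apply/eqmodP.
rewrite /= FracField.equivfE /FracField.mulf !numden_Ratio ?oner_eq0 ?mulr1 //.
  by rewrite mulrC.
all: exact: denom_ratioP.
Qed.

End RatFun.

Section RatFunMap.
Context {k : fieldType} {n : nat}.
Variables (h : {lrmorphism {mpoly k[n]} -> {mpoly k[n]}}) (h_inj : injective h).

Definition ratfun_map of injective h := fun f : ratfun k n =>
  to_ratfun (h (numer f)) / to_ratfun (h (denom f)).

Local Notation hF := (ratfun_map h_inj).

Let h_neq0 q : q != 0 -> to_ratfun (h q) != 0.
Proof. by move=> q0; rewrite to_ratfun_eq0 raddf_eq0. Qed.

Lemma ratfun_mapE p q : q != 0 ->
  hF (to_ratfun p / to_ratfun q) = to_ratfun (h p) / to_ratfun (h q).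
Proof.
move=> q0; set f := _ / _; have d0 := denom_neq0 f.
have E : p * denom f = numer f * q.
  have /eqP := numer_div_denom f.
  rewrite {1}/f eqr_div ?to_ratfun_eq0 // -2!(rmorphM to_ratfun).
  by rewrite /to_ratfun tofrac_eq => /eqP.
apply/eqP; rewrite /ratfun_map eqr_div ?h_neq0 //.
by rewrite -2!(rmorphM to_ratfun) -2!(rmorphM h) E.
Qed.

Lemma ratfun_map_to_ratfun p : hF (to_ratfun p) = to_ratfun (h p).
Proof. by rewrite -[to_ratfun p]divr1 -(rmorph1 to_ratfun) ratfun_mapE ?oner_neq0 // !rmorph1 divr1. Qed.

Fact ratfun_map_is_zmod_morphism : zmod_morphism hF.
Proof.
move=> f g; rewrite [f]numer_div_denom [g]numer_div_denom.
have := denom_neq0 f; have := denom_neq0 g.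
move: (numer f) (denom f) (numer g) (denom g) => p q p' q' q'0 q0.
rewrite -mulNr -rmorphN addf_div ?to_ratfun_eq0 // -!rmorphM -rmorphD.
rewrite !ratfun_mapE ?mulf_neq0 // -mulNr -rmorphN addf_div ?h_neq0 //.
by rewrite -!rmorphM -rmorphD /= !(rmorphD, rmorphM, rmorphN).
Qed.

Fact ratfun_map_is_monoid_morphism : monoid_morphism hF.
Proof.
split=> [|f g]; first by rewrite -(rmorph1 to_ratfun) ratfun_map_to_ratfun !rmorph1.
rewrite [f]numer_div_denom [g]numer_div_denom.
have := denom_neq0 f; have := denom_neq0 g.
move: (numer f) (denom f) (numer g) (denom g) => p q p' q' q'0 q0.
by rewrite mulf_div -!rmorphM !ratfun_mapE ?mulf_neq0 // mulf_div !rmorphM.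
Qed.

HB.instance Definition _ := GRing.isZmodMorphism.Build _ _ hF
  ratfun_map_is_zmod_morphism.
HB.instance Definition _ := GRing.isMonoidMorphism.Build _ _ hF
  ratfun_map_is_monoid_morphism.

Fact ratfun_map_is_scalable : scalable hF.
Proof.
have toA c : to_ratfun c%:A = c%:A by rewrite linearZ /= rmorph1.
move=> c f; rewrite -[c *: f]mulr_algl -[c *: hF f]mulr_algl rmorphM /=.
by rewrite -toA ratfun_map_to_ratfun linearZ /= rmorph1.
Qed.

HB.instance Definition _ := GRing.isScalable.Build k _ _ _ hF
  ratfun_map_is_scalable.

End RatFunMap.

Section MpolyExt.
Context {k : fieldType} {n : nat}.

Lemma mpoly_lrmorph_ext (A : algType k) (f g : {lrmorphism {mpoly k[n]} -> A}) :
  (forall i, f 'X_i = g 'X_i) -> f =1 g.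
Proof.
move=> fg p; rewrite [p]mpolyE !linear_sum; apply: eq_bigr => w _.
rewrite !linearZ mpolyXE_id !rmorph_prod; congr (_ *: _); apply: eq_bigr => i _.
by rewrite !rmorphXn /= fg.
Qed.

Lemma ratfun_lrmorph_ext (f g : {lrmorphism ratfun k n -> ratfun k n}) :
  (forall i, f (to_ratfun 'X_i) = g (to_ratfun 'X_i)) -> f =1 g.
Proof.
move=> fg; have fgp : f \o to_ratfun =1 g \o to_ratfun.
  exact: (@mpoly_lrmorph_ext _ (f \o to_ratfun) (g \o to_ratfun)).
move=> x; rewrite [x]numer_div_denom (fmorph_div f) (fmorph_div g).
by have /= -> := fgp (numer x); have /= -> := fgp (denom x).
Qed.

Definition mpoly_subst (h : 'I_n -> {mpoly k[n]}) (p : {mpoly k[n]}) :=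
  p \mPo [tuple h i | i < n].
HB.instance Definition _ h := GRing.LRMorphism.copy (mpoly_subst h)
  (comp_mpoly [tuple h i | i < n]).

Lemma mpoly_substX h i : mpoly_subst h 'X_i = h i.
Proof. by rewrite /mpoly_subst comp_mpolyXU -tnth_nth tnth_mktuple. Qed.

Lemma mpoly_substK h h' : (forall i, mpoly_subst h' (h i) = 'X_i) ->
  cancel (mpoly_subst h) (mpoly_subst h').
Proof.
move=> hK; apply: (@mpoly_lrmorph_ext _ (mpoly_subst h' \o mpoly_subst h) idfun).
by move=> i; rewrite /= -[RHS]hK; congr (mpoly_subst h' _); exact: mpoly_substX.
Qed.

End MpolyExt.

Section Weyl.
Context {K : fieldType} {n : nat}.

(* The free associative algebra on x_i (the letters [inl i]) and d_i (the
   letters [inr i]). *)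
Definition weyl_free : Type := malg (fmonom ('I_n + 'I_n)%type) K.
HB.instance Definition _ := GRing.Lalgebra.on weyl_free.

Definition free_gen (l : 'I_n + 'I_n) : weyl_free := mkmalgU (fmu l) 1.
Local Notation fX i := (free_gen (inl i)).
Local Notation fD i := (free_gen (inr i)).

Inductive weyl_ideal : weyl_free -> Prop :=
| weyl_ideal_XX i j : weyl_ideal (fX i * fX j - fX j * fX i)
| weyl_ideal_DD i j : weyl_ideal (fD i * fD j - fD j * fD i)
| weyl_ideal_DX i j : weyl_ideal (fD i * fX j - fX j * fD i - (i == j)%:R)
| weyl_ideal_0 : weyl_ideal 0
| weyl_ideal_B a b : weyl_ideal a -> weyl_ideal b -> weyl_ideal (a - b)
| weyl_ideal_Ml a b : weyl_ideal b -> weyl_ideal (a * b)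
| weyl_ideal_Mr a b : weyl_ideal a -> weyl_ideal (a * b).

(* The free algebra acts on polynomials by multiplications and partial
   derivatives, and weyl_ideal acts by 0; hence 1 is not in weyl_ideal. *)
Fixpoint free_act_word (w : seq ('I_n + 'I_n)) (p : {mpoly K[n]}) :=
  match w with
  | [::] => p
  | inl i :: w' => 'X_i * free_act_word w' p
  | inr i :: w' => mderiv i (free_act_word w' p)
  end.

Definition free_act (a : weyl_free) (p : {mpoly K[n]}) : {mpoly K[n]} :=
  \sum_(w <- monalg.msupp a) monalg.mcoeff w a *: free_act_word w p.

Fact free_act_word_is_linear w : linear (free_act_word w).
Proof.
elim: w => //= l w IH c p q; case: l => i; rewrite IH.
  by rewrite mulrDr scalerAr.
by rewrite linearP.
Qed.

Fact free_act_word0 w : free_act_word w 0 = 0.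
Proof. by elim: w => //= -[] i w ->; rewrite ?mulr0 ?raddf0. Qed.

Fact free_actEw (d : {fset fmonom ('I_n + 'I_n)%type}) a p :
  fsubset (monalg.msupp a) d ->
  free_act a p = \sum_(w <- d) monalg.mcoeff w a *: free_act_word w p.
Proof.
move=> le; rewrite /free_act (big_fset_incl _ le) //= => w _ /monalg.mcoeff_outdom ->.
by rewrite scale0r.
Qed.

Fact free_actD a b p : free_act (a + b) p = free_act a p + free_act b p.
Proof.
rewrite (free_actEw _ (monalg.msuppD_le a b)) (free_actEw _ (fsubsetUl _ (monalg.msupp b))).
rewrite (free_actEw _ (fsubsetUr (monalg.msupp a) _)) -big_split /=.
by apply: eq_bigr => w _; rewrite monalg.mcoeffD scalerDl.
Qed.

Fact free_act0 p : free_act 0 p = 0.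
Proof. by rewrite /free_act monalg.msupp0 big_seq_fset0. Qed.

Fact free_actN a p : free_act (- a) p = - free_act a p.
Proof. by apply/eqP; rewrite -addr_eq0 -free_actD addNr free_act0. Qed.

Fact free_actB a b p : free_act (a - b) p = free_act a p - free_act b p.
Proof. by rewrite free_actD free_actN. Qed.

Fact free_act_sum (I : Type) (r : seq I) (F : I -> weyl_free) p :
  free_act (\sum_(i <- r) F i) p = \sum_(i <- r) free_act (F i) p.
Proof.
by rewrite (big_morph (free_act^~ p) (fun a b => free_actD a b p) (free_act0 p)).
Qed.

Fact free_actU c w p : free_act (mkmalgU w c) p = c *: free_act_word w p.
Proof.
by rewrite (free_actEw _ monalg.msuppU_le) big_seq_fset1 monalg.mcoeffUU.
Qed.

Fact free_act_gen l p : free_act (free_gen l) p = free_act_word [:: l] p.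
Proof. by rewrite free_actU scale1r fmuE. Qed.

Fact free_act1 p : free_act 1 p = p.
Proof. by rewrite free_actU scale1r /= fm1. Qed.

Fact free_act_is_linear a : linear (free_act a).
Proof.
move=> c p q; rewrite /free_act scaler_sumr -big_split /=; apply: eq_bigr => w _.
by rewrite free_act_word_is_linear scalerDr !scalerA mulrC.
Qed.

Fact free_act_word_cat w v p :
  free_act_word (w ++ v) p = free_act_word w (free_act_word v p).
Proof. by elim: w => //= -[] i w ->. Qed.

Fact free_actM a b p : free_act (a * b) p = free_act a (free_act b p).
Proof.
rewrite [a * b]malgME free_act_sum [RHS]/free_act; apply: eq_bigr => w _.
rewrite free_act_sum [free_act b p]/free_act.
have lin := free_act_word_is_linear w.
have wD q r : free_act_word w (q + r) = free_act_word w q + free_act_word w r.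
  by rewrite -[q]scale1r lin !scale1r.
have w0 := free_act_word0 w.
rewrite (big_morph (free_act_word w) wD w0) scaler_sumr; apply: eq_bigr => v _.
have wZ c q : free_act_word w (c *: q) = c *: free_act_word w q.
  by rewrite -[c *: q]addr0 lin w0 addr0.
by rewrite free_actU wZ scalerA fmM free_act_word_cat.
Qed.

Fact free_act_gen2 l l' p :
  free_act (free_gen l * free_gen l') p = free_act_word [:: l; l'] p.
Proof. by rewrite free_actM free_act_gen free_act_gen -free_act_word_cat. Qed.

Fact free_act_comm l l' p :
  free_act (free_gen l * free_gen l' - free_gen l' * free_gen l) p =
  free_act_word [:: l; l'] p - free_act_word [:: l'; l] p.
Proof.
by apply: etrans (free_actB _ _ _) _; congr (_ - _); exact: free_act_gen2.
Qed.

Fact free_act_ideal a p : weyl_ideal a -> free_act a p = 0.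
Proof.
move=> Ia; elim: Ia p => {a} [i j|i j|i j||a b _ IHa _ IHb|a b _ IH|a b _ IH] p.
- by apply: etrans (free_act_comm _ _ _) _; rewrite /= mulrCA subrr.
- by apply: etrans (free_act_comm _ _ _) _; rewrite /= mderiv_comm subrr.
- rewrite free_actB free_act_comm /= mderivM mderivX mnmE.
  have -> : free_act (i == j)%:R p = (i == j)%:R * p.
    case: (i == j); first by rewrite free_act1 mul1r.
    by rewrite free_act0 mul0r.
  rewrite addrK [j == i]eq_sym; case: (i =P j) => [<-|_] /=.
    have -> : (U_(i) - U_(i) = 0 :> 'X_{1..n})%MM.
      by apply/mnmP => l; rewrite mnmBE mnm0E subnn.
    by rewrite mpolyX0 scale1r subrr.
  by rewrite scale0r mul0r subrr.
- exact: free_act0.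
- by rewrite free_actB IHa IHb subrr.
- rewrite free_actM IH /free_act big1 // => w _.
  by rewrite free_act_word0 scaler0.
- by rewrite free_actM IH.
Qed.

Definition weyl_idealb : {pred weyl_free} := fun a => `[< weyl_ideal a >].

Fact weyl_ideal_zmod_closed : zmod_closed weyl_idealb.
Proof.
split=> [|a b /asboolP Ia /asboolP Ib]; apply/asboolP.
  exact: weyl_ideal_0.
exact: weyl_ideal_B.
Qed.
HB.instance Definition _ := GRing.isZmodClosed.Build weyl_free weyl_idealb
  weyl_ideal_zmod_closed.

Local Open Scope quotient_scope.

Definition weyl : Type := Quotient.quot weyl_idealb.
HB.instance Definition _ := GRing.Zmodule.on weyl.

Definition to_weyl (a : weyl_free) : weyl := \pi_(Quotient.quot weyl_idealb) a.

Lemma to_weyl_eq a b : to_weyl a = to_weyl b <-> weyl_ideal (a - b).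
Proof.
split=> [/eqP|I].
  by rewrite -Quotient.idealrBE => /asboolP.
by apply/eqP; rewrite -Quotient.idealrBE; apply/asboolP.
Qed.

Lemma to_weyl_surj u : {a | u = to_weyl a}.
Proof. by exists (repr (u : Quotient.quot weyl_idealb)); rewrite /to_weyl reprK. Qed.

Fact to_weyl_is_zmod_morphism : zmod_morphism to_weyl.
Proof. exact: (raddfB (\pi_(Quotient.quot weyl_idealb))). Qed.
HB.instance Definition _ := GRing.isZmodMorphism.Build _ _ to_weyl
  to_weyl_is_zmod_morphism.

Let rep (u : weyl) : weyl_free := sval (to_weyl_surj u).
Let repK u : to_weyl (rep u) = u.
Proof. by rewrite /rep; case: to_weyl_surj. Qed.

Definition weyl_one := to_weyl 1.
Definition weyl_mul (u v : weyl) := to_weyl (rep u * rep v).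
Definition weyl_scale (c : K) (u : weyl) := to_weyl (c *: rep u).

Fact to_weyl_mul a b : weyl_mul (to_weyl a) (to_weyl b) = to_weyl (a * b).
Proof.
apply/to_weyl_eq; set a' := rep _; set b' := rep _.
have Ia : weyl_ideal (a' - a) by apply/to_weyl_eq; rewrite repK.
have Ib : weyl_ideal (b' - b) by apply/to_weyl_eq; rewrite repK.
have -> : a' * b' - a * b = (a' - a) * b' - (a * (b - b')).
  by rewrite mulrBl mulrBr opprB addrA addrNK.
apply: weyl_ideal_B; first exact: weyl_ideal_Mr.
apply: weyl_ideal_Ml; rewrite -opprB -[X in weyl_ideal X]sub0r.
exact: (weyl_ideal_B weyl_ideal_0).
Qed.

Fact to_weyl_scale c a : weyl_scale c (to_weyl a) = to_weyl (c *: a).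
Proof.
apply/to_weyl_eq; rewrite -scalerBr -mulr_algl; apply: weyl_ideal_Ml.
by apply/to_weyl_eq; rewrite repK.
Qed.

Fact weyl_mulA : associative weyl_mul.
Proof.
move=> u v w; rewrite -[u]repK -[v]repK -[w]repK.
by rewrite !to_weyl_mul mulrA.
Qed.
Fact weyl_mul1 : left_id weyl_one weyl_mul.
Proof. by move=> u; rewrite -[u]repK to_weyl_mul mul1r. Qed.
Fact weyl_mulr1 : right_id weyl_one weyl_mul.
Proof. by move=> u; rewrite -[u]repK to_weyl_mul mulr1. Qed.
Fact weyl_mulDl : left_distributive weyl_mul +%R.
Proof.
move=> u v w; rewrite -[u]repK -[v]repK -[w]repK.
by rewrite -raddfD !to_weyl_mul mulrDl raddfD.
Qed.
Fact weyl_mulDr : right_distributive weyl_mul +%R.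
Proof.
move=> u v w; rewrite -[u]repK -[v]repK -[w]repK.
by rewrite -raddfD !to_weyl_mul mulrDr raddfD.
Qed.
Fact weyl_one_neq0 : weyl_one != 0.
Proof.
apply/eqP; rewrite -(raddf0 to_weyl) => /to_weyl_eq.
rewrite subr0 => /(@free_act_ideal 1 1) /eqP.
by rewrite free_act1 oner_eq0.
Qed.
HB.instance Definition _ := GRing.Zmodule_isNzRing.Build weyl
  weyl_mulA weyl_mul1 weyl_mulr1 weyl_mulDl weyl_mulDr weyl_one_neq0.

Fact to_weyl_is_monoid_morphism : monoid_morphism to_weyl.
Proof. by split=> [|a b]; [|exact: esym (to_weyl_mul a b)]. Qed.
HB.instance Definition _ := GRing.isMonoidMorphism.Build _ _ to_weyl
  to_weyl_is_monoid_morphism.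

Fact weyl_scaleA c d u : weyl_scale c (weyl_scale d u) = weyl_scale (c * d) u.
Proof. by rewrite -[u]repK !to_weyl_scale scalerA. Qed.
Fact weyl_scale1 : left_id 1 weyl_scale.
Proof. by move=> u; rewrite -[u]repK to_weyl_scale scale1r. Qed.
Fact weyl_scaleDr : right_distributive weyl_scale +%R.
Proof.
move=> c u v; rewrite -[u]repK -[v]repK.
by rewrite -raddfD !to_weyl_scale scalerDr raddfD.
Qed.
Fact weyl_scaleDl u : {morph weyl_scale^~ u : c d / c + d}.
Proof. by move=> c d; rewrite -[u]repK !to_weyl_scale scalerDl raddfD. Qed.
HB.instance Definition _ := GRing.Zmodule_isLmodule.Build K weyl
  weyl_scaleA weyl_scale1 weyl_scaleDr weyl_scaleDl.

Fact to_weyl_is_scalable : scalable to_weyl.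
Proof. by move=> c a; rewrite -to_weyl_scale. Qed.
HB.instance Definition _ := GRing.isScalable.Build K _ _ _ to_weyl
  to_weyl_is_scalable.

Lemma to_weylM a b : to_weyl (a * b) = to_weyl a * to_weyl b.
Proof. exact: rmorphM. Qed.
Lemma to_weylZ c a : to_weyl (c *: a) = c *: to_weyl a.
Proof. exact: linearZ. Qed.

Fact weyl_scaleAl (c : K) (u v : weyl) : c *: (u * v) = (c *: u) * v.
Proof.
rewrite -[u]repK -[v]repK -to_weylM -to_weylZ scalerAl.
by rewrite to_weylM to_weylZ.
Qed.
HB.instance Definition _ := GRing.Lmodule_isLalgebra.Build K weyl weyl_scaleAl.

Fact free_scaleU (c d : K) w :
  c *: (mkmalgU w d : weyl_free) = mkmalgU w (c * d).
Proof.
apply/malgP => z; apply: etrans (monalg.mcoeffZ _ _ _) _.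
apply: etrans (congr1 _ (monalg.mcoeffU _ _ _)) _; rewrite mulrnAr.
exact: esym (monalg.mcoeffU _ _ _).
Qed.

Fact free_scaleAr c (a b : weyl_free) : c *: (a * b) = a * (c *: b).
Proof.
rewrite (malgMEw (fsubset_refl _) (monalg.msuppZ_le c b)) malgME scaler_sumr.
apply: eq_bigr => w _; rewrite scaler_sumr; apply: eq_bigr => v _.
by apply: etrans (free_scaleU _ _ _) _; rewrite monalg.mcoeffZ mulrCA.
Qed.

Fact weyl_scaleAr (c : K) (u v : weyl) : c *: (u * v) = u * (c *: v).
Proof.
rewrite -[u]repK -[v]repK -to_weylM -to_weylZ free_scaleAr.
by rewrite to_weylM to_weylZ.
Qed.
HB.instance Definition _ := GRing.Lalgebra_isAlgebra.Build K weyl weyl_scaleAr.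

End Weyl.

Arguments weyl : clear implicits.

(* A_(n,m) as an algebra over k, by restriction of scalars along k -> k(z). *)
Definition weyl_ratfun (k : fieldType) (n m : nat) : Type := weyl (ratfun k m) n.

Section WeylRatFun.
Context {k : fieldType} {n m : nat}.
Implicit Types (c : k) (u v : weyl_ratfun k n m).

HB.instance Definition _ := GRing.NzRing.on (weyl_ratfun k n m).

Definition weyl_ratfun_scale c u : weyl_ratfun k n m :=
  (c%:A : ratfun k m) *: (u : weyl (ratfun k m) n).

Fact weyl_ratfun_scaleA c d u :
  weyl_ratfun_scale c (weyl_ratfun_scale d u) = weyl_ratfun_scale (c * d) u.
Proof. by rewrite /weyl_ratfun_scale scalerA mulr_algl scalerA. Qed.
Fact weyl_ratfun_scale1 : left_id 1 weyl_ratfun_scale.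
Proof. by move=> u; rewrite /weyl_ratfun_scale !scale1r. Qed.
Fact weyl_ratfun_scaleDr : right_distributive weyl_ratfun_scale +%R.
Proof. by move=> c u v; rewrite /weyl_ratfun_scale scalerDr. Qed.
Fact weyl_ratfun_scaleDl u : {morph weyl_ratfun_scale^~ u : c d / c + d}.
Proof. by move=> c d; rewrite /weyl_ratfun_scale !scalerDl. Qed.
HB.instance Definition _ := GRing.Zmodule_isLmodule.Build k (weyl_ratfun k n m)
  weyl_ratfun_scaleA weyl_ratfun_scale1 weyl_ratfun_scaleDr weyl_ratfun_scaleDl.

Fact weyl_ratfun_scaleAl c u v : c *: (u * v) = (c *: u) * v.
Proof. exact: (@scalerAl _ (weyl (ratfun k m) n)). Qed.
HB.instance Definition _ := GRing.Lmodule_isLalgebra.Build k (weyl_ratfun k n m)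
  weyl_ratfun_scaleAl.
Fact weyl_ratfun_scaleAr c u v : c *: (u * v) = u * (c *: v).
Proof. exact: (@scalerAr _ (weyl (ratfun k m) n)). Qed.
HB.instance Definition _ := GRing.Lalgebra_isAlgebra.Build k (weyl_ratfun k n m)
  weyl_ratfun_scaleAr.
End WeylRatFun.

Arguments weyl_ratfun : clear implicits.

(* The monoid M is commutative and written additively. *)
Record alg_action (k : fieldType) (M : nmodType) (L : comAlgType k) := AlgAction {
  act_fun :> M -> {lrmorphism L -> L};
  act_fun0 : act_fun 0 =1 id;
  act_funD : forall s t, act_fun (s + t) =1 act_fun s \o act_fun t
}.

(* Finitely supported families [(x_s)_s] in L, standing for [\sum_s x_s s]. *)
Definition skew (k : fieldType) (M : nmodType) (L : comAlgType k)
  (act : alg_action M L) : Type := malg M L.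

Section Skew.
Context {k : fieldType} {M : nmodType} {L : comAlgType k}.
Variable act : alg_action M L.
Local Notation S := (skew act).
Implicit Types (x y z : S) (s t : M) (f g : L).

HB.instance Definition _ := GRing.Zmodule.on S.

Definition skewU (f : L) (s : M) : S := mkmalgU s f.
Definition skew_coef (s : M) (x : S) : L := monalg.mcoeff s x.
Definition skew_supp (x : S) : {fset M} := monalg.msupp x.

Definition skew_mul x y : S :=
  \sum_(s <- skew_supp x) \sum_(t <- skew_supp y)
    skewU (skew_coef s x * act s (skew_coef t y)) (s + t).

Lemma skewP x y : (forall s, skew_coef s x = skew_coef s y) -> x = y.
Proof. by move/malgP. Qed.

Lemma skew_coefU f s t : skew_coef t (skewU f s) = f *+ (s == t).
Proof. exact: monalg.mcoeffU. Qed.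

Lemma skew_coefB s x y : skew_coef s (x - y) = skew_coef s x - skew_coef s y.
Proof. exact: monalg.mcoeffB. Qed.

Lemma skew_coefD s x y : skew_coef s (x + y) = skew_coef s x + skew_coef s y.
Proof. exact: monalg.mcoeffD. Qed.

Lemma skew_suppP x s : s \notin skew_supp x -> skew_coef s x = 0.
Proof. exact: monalg.mcoeff_outdom. Qed.

Lemma skewE x : x = \sum_(s <- skew_supp x) skewU (skew_coef s x) s.
Proof. exact: monalgE. Qed.

Lemma skewU0 s : skewU 0 s = 0.
Proof. exact: monalg.monalgU0. Qed.

Lemma skewUD f g s : skewU (f + g) s = skewU f s + skewU g s.
Proof. exact: monalg.monalgUD. Qed.

Fact skew_mulEw (d1 d2 : {fset M}) x y :
    fsubset (skew_supp x) d1 -> fsubset (skew_supp y) d2 ->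
  skew_mul x y = \sum_(s <- d1) \sum_(t <- d2)
    skewU (skew_coef s x * act s (skew_coef t y)) (s + t).
Proof.
move=> le1 le2; rewrite /skew_mul (big_fset_incl _ le1) /=.
  apply: eq_bigr => s _; apply: (big_fset_incl _ le2) => t _ /skew_suppP ->.
  by rewrite rmorph0 mulr0 skewU0.
move=> s _ /skew_suppP ->; rewrite big1 // => t _.
by rewrite mul0r skewU0.
Qed.

Fact skew_mulUU f g s t :
  skew_mul (skewU f s) (skewU g t) = skewU (f * act s g) (s + t).
Proof.
rewrite (skew_mulEw monalg.msuppU_le monalg.msuppU_le) !big_seq_fset1.
by rewrite !skew_coefU !eqxx.
Qed.

Fact skew_mulDl : left_distributive skew_mul +%R.
Proof.
move=> x y z; set d := fsetU (skew_supp x) (skew_supp y).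
rewrite (@skew_mulEw d (skew_supp z)) ?fsubset_refl ?monalg.msuppD_le //.
rewrite (@skew_mulEw d (skew_supp z) x) ?fsubset_refl ?fsubsetUl //.
rewrite (@skew_mulEw d (skew_supp z) y) ?fsubset_refl ?fsubsetUr //.
rewrite -big_split; apply: eq_bigr => s _ /=.
rewrite -big_split; apply: eq_bigr => t _ /=.
by rewrite skew_coefD mulrDl skewUD.
Qed.

Fact skew_mulDr : right_distributive skew_mul +%R.
Proof.
move=> z x y; set d := fsetU (skew_supp x) (skew_supp y).
rewrite (@skew_mulEw (skew_supp z) d) ?fsubset_refl ?monalg.msuppD_le //.
rewrite (@skew_mulEw (skew_supp z) d z x) ?fsubset_refl ?fsubsetUl //.
rewrite (@skew_mulEw (skew_supp z) d z y) ?fsubset_refl ?fsubsetUr //.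
rewrite -big_split; apply: eq_bigr => s _ /=.
rewrite -big_split; apply: eq_bigr => t _ /=.
by rewrite skew_coefD rmorphD mulrDr skewUD.
Qed.

Fact skew_mul0l x : skew_mul 0 x = 0.
Proof. by apply: (addrI (skew_mul 0 x)); rewrite -skew_mulDl !addr0. Qed.

Fact skew_mul0r x : skew_mul x 0 = 0.
Proof. by apply: (addrI (skew_mul x 0)); rewrite -skew_mulDr !addr0. Qed.

Lemma skew_ind (P : S -> Prop) : P 0 -> (forall x y, P x -> P y -> P (x + y)) ->
  (forall f s, P (skewU f s)) -> forall x, P x.
Proof. by move=> P0 PD PU x; rewrite [x]skewE; apply: big_ind. Qed.

Fact skew_mulA : associative skew_mul.
Proof.
move=> x y z; elim/skew_ind: x => [|x x' IH IH'|f s].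
- by rewrite !skew_mul0l.
- by rewrite !skew_mulDl IH IH'.
elim/skew_ind: y => [|y y' IH IH'|g t].
- by rewrite !(skew_mul0l, skew_mul0r).
- by rewrite !(skew_mulDl, skew_mulDr) IH IH'.
elim/skew_ind: z => [|z z' IH IH'|h u].
- by rewrite !skew_mul0r.
- by rewrite !skew_mulDr IH IH'.
by rewrite !skew_mulUU rmorphM act_funD /= mulrA addrA.
Qed.

Fact skew_mul1l : left_id (skewU 1 0) skew_mul.
Proof.
elim/skew_ind=> [|x y IH IH'|f s]; first by rewrite skew_mul0r.
  by rewrite skew_mulDr IH IH'.
by rewrite skew_mulUU mul1r add0r act_fun0.
Qed.

Fact skew_mul1r : right_id (skewU 1 0) skew_mul.
Proof.
elim/skew_ind=> [|x y IH IH'|f s]; first by rewrite skew_mul0l.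
  by rewrite skew_mulDl IH IH'.
by rewrite skew_mulUU rmorph1 mulr1 addr0.
Qed.

Fact skew_one_neq0 : skewU 1 0 != 0.
Proof. by rewrite monalg.monalgU_eq0 oner_eq0. Qed.

HB.instance Definition _ := GRing.Zmodule_isNzRing.Build S
  skew_mulA skew_mul1l skew_mul1r skew_mulDl skew_mulDr skew_one_neq0.

Lemma skewUM f g s t : skewU f s * skewU g t = skewU (f * act s g) (s + t).
Proof. exact: skew_mulUU. Qed.

Definition skew_scale (c : k) x : S := skewU c%:A 0 * x.

Fact skew_scaleA c d x : skew_scale c (skew_scale d x) = skew_scale (c * d) x.
Proof. by rewrite /skew_scale mulrA skewUM addr0 act_fun0 mulr_algl scalerA. Qed.
Fact skew_scale1 : left_id 1 skew_scale.
Proof. by move=> x; rewrite /skew_scale scale1r mul1r. Qed.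
Fact skew_scaleDr : right_distributive skew_scale +%R.
Proof. by move=> c x y; rewrite /skew_scale mulrDr. Qed.
Fact skew_scaleDl x : {morph skew_scale^~ x : c d / c + d}.
Proof. by move=> c d; rewrite /skew_scale scalerDl skewUD mulrDl. Qed.
HB.instance Definition _ := GRing.Zmodule_isLmodule.Build k S
  skew_scaleA skew_scale1 skew_scaleDr skew_scaleDl.

Fact skew_scaleAl (c : k) x y : c *: (x * y) = (c *: x) * y.
Proof. exact: mulrA. Qed.
HB.instance Definition _ := GRing.Lmodule_isLalgebra.Build k S skew_scaleAl.

Fact skew_scaleAr (c : k) x y : c *: (x * y) = x * (c *: y).
Proof.
rewrite scalerAl -[c *: y]/(skewU c%:A 0 * y) mulrA; congr (_ * _).
rewrite -[c *: x]/(skewU c%:A 0 * x).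
elim/skew_ind: x => [|x x' IH IH'|f s]; first by rewrite mul0r mulr0.
  by rewrite mulrDl mulrDr IH IH'.
by rewrite !skewUM act_fun0 rmorph_alg addr0 add0r mulrC.
Qed.
HB.instance Definition _ := GRing.Lalgebra_isAlgebra.Build k S skew_scaleAr.

End Skew.

Arguments skewU {k M L act} f s.
Arguments skew_coef {k M L act} s x.
Arguments skew_supp {k M L act} x.

(* The pair (p, e) acts on r variables by t_j |-> (-1)^(e j) t_(p j). *)
Record signed_perm (r : nat) := SignedPerm {
  sp_perm : 'S_r;
  sp_neg : {ffun 'I_r -> bool}
}.

Section SignedPerm.
Context {r : nat}.
Implicit Types g h : signed_perm r.

Let to_pair g := (sp_perm g, sp_neg g).
Let of_pair (u : 'S_r * {ffun 'I_r -> bool}) := SignedPerm u.1 u.2.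
Let to_pairK : cancel to_pair of_pair. Proof. by case. Qed.
HB.instance Definition _ := Finite.copy (signed_perm r) (can_type to_pairK).

(* As for 'S_r, the product g * h is "g, then h". *)
Definition sp_mul g h := SignedPerm (sp_perm g * sp_perm h)%g
  [ffun j => sp_neg g j (+) sp_neg h (sp_perm g j)].
Definition sp_one := @SignedPerm r 1%g [ffun=> false].
Definition sp_inv g := SignedPerm (sp_perm g)^-1%g
  [ffun j => sp_neg g ((sp_perm g)^-1%g j)].

Lemma signed_permP g h : sp_perm g = sp_perm h -> sp_neg g =1 sp_neg h -> g = h.
Proof. by case: g h => [p e] [q f] /= -> /ffunP ->. Qed.

Fact sp_mulA : associative sp_mul.
Proof.
move=> f g h; apply: signed_permP => [|j]; first exact: mulgA.
by rewrite !ffunE permM addbA.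
Qed.
Fact sp_mul1 : left_id sp_one sp_mul.
Proof.
move=> g; apply: signed_permP => [|j]; first exact: mul1g.
by rewrite !ffunE perm1.
Qed.
Fact sp_mulV : left_inverse sp_one sp_inv sp_mul.
Proof.
move=> g; apply: signed_permP => [|j]; first exact: mulVg.
by rewrite !ffunE addbb.
Qed.
HB.instance Definition _ := Finite_isGroup.Build (signed_perm r)
  sp_mulA sp_mul1 sp_mulV.

End SignedPerm.

Variant classical_type := TypeS | TypeB | TypeD.

Definition classical_set (c : classical_type) (r : nat) : {set signed_perm r} :=
  match c with
  | TypeS => [set g | [forall j, ~~ sp_neg g j]]
  | TypeB => [set: signed_perm r]
  | TypeD => [set g | ~~ odd #|[set j | sp_neg g j]|]
  end.

Fact classical_group_set c r : group_set (classical_set c r).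
Proof.
have parE (e : 'I_r -> bool) : odd #|[set j | e j]| = \big[addb/false]_j e j.
  rewrite cardsE -sum1_card big_mkcond /= (big_morph odd oddD (erefl _)).
  by apply: eq_bigr => j _; rewrite unfold_in /=; case: (e j).
case: c => /=; last 1 first.
- apply/group_setP; split=> [|g h]; rewrite !inE !parE.
    by rewrite big1 // => j _; rewrite ffunE.
  move=> ge he; under eq_bigr do rewrite ffunE.
  rewrite big_split /= (negbTE ge) /=.
  by move: he; rewrite (reindex_inj (@perm_inj _ (sp_perm g))).
- apply/group_setP; split=> [|g h]; rewrite !inE.
    by apply/forallP => j; rewrite ffunE.
  move=> /forallP ge /forallP he; apply/forallP => j.
  by rewrite ffunE (negbTE (ge _)) (negbTE (he _)).
exact: groupP.
Qed.
Definition classical_group c r := Group (classical_group_set c r).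

Definition reflection_group N (n_ : 'I_N -> nat) (cl : 'I_N -> classical_type) :
    {group {dffun forall s, signed_perm (n_ s)}} :=
  [group of setXn (fun s => classical_group (cl s) (n_ s))].

Section ShiftsAndReflections.
Context {k : fieldType} {N : nat} {n_ : 'I_N -> nat} {m : nat}.
Local Notation n := (\sum_(s < N) n_ s)%N.
Local Notation L := (ratfun k (n + m)).
Local Notation M := 'rV[int]_n.
Local Notation W := {dffun forall s : 'I_N, signed_perm (n_ s)}.
Implicit Types (v w : M) (g h : W) (a b : 'I_n).

(* The variable t_(s,j) is 'X_(lshift m a) with a = tagnat.Rank s j, and z_l is
   'X_(rshift n l). *)

Definition shift_img v (i : 'I_(n + m)) : {mpoly k[n + m]} :=
  match split i with
  | inl a => 'X_i - (v 0 a)%:~R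
  | inr _ => 'X_i
  end.

Fact shift_imgD v w i :
  mpoly_subst (shift_img w) (shift_img v i) = shift_img (v + w) i.
Proof.
rewrite {2 3}/shift_img; case E: (split i) => [a|b].
  rewrite rmorphB rmorph_int /= mpoly_substX /shift_img E mxE rmorphD /=.
  by rewrite opprD addrA addrAC.
by rewrite mpoly_substX /shift_img E.
Qed.

Fact shift_img0 i : shift_img 0 i = 'X_i.
Proof. by rewrite /shift_img; case: (split i) => // a; rewrite mxE subr0. Qed.

Fact shift_inj v : injective (mpoly_subst (shift_img v)).
Proof.
apply: (can_inj (g := mpoly_subst (shift_img (- v)))); apply: mpoly_substK => i.
by rewrite shift_imgD subrr shift_img0.
Qed.

Definition shift v : L -> L := ratfun_map (@shift_inj v).
HB.instance Definition _ v := GRing.LRMorphism.on (shift v).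

Lemma shiftX v i : shift v (to_ratfun 'X_i) = to_ratfun (shift_img v i).
Proof. by rewrite [LHS]ratfun_map_to_ratfun /= mpoly_substX. Qed.

Fact shift0 : shift 0 =1 id.
Proof.
apply: (@ratfun_lrmorph_ext _ _ (shift 0) idfun) => i.
by rewrite /= shiftX shift_img0.
Qed.

Fact shiftD v w : shift (v + w) =1 shift v \o shift w.
Proof.
apply: (@ratfun_lrmorph_ext _ _ (shift (v + w)) (shift v \o shift w)) => i.
rewrite /= !shiftX [RHS]ratfun_map_to_ratfun /=.
by rewrite shift_imgD addrC.
Qed.

Definition shift_action : alg_action M L := @AlgAction k M L (fun v => shift v) shift0 shiftD.

(* With flat indices, g maps t_a to (-1)^(refl_neg g a) t_(refl_idx g a). *)
Definition refl_pair g (p : {s : 'I_N & 'I_(n_ s)}) : {s : 'I_N & 'I_(n_ s)} :=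
  Tagged (fun s => 'I_(n_ s)) (sp_perm (g (tag p)) (tagged p)).
Definition refl_idx g a : 'I_n := tagnat.rank (refl_pair g (tagnat.sig a)).
Definition refl_neg g a : bool :=
  sp_neg (g (tag (tagnat.sig a))) (tagged (tagnat.sig a)).

Definition refl_img g (i : 'I_(n + m)) : {mpoly k[n + m]} :=
  match split i with
  | inl a => (-1) ^+ refl_neg g a * 'X_(lshift m (refl_idx g a))
  | inr _ => 'X_i
  end.

Fact refl_idxM g h a : refl_idx (g * h)%g a = refl_idx h (refl_idx g a).
Proof.
rewrite /refl_idx tagnat.rankK; congr tagnat.rank.
by rewrite /refl_pair /= ffunE permM.
Qed.

Fact refl_negM g h a :
  refl_neg (g * h)%g a = refl_neg g a (+) refl_neg h (refl_idx g a).
Proof. by rewrite /refl_neg /refl_idx tagnat.rankK /= !ffunE. Qed.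

Fact refl_idx1 a : refl_idx 1%g a = a.
Proof.
rewrite /refl_idx /refl_pair -[RHS]tagnat.sigK; congr tagnat.rank.
by case: (tagnat.sig a) => s j /=; rewrite ffunE perm1.
Qed.

Fact refl_neg1 a : refl_neg 1%g a = false.
Proof. by rewrite /refl_neg !ffunE. Qed.

Fact refl_imgM g h i :
  mpoly_subst (refl_img h) (refl_img g i) = refl_img (g * h)%g i.
Proof.
rewrite {2 3}/refl_img; case E: (split i) => [a|b].
  rewrite rmorphM rmorphXn rmorphN1 /= mpoly_substX /refl_img.
  by rewrite (unsplitK (inl _)) mulrA -signr_addb refl_negM refl_idxM.
by rewrite mpoly_substX /refl_img E.
Qed.

Fact refl_img1 i : refl_img 1%g i = 'X_i.
Proof.
rewrite /refl_img; case E: (split i) => [a|//].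
rewrite refl_neg1 mul1r refl_idx1; congr 'X_ _.
by rewrite -[RHS]splitK E.
Qed.

Fact refl_inj g : injective (mpoly_subst (refl_img g)).
Proof.
apply: (can_inj (g := mpoly_subst (refl_img g^-1%g))); apply: mpoly_substK => i.
by rewrite refl_imgM mulgV refl_img1.
Qed.

Definition refl g : L -> L := ratfun_map (@refl_inj g).
HB.instance Definition _ g := GRing.LRMorphism.on (refl g).

Lemma reflX g i : refl g (to_ratfun 'X_i) = to_ratfun (refl_img g i).
Proof. by rewrite [LHS]ratfun_map_to_ratfun /= mpoly_substX. Qed.

Lemma refl1 : refl 1%g =1 id.
Proof.
apply: (@ratfun_lrmorph_ext _ _ (refl 1%g) idfun) => i.
by rewrite /= reflX refl_img1.
Qed.

Lemma reflM g h : refl (g * h)%g =1 refl h \o refl g.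
Proof.
apply: (@ratfun_lrmorph_ext _ _ (refl (g * h)%g) (refl h \o refl g)) => i.
rewrite /= !reflX [RHS]ratfun_map_to_ratfun /=.
by rewrite refl_imgM.
Qed.

(* The conjugation action of g on Z^n (see refl_conj): it maps the generator
   sigma_a to sigma_(refl_idx g a), or to its inverse if refl_neg g a. *)
Definition refl_shift g v : M :=
  \row_b let a := refl_idx g^-1%g b in (-1) ^+ refl_neg g a * v 0 a.

Lemma refl_conj g v f : refl g (shift v f) = shift (refl_shift g v) (refl g f).
Proof.
move: f; apply: (@ratfun_lrmorph_ext _ _ (refl g \o shift v)
  (shift (refl_shift g v) \o refl g)) => i.
rewrite /= shiftX reflX [LHS]ratfun_map_to_ratfun [RHS]ratfun_map_to_ratfun /=.
congr to_ratfun.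
rewrite [shift_img v i]/shift_img [refl_img g i]/refl_img; case E: (split i) => [a|b].
  rewrite rmorphB rmorph_int /= mpoly_substX {1}/refl_img E.
  rewrite rmorphM rmorphXn rmorphN1 /= mpoly_substX /shift_img (unsplitK (inl _)).
  rewrite mxE /= -refl_idxM mulgV refl_idx1 mulrBr; congr (_ - _).
  by rewrite rmorphM rmorphXn rmorphN1 signrMK.
by rewrite !mpoly_substX /refl_img /shift_img E.
Qed.

End ShiftsAndReflections.

Inductive subalg_gen (k : fieldType) (A : algType k) (P : A -> Prop) : A -> Prop :=
| subalg_gen_base a : P a -> subalg_gen P a
| subalg_gen_1 : subalg_gen P 1
| subalg_gen_P c a b :
    subalg_gen P a -> subalg_gen P b -> subalg_gen P (c *: a + b)
| subalg_gen_M a b : subalg_gen P a -> subalg_gen P b -> subalg_gen P (a * b).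

Section Galois.
Context {k : fieldType} {M : nmodType} {L : comUnitAlgType k}.
Context {act : alg_action M L} {gT : finGroupType}.
(* The action gL of G on L and its action gM on M by conjugation are given
   separately; L is meant to be a field. *)
Variables (G : {set gT}) (gL : gT -> L -> L) (gM : gT -> M -> M).
Local Notation S := (skew act).

Definition fixed_field (f : L) : Prop := forall g, g \in G -> gL g f = f.

Definition skew_gact (g : gT) (x : S) : S :=
  \sum_(s <- skew_supp x) skewU (gL g (skew_coef s x)) (gM g s).

Definition skew_fixed (x : S) : Prop := forall g, g \in G -> skew_gact g x = x.

Definition skewC (f : L) : S := skewU f 0.

(* U is given by an embedding j into the skew monoid algebra. Gamma and K are
   subsets of L: galois_frac says that K = L^G is the field of fractions of
   Gamma, galois_KU and galois_UK that KU and UK (finite sums of products) are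
   the whole fixed subalgebra. *)
Record galois_algebra (Gamma : L -> Prop) (U : algType k)
    (j : {lrmorphism U -> S}) : Prop := GaloisAlgebra {
  galois_frac : forall f, fixed_field f <->
    exists a b, [/\ Gamma a, Gamma b, b != 0 & f = a / b];
  galois_inj : injective j;
  galois_fixed : forall u, skew_fixed (j u);
  galois_fingen : exists gens : seq S, forall x,
    (exists u, x = j u) <->
    subalg_gen (fun y => (exists2 f, Gamma f & y = skewC f) \/ y \in gens) x;
  galois_KU : forall x, skew_fixed x <-> exists r : seq (L * U),
    {in r, forall fu, fixed_field fu.1} /\
    x = \sum_(fu <- r) skewC fu.1 * j fu.2;
  galois_UK : forall x, skew_fixed x <-> exists r : seq (L * U),
    {in r, forall fu, fixed_field fu.1} /\
    x = \sum_(fu <- r) j fu.2 * skewC fu.1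
}.

End Galois.

Definition polynomial_subalg (k : fieldType) (A : comAlgType k)
    (Gamma : A -> Prop) : Prop :=
  exists (d : nat) (phi : {lrmorphism {mpoly k[d]} -> A}),
    injective phi /\ forall a, Gamma a <-> exists p, a = phi p.

Definition shift_skew (k : fieldType) (N : nat) (n_ : 'I_N -> nat) (m : nat) :=
  skew (@shift_action k N n_ m).

Definition linear_galois_algebra (k : fieldType) (N : nat) (n_ : 'I_N -> nat)
    (m : nat) (cl : 'I_N -> classical_type) (U : algType k)
    (j : {lrmorphism U -> shift_skew k n_ m}) : Prop :=
  exists Gamma, polynomial_subalg Gamma /\
    galois_algebra (reflection_group n_ cl) refl refl_shift Gamma j.

Definition skew_field (D : unitRingType) : Prop :=
  forall d : D, d != 0 -> d \is a GRing.unit.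

(* Fractions on both sides, for two-sided Ore domains. *)
Record skew_field_of_fractions (A : nzRingType) (D : unitRingType)
    (i : {rmorphism A -> D}) : Prop := SkewFieldOfFractions {
  sff_skew_field : skew_field D;
  sff_inj : injective i;
  sff_right : forall d, exists a b, b != 0 /\ d = i a / i b;
  sff_left : forall d, exists a b, b != 0 /\ d = (i b)^-1 * i a
}.

(* Main.v *)
(* Let E be the skew field of fractions of the Ore domain S = L * M, and x_a the
   generators of M, so that t_a x_b - x_b t_a = delta_ab x_b. A fraction fixed by
   G is a quotient of fixed elements of S: multiply numerator and denominator by
   an element of C[t] for which the trace of the denominator is nonzero (one
   exists by Dedekind independence), and take traces. The fixed elements of S
   have common denominators in Gamma, which is contained in U; hence E^G is the
   skew field of fractions of U. On the other hand C(z)(x)^G = C(z)(y) for n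
   explicit invariants y_i. The derivations [t_a, -] have an invertible Jacobian
   matrix on the y_i, and the entries c_ai of its inverse give G-invariant
   elements d_i = sum_a c_ai t_a, which act as the partial derivatives in y_i. So
   the y_i and d_i define an embedding of the Weyl algebra over C(z) in E^G, and
   by the same trace argument E^G is the skew field of fractions of its image. *)

Require Import Defs.
From HB Require Import structures.
From mathcomp Require Import all_boot all_order all_algebra all_fingroup.
From mathcomp Require Import boolp finmap.
From mathcomp Require Import -(notations) monalg.
From mathcomp Require Import mpoly.
From mathcomp Require Import ring zify.
From mathcomp Require Import reals complex.

Set Implicit Arguments.
Unset Strict Implicit.
Unset Printing Implicit Defensive.

Import Order.TTheory GRing.Theory Num.Theory.
Local Open Scope ring_scope.

(** * Skew fields of fractions of Ore domains *)

(** The point of view is that of differential operators in the shift generators: [[t_a, -]] acts on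
    C(z)(x) as x_a d/dx_a, so t_a is a logarithmic vector field, and a sign change of t_a inverts
    x_a. The group therefore acts on the commutative field C(z)(x) by permuting and inverting the
    coordinates of a torus, and the noncommutative question rests on a commutative one, the
    rationality of C(z)(x)^G. For types S and B the symmetric functions of the x_a, respectively of
    the x_a + 1/x_a, generate this field. Type D is the delicate case, since there the latter only
    generate a subfield of index 2. No isomorphism has to be constructed: U and the Weyl algebra are
    embedded in the same skew field E^G, and each is shown to have it as skew field of fractions.
    Plain averaging does not reach fractions, because the trace of a nonzero denominator may vanish.
    The t_a repair this: distinct elements of G already differ on them, and all their images under G
    commute, which is what Dedekind's argument needs in a skew field. *)

Record ore_domain (k : fieldType) := OreDomain {
  ore_alg :> algType k;
  ore_mulf_eq0 : forall a b : ore_alg, a * b = 0 -> a = 0 \/ b = 0;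
  ore_right : forall a b : ore_alg, b != 0 ->
    exists c d, c != 0 /\ a * c = b * d;
  ore_left : forall a b : ore_alg, b != 0 ->
    exists c d, c != 0 /\ c * a = d * b
}.

Section OreFractions.
Context {k : fieldType} {A : ore_domain k}.
Implicit Types a b c x y z : A.

Lemma ore_mulf_neq0 a b : a != 0 -> b != 0 -> a * b != 0.
Proof. by move=> a0 b0; apply/eqP => /ore_mulf_eq0[]; apply/eqP. Qed.

Lemma ore_mulIf c a b : c != 0 -> a * c = b * c -> a = b.
Proof.
move=> c0 e; have /ore_mulf_eq0[/subr0_eq//|/eqP] : (a - b) * c = 0.
  by rewrite mulrBl e subrr.
by rewrite (negbTE c0).
Qed.

Lemma ore_mulfI c a b : c != 0 -> c * a = c * b -> a = b.
Proof.
move=> c0 e; have /ore_mulf_eq0[/eqP|/subr0_eq//] : c * (a - b) = 0.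
  by rewrite mulrBr e subrr.
by rewrite (negbTE c0).
Qed.

(* The graph [{(x, y) | y = q x}] of left multiplication by [q = y0 / x0]; a
   fraction is represented by this graph. *)
Definition ore_line x0 y0 x y : Prop :=
  exists c d, [/\ d != 0, x * d = x0 * c & y * d = y0 * c].

Definition ore_frac : Type :=
  {q : A -> A -> Prop | exists x0 y0, x0 != 0 /\ q = ore_line x0 y0}.
HB.instance Definition _ := gen_eqMixin ore_frac.
HB.instance Definition _ := gen_choiceMixin ore_frac.
Implicit Types q r s : ore_frac.

Definition graph q : A -> A -> Prop := sval q.

Lemma graphMr q x y c : graph q x y -> graph q (x * c) (y * c).
Proof.
case: q => q [x0 [y0 [x00 /= ->]]] [c' [d [d0 ex ey]]].
have [e [f [e0 ef]]] := ore_right c d0.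
by exists (c' * f), e; split=> //; rewrite -mulrA ef !mulrA (ex, ey).
Qed.

Lemma graphMI q x y c : c != 0 -> graph q (x * c) (y * c) -> graph q x y.
Proof.
case: q => q [x0 [y0 [x00 /= ->]]] c0 [c' [d [d0 ex ey]]].
by exists c', (c * d); split; rewrite ?ore_mulf_neq0 ?mulrA.
Qed.

Lemma graph_fun q x y y' : graph q x y -> graph q x y' -> y = y'.
Proof.
case: q => q [x0 [y0 [x00 /= ->]]] [c [d [d0 ex ey]]] [c' [d' [d'0 ex' ey']]].
have [e [f [e0 ef]]] := ore_right d d'0.
apply: (@ore_mulIf (d * e)); first exact: ore_mulf_neq0.
rewrite {2}ef !mulrA ey ey' -!mulrA; congr (_ * _).
by apply: (ore_mulfI x00); rewrite !mulrA -ex -ex' -!mulrA ef.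
Qed.

Lemma graphD q x y x' y' :
  graph q x y -> graph q x' y' -> graph q (x + x') (y + y').
Proof.
case: q => q [x0 [y0 [x00 /= ->]]] [c [d [d0 ex ey]]] [c' [d' [d'0 ex' ey']]].
have [e [f [e0 ef]]] := ore_right d d'0.
exists (c * e + c' * f), (d * e); split; first exact: ore_mulf_neq0.
  by rewrite mulrDl {2}ef !mulrDr !mulrA ex ex'.
by rewrite mulrDl {2}ef !mulrDr !mulrA ey ey'.
Qed.

(** By the right Ore condition the domain of a fraction is an essential right ideal: it contains
    [a * c] for some nonzero [c]. Repeating this gives a nonzero point in the common domain of
    several fractions. *)
Lemma graph_dom q a : exists c y, c != 0 /\ graph q (a * c) y.
Proof.
case: q => q [x0 [y0 [x00 /= ->]]].
have [c [d [c0 e]]] := ore_right a x00.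
by exists c, (y0 * d); split=> //; exists d, 1; rewrite oner_neq0 !mulr1.
Qed.

(** Graphs are right linear, and every [a * c] in the domain has a common right multiple with [x],
    so one nonzero point determines a fraction. The identities between fractions below, ring axioms
    included, are checked by evaluating both sides at such a point. *)
Lemma graph_ext q r x y : x != 0 -> graph q x y -> graph r x y -> q = r.
Proof.
move=> x0; have sub q' r' : graph q' x y -> graph r' x y ->
    forall a b, graph q' a b -> graph r' a b.
  move=> qxy rxy a b qab; have [c [y' [c0 ry']]] := graph_dom r' a.
  have [e [f [e0 ef]]] := ore_right (a * c) x0.
  have := graph_fun (graphMr (c * e) qab); rewrite !mulrA ef.
  move=> /(_ _ (graphMr f qxy)) bce.
  have := graph_fun (graphMr e ry'); rewrite ef => /(_ _ (graphMr f rxy)) y'e.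
  apply: (graphMI c0); suff -> : b * c = y' by [].
  by apply: (ore_mulIf e0); rewrite bce y'e.
move=> qxy rxy; have {sub} qr : graph q = graph r.
  by apply/funext => a; apply/funext => b; apply/propext; split; apply: sub.
by move: qr {qxy rxy}; case: q r => q hq [r hr]; apply: eq_exist.
Qed.

(** The second branch is a default value, the zero fraction, which makes the operation total. *)
Definition mk_frac x y : ore_frac :=
  if pselect (x != 0) is left x0
  then exist _ (ore_line x y) (ex_intro _ x (ex_intro _ y (conj x0 erefl)))
  else exist _ (ore_line 1 0)
    (ex_intro _ 1 (ex_intro _ 0 (conj (oner_neq0 _) erefl))).

Lemma graph_mk x y : x != 0 -> graph (mk_frac x y) x y.
Proof.
rewrite /mk_frac; case: pselect => // x0 _.
by exists 1, 1; rewrite oner_neq0.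
Qed.

Lemma graph_mk1 a x : graph (mk_frac 1 a) x (a * x).
Proof. by have := graphMr x (graph_mk a (oner_neq0 A)); rewrite mul1r. Qed.

Lemma graph_ex q : exists x y, x != 0 /\ graph q x y.
Proof.
have [c [y [c0 qcy]]] := graph_dom q 1.
by exists c, y; rewrite mul1r in qcy.
Qed.

Lemma graph_ex2 q r : exists x y z, [/\ x != 0, graph q x y & graph r x z].
Proof.
have [x [y [x0 qxy]]] := graph_ex q.
have [c [z [c0 rz]]] := graph_dom r x.
by exists (x * c), (y * c), z; rewrite ore_mulf_neq0 //; split=> //; apply: graphMr.
Qed.

Lemma graph_ex_comp q r : exists x y z, [/\ x != 0, graph r x y & graph q y z].
Proof.
have [x [y [x0 rxy]]] := graph_ex r.
have [c [z [c0 qz]]] := graph_dom q y.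
by exists (x * c), (y * c), z; rewrite ore_mulf_neq0 //; split=> //; apply: graphMr.
Qed.

(** The operations are specified by their effect on graphs. One common nonzero point [x0] defines
    the result, and right linearity carries the property to the rest of the common domain. *)
Fact add_ex q r : exists p : ore_frac, forall x y z,
  graph q x y -> graph r x z -> graph p x (y + z).
Proof.
have [x0 [y0 [z0 [x0n q0 r0]]]] := graph_ex2 q r.
exists (mk_frac x0 (y0 + z0)) => x y z qxy rxz.
have [e [f [e0 ef]]] := ore_right x x0n.
apply: (graphMI e0); rewrite ef mulrDl.
have := graphMr e qxy; rewrite ef => /graph_fun/(_ (graphMr f q0)) ->.
have := graphMr e rxz; rewrite ef => /graph_fun/(_ (graphMr f r0)) ->.
by rewrite -mulrDl; apply: graphMr; apply: graph_mk.
Qed.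

Fact mul_ex q r : exists p : ore_frac, forall x y z,
  graph r x y -> graph q y z -> graph p x z.
Proof.
have [x0 [y0 [z0 [x0n r0 q0]]]] := graph_ex_comp q r.
exists (mk_frac x0 z0) => x y z rxy qyz.
have [e [f [e0 ef]]] := ore_right x x0n.
apply: (graphMI e0); rewrite ef.
have := graphMr e rxy; rewrite ef => /graph_fun/(_ (graphMr f r0)) ye.
have := graphMr e qyz; rewrite ye => /graph_fun/(_ (graphMr f q0)) ->.
by apply: graphMr; apply: graph_mk.
Qed.

Fact opp_ex q : exists p : ore_frac, forall x y,
  graph q x y -> graph p x (- y).
Proof.
have [x0 [y0 [x0n q0]]] := graph_ex q.
exists (mk_frac x0 (- y0)) => x y qxy.
have [e [f [e0 ef]]] := ore_right x x0n.
apply: (graphMI e0); rewrite ef mulNr.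
have := graphMr e qxy; rewrite ef => /graph_fun/(_ (graphMr f q0)) ->.
by rewrite -mulNr; apply: graphMr; apply: graph_mk.
Qed.

(** [mk_frac 1 0] is the zero of the ring to come, and is its own inverse by the convention of unit
    rings. Otherwise inversion exchanges the two coordinates of the graph. *)
Fact inv_ex q : exists p : ore_frac,
  if q == mk_frac 1 0 then p = q else forall x y, graph q x y -> graph p y x.
Proof.
case: eqP => [_|/eqP q0]; first by exists q.
have [x0 [y0 [x0n q0']]] := graph_ex q.
have y0n : y0 != 0.
  apply: contra q0 => /eqP y0E; apply/eqP/(graph_ext x0n q0').
  by rewrite y0E -[X in graph _ _ X](mul0r x0); apply: graph_mk1.
exists (mk_frac y0 x0) => x y qxy.
have [e [f [e0 ef]]] := ore_right x x0n.
apply: (graphMI e0); rewrite ef.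
have := graphMr e qxy; rewrite ef => /graph_fun/(_ (graphMr f q0')) ->.
by apply: graphMr; apply: graph_mk.
Qed.

Definition frac_add q r := sval (cid (add_ex q r)).
Definition frac_mul q r := sval (cid (mul_ex q r)).
Definition frac_opp q := sval (cid (opp_ex q)).
Definition frac_inv q := sval (cid (inv_ex q)).
Definition to_frac a := mk_frac 1 a.

Lemma graph_add q r x y z : graph q x y -> graph r x z ->
  graph (frac_add q r) x (y + z).
Proof. by rewrite /frac_add; case: cid => /= p; apply. Qed.
Lemma graph_mul q r x y z : graph r x y -> graph q y z ->
  graph (frac_mul q r) x z.
Proof. by rewrite /frac_mul; case: cid => /= p; apply. Qed.
Lemma graph_opp q x y : graph q x y -> graph (frac_opp q) x (- y).
Proof. by rewrite /frac_opp; case: cid => /= p; apply. Qed.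
Lemma graph_to_frac a x : graph (to_frac a) x (a * x).
Proof. exact: graph_mk1. Qed.
Lemma graph_to_frac0 x : graph (to_frac 0) x 0.
Proof. by have := graph_to_frac 0 x; rewrite mul0r. Qed.
Lemma graph_ex3 p q r : exists x y z w,
  [/\ x != 0, graph p x y, graph q x z & graph r x w].
Proof.
have [x [y [z [x0 qxy rxz]]]] := graph_ex2 p q.
have [c [w [c0 rw]]] := graph_dom r x.
exists (x * c), (y * c), (z * c), w; rewrite ore_mulf_neq0 //.
by split=> //; apply: graphMr.
Qed.

Fact frac_addA : associative frac_add.
Proof.
move=> p q r; have [x [y [z [w [x0 py qz rw]]]]] := graph_ex3 p q r.
apply: (graph_ext x0 (graph_add py (graph_add qz rw))).
by rewrite addrA; apply/graph_add/rw/graph_add.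
Qed.
Fact frac_addC : commutative frac_add.
Proof.
move=> p q; have [x [y [z [x0 py qz]]]] := graph_ex2 p q.
by apply: (graph_ext x0 (graph_add py qz)); rewrite addrC; apply: graph_add.
Qed.
Fact frac_add0 : left_id (to_frac 0) frac_add.
Proof.
move=> p; have [x [y [x0 py]]] := graph_ex p; apply: (graph_ext x0 _ py).
by rewrite -[y]add0r; apply: graph_add => //; apply: graph_to_frac0.
Qed.
Fact frac_addN : left_inverse (to_frac 0) frac_opp frac_add.
Proof.
move=> p; have [x [y [x0 py]]] := graph_ex p.
apply: (graph_ext x0 (graph_add (graph_opp py) py)).
by rewrite addNr; apply: graph_to_frac0.
Qed.
HB.instance Definition _ := GRing.isZmodule.Build ore_frac
  frac_addA frac_addC frac_add0 frac_addN.

Fact frac_mulA : associative frac_mul.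
Proof.
move=> p q r; have [x [y [z [x0 ry qz]]]] := graph_ex_comp q r.
have [c [w [c0 pw]]] := graph_dom p z.
have xc0 : x * c != 0 by exact: ore_mulf_neq0.
have {}ry := graphMr c ry; have {}qz := graphMr c qz.
apply: (graph_ext xc0 (graph_mul (graph_mul ry qz) pw)).
exact: graph_mul ry (graph_mul qz pw).
Qed.
Fact frac_mul1l : left_id (to_frac 1) frac_mul.
Proof.
move=> p; have [x [y [x0 py]]] := graph_ex p; apply: (graph_ext x0 _ py).
by apply: (graph_mul py); have := graph_to_frac 1 y; rewrite mul1r.
Qed.
Fact frac_mul1r : right_id (to_frac 1) frac_mul.
Proof.
move=> p; have [x [y [x0 py]]] := graph_ex p; apply: (graph_ext x0 _ py).
by apply: (graph_mul _ py); have := graph_to_frac 1 x; rewrite mul1r.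
Qed.
Fact frac_mulDl : left_distributive frac_mul +%R.
Proof.
move=> p q r; have [x [y [x0 ry]]] := graph_ex r.
have [c [z [c0 pz]]] := graph_dom p y.
have [d [w [d0 qw]]] := graph_dom q (y * c).
have xc0 : x * c * d != 0 by rewrite !ore_mulf_neq0.
have {}ry := graphMr d (graphMr c ry); have {}pz := graphMr d pz.
apply: (graph_ext xc0 (graph_mul ry (graph_add pz qw))).
exact: graph_add (graph_mul ry pz) (graph_mul ry qw).
Qed.
Fact frac_mulDr : right_distributive frac_mul +%R.
Proof.
move=> p q r; have [x [y [z [x0 qy rz]]]] := graph_ex2 q r.
have [c [w [c0 pw]]] := graph_dom p y.
have [d [v [d0 pv]]] := graph_dom p (z * c).
have xc0 : x * c * d != 0 by rewrite !ore_mulf_neq0.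
have {}qy := graphMr d (graphMr c qy); have {}rz := graphMr d (graphMr c rz).
have {}pw := graphMr d pw.
apply: (graph_ext xc0 (graph_mul (graph_add qy rz) (graphD pw pv))).
exact: graph_add (graph_mul qy pw) (graph_mul rz pv).
Qed.

Lemma to_frac_inj : injective to_frac.
Proof.
move=> a b ab; have := graph_to_frac a 1; rewrite ab.
by move/graph_fun/(_ (graph_to_frac b 1)); rewrite !mulr1.
Qed.

Fact frac_1neq0 : to_frac 1 != 0.
Proof. by apply/eqP => /to_frac_inj/eqP; rewrite oner_eq0. Qed.
HB.instance Definition _ := GRing.Zmodule_isNzRing.Build ore_frac
  frac_mulA frac_mul1l frac_mul1r frac_mulDl frac_mulDr frac_1neq0.

Fact to_frac_is_zmod_morphism : zmod_morphism to_frac.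
Proof.
move=> a b; apply: (graph_ext (oner_neq0 A) (graph_to_frac _ _)).
rewrite mulrBl; apply: graph_add (graph_to_frac _ _) _.
exact/graph_opp/graph_to_frac.
Qed.
Fact to_frac_is_monoid_morphism : monoid_morphism to_frac.
Proof.
split=> // a b; apply: (graph_ext (oner_neq0 A) (graph_to_frac _ _)).
rewrite -mulrA; apply: graph_mul (graph_to_frac _ _) _.
exact: graph_to_frac.
Qed.
HB.instance Definition _ := GRing.isZmodMorphism.Build _ _ to_frac
  to_frac_is_zmod_morphism.
HB.instance Definition _ := GRing.isMonoidMorphism.Build _ _ to_frac
  to_frac_is_monoid_morphism.

Lemma to_frac_eq0 a : (to_frac a == 0) = (a == 0).
Proof. by rewrite -(inj_eq to_frac_inj). Qed.

Definition frac_unit : {pred ore_frac} := fun q => q != 0.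

Lemma graph_inv q x y : q != 0 -> graph q x y -> graph (frac_inv q) y x.
Proof.
move=> q0; rewrite /frac_inv; case: cid => /= p.
by rewrite -[q == _]/(q == 0) (negbTE q0); apply.
Qed.

Fact graph_neq0 q x y : q != 0 -> x != 0 -> graph q x y -> y != 0.
Proof.
move=> q0 x0 qxy; apply: contra q0 => /eqP y0; apply/eqP/(graph_ext x0 qxy).
by rewrite y0; apply: graph_to_frac0.
Qed.

Fact frac_mulV : {in frac_unit, left_inverse 1 frac_inv *%R}.
Proof.
move=> q q0; have [x [y [x0 qxy]]] := graph_ex q.
apply: (graph_ext x0 (graph_mul qxy (graph_inv q0 qxy))).
by have := graph_to_frac 1 x; rewrite mul1r.
Qed.
Fact frac_mulrV : {in frac_unit, right_inverse 1 frac_inv *%R}.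
Proof.
move=> q q0; have [x [y [x0 qxy]]] := graph_ex q.
have y0 := graph_neq0 q0 x0 qxy.
apply: (graph_ext y0 (graph_mul (graph_inv q0 qxy) qxy)).
by have := graph_to_frac 1 y; rewrite mul1r.
Qed.
Fact frac_unitP q r : r * q = 1 /\ q * r = 1 -> frac_unit q.
Proof.
by case=> rq _; apply/eqP => q0; move: rq; rewrite q0 mulr0 => /esym/eqP; rewrite oner_eq0.
Qed.
Fact frac_inv_out : {in [predC frac_unit], frac_inv =1 id}.
Proof.
move=> q; rewrite inE negbK => /eqP q0.
by rewrite /frac_inv; case: cid => /= p; rewrite -[q == _]/(q == 0) q0 eqxx.
Qed.
HB.instance Definition _ := GRing.NzRing_hasMulInverse.Build ore_frac
  frac_mulV frac_mulrV frac_unitP frac_inv_out.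

Lemma frac_unitE q : (q \is a GRing.unit) = (q != 0).
Proof. by []. Qed.

Lemma graph_div q x y : x != 0 -> graph q x y -> q = to_frac y / to_frac x.
Proof.
move=> x0 qxy; apply: (canRL (mulrK _)); first by rewrite frac_unitE to_frac_eq0.
apply: (graph_ext (oner_neq0 A) (graph_mul (graph_to_frac _ _) _) (graph_to_frac _ _)).
exact: graphMr.
Qed.

Lemma frac_right q : exists x y, x != 0 /\ q = to_frac y / to_frac x.
Proof.
have [x [y [x0 qxy]]] := graph_ex q.
by exists x, y; split=> //; apply: graph_div.
Qed.

Lemma frac_left q : exists x y, x != 0 /\ q = (to_frac x)^-1 * to_frac y.
Proof.
have [x [y [x0 ->]]] := frac_right q.
have [c [d [c0 e]]] := ore_left y x0.
exists c, d; split=> //; apply: (canLR (mulrK _)); first by rewrite frac_unitE to_frac_eq0.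
rewrite -mulrA; apply: (canRL (mulKr _)); first by rewrite frac_unitE to_frac_eq0.
by rewrite -!rmorphM e.
Qed.

Definition frac_scale (c : k) q := to_frac c%:A * q.

Fact frac_scaleA (c d : k) q : frac_scale c (frac_scale d q) = frac_scale (c * d) q.
Proof. by rewrite /frac_scale mulrA -rmorphM /= mulr_algl scalerA. Qed.
Fact frac_scale1 : left_id 1 frac_scale.
Proof. by move=> q; rewrite /frac_scale scale1r mul1r. Qed.
Fact frac_scaleDr : right_distributive frac_scale +%R.
Proof. by move=> c q r; rewrite /frac_scale mulrDr. Qed.
Fact frac_scaleDl q : {morph frac_scale^~ q : c d / c + d}.
Proof. by move=> c d; rewrite /frac_scale scalerDl rmorphD mulrDl. Qed.
HB.instance Definition _ := GRing.Zmodule_isLmodule.Build k ore_frac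
  frac_scaleA frac_scale1 frac_scaleDr frac_scaleDl.

Fact frac_scaleAl (c : k) q r : c *: (q * r) = (c *: q) * r.
Proof. exact: mulrA. Qed.
HB.instance Definition _ := GRing.Lmodule_isLalgebra.Build k ore_frac frac_scaleAl.

Fact frac_algC (c : k) q : to_frac c%:A * q = q * to_frac c%:A.
Proof.
have [x [y [x0 ->]]] := frac_right q.
have ux : to_frac x \is a GRing.unit by rewrite frac_unitE to_frac_eq0.
have C a : to_frac c%:A * to_frac a = to_frac a * to_frac c%:A.
  by rewrite -!rmorphM /= mulr_algl mulr_algr.
rewrite mulrA C -!mulrA; congr (_ * _); apply: (canRL (mulKr ux)).
by rewrite mulrA -C mulrK.
Qed.
Fact frac_scaleAr (c : k) q r : c *: (q * r) = q * (c *: r).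
Proof. by rewrite -[LHS]/(_ * _) -[c *: r]/(_ * _) !mulrA frac_algC. Qed.
HB.instance Definition _ := GRing.Lalgebra_isAlgebra.Build k ore_frac frac_scaleAr.

Fact to_frac_is_scalable : scalable to_frac.
Proof. by move=> c a; rewrite -mulr_algl rmorphM. Qed.
HB.instance Definition _ := GRing.isScalable.Build k _ _ _ to_frac
  to_frac_is_scalable.

End OreFractions.

Arguments ore_frac {k} A.
Arguments to_frac {k A} a.

(** * Extension of injective endomorphisms to fractions *)

Section FracMap.
Context {k : fieldType} {A : ore_domain k}.
Variable h : {lrmorphism A -> A}.
Hypothesis h_inj : injective h.

Fact frac_map_ex (q : ore_frac A) : exists p : ore_frac A, forall x y,
  graph q x y -> graph p (h x) (h y).
Proof.
have [x0 [y0 [x0n q0]]] := graph_ex q.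
exists (mk_frac (h x0) (h y0)) => x y qxy.
have hn a : a != 0 -> h a != 0 by rewrite raddf_eq0.
have [e [f [e0 ef]]] := ore_right x x0n.
apply: (@graphMI _ _ _ _ _ (h e)); first exact: hn.
rewrite -!rmorphM ef.
have := graphMr e qxy; rewrite ef => /graph_fun/(_ (graphMr f q0)) ->.
by rewrite !rmorphM; apply/graphMr/graph_mk/hn.
Qed.

Definition frac_map of injective h := fun q : ore_frac A => sval (cid (frac_map_ex q)).
Local Notation hF := (frac_map h_inj).

Lemma graph_map q x y : graph q x y -> graph (hF q) (h x) (h y).
Proof. by rewrite /frac_map; case: cid => /= p; apply. Qed.

Let h_neq0 a : a != 0 -> h a != 0.
Proof. by rewrite raddf_eq0. Qed.

Lemma frac_map_to_frac a : hF (to_frac a) = to_frac (h a).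
Proof.
apply: (graph_ext (h_neq0 (oner_neq0 A)) (graph_map (graph_to_frac _ _))).
by rewrite rmorphM; apply: graph_to_frac.
Qed.

Fact frac_map_is_zmod_morphism : zmod_morphism hF.
Proof.
move=> p q; have [x [y [z [x0 py qz]]]] := graph_ex2 p q.
apply: (graph_ext (h_neq0 x0)); first exact/graph_map/(graph_add py)/graph_opp/qz.
by rewrite rmorphB; apply: graph_add (graph_map py) (graph_opp (graph_map qz)).
Qed.
Fact frac_map_is_monoid_morphism : monoid_morphism hF.
Proof.
split; first by rewrite -(rmorph1 to_frac) frac_map_to_frac !rmorph1.
move=> p q; have [x [y [z [x0 qy pz]]]] := graph_ex_comp p q.
apply: (graph_ext (h_neq0 x0)); first exact/graph_map/graph_mul/pz.
exact: graph_mul (graph_map qy) (graph_map pz).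
Qed.
HB.instance Definition _ := GRing.isZmodMorphism.Build _ _ hF
  frac_map_is_zmod_morphism.
HB.instance Definition _ := GRing.isMonoidMorphism.Build _ _ hF
  frac_map_is_monoid_morphism.
Fact frac_map_is_scalable : scalable hF.
Proof.
move=> c q; apply: etrans (rmorphM hF (to_frac c%:A) q) _; congr (_ * _).
by apply: etrans (frac_map_to_frac _) _; rewrite linearZ /= rmorph1.
Qed.
HB.instance Definition _ := GRing.isScalable.Build k _ _ _ hF
  frac_map_is_scalable.
End FracMap.

(** * Maps out of the Weyl algebra *)

Section OrderedMonomials.
Context {B : nzRingType} {I : eqType}.
Implicit Types (h : I -> B) (e : I -> nat) (r : seq I).

Lemma ad_exp (b x : B) n : b * x - x * b = 1 ->
  b * x ^+ n - x ^+ n * b = n%:R * x ^+ n.-1.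
Proof.
move/eqP; rewrite subr_eq => /eqP bx; elim: n => [|n IH].
  by rewrite !expr0 mulr1 mul1r subrr mul0r.
move/eqP: IH; rewrite subr_eq => /eqP IH.
rewrite exprS mulrA bx mulrDl mul1r -[x * b * _]mulrA IH mulrDr addrA -mulrA addrK.
rewrite mulrA commr_nat -mulrA -nat1r mulrDl mul1r; congr (_ + _).
by case: n {IH} => [|n]; rewrite ?mul0r // -exprS.
Qed.

(** The derivation [[b, -]] takes scalar values on the letters, so it differentiates an ordered
    product in place, whether or not the letters commute with each other. This treats the letters
    x_i and d_i at once. *)
Lemma ad_ordered_monomial (b : B) h e r l0 : uniq r ->
  (forall l, b * h l - h l * b = (l == l0)%:R) ->
  b * (\prod_(l <- r) h l ^+ e l) - (\prod_(l <- r) h l ^+ e l) * b =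
  (if l0 \in r then (e l0)%:R else 0) *
    \prod_(l <- r) h l ^+ (e l - (l == l0))%N.
Proof.
move=> + bh; elim: r => [|l r IH] /=.
  by rewrite !big_nil mulr1 mul1r subrr mul0r.
move=> /andP[lr /IH {}IH]; rewrite !big_cons.
set P := \prod_(i <- r) _ in IH *; set Q := \prod_(i <- r) _ in IH *.
have -> : b * (h l ^+ e l * P) - h l ^+ e l * P * b =
  (b * h l ^+ e l - h l ^+ e l * b) * P + h l ^+ e l * (b * P - P * b).
  by rewrite mulrBl mulrBr !mulrA addrA subrK.
rewrite IH in_cons; case: (eqVneq l l0) => [ll0|ll0].
  rewrite -ll0 (negbTE lr) mul0r mulr0 addr0 /= ad_exp; last by rewrite bh ll0 eqxx.
  rewrite subn1 -mulrA; congr (_ * (_ * _)).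
  rewrite /P /Q; rewrite !big_seq; apply: eq_bigr => i ir.
  suff /negbTE -> : i != l0 by rewrite subn0.
  by apply: contraNneq lr => il0; rewrite ll0 -il0.
rewrite /= subn0.
have -> : b * h l ^+ e l - h l ^+ e l * b = 0.
  have := bh l; rewrite (negbTE ll0) => /subr0_eq c; apply/eqP; rewrite subr_eq0.
  exact/eqP/commrX.
rewrite mul0r add0r; case: (l0 \in r); last by rewrite !mul0r mulr0.
by rewrite mulrA commr_nat -mulrA.
Qed.

Lemma ordered_monomial_mulr h e r l0 : uniq r -> l0 \in r ->
  (forall l, GRing.comm (h l) (h l0)) ->
  (\prod_(l <- r) h l ^+ e l) * h l0 = \prod_(l <- r) h l ^+ (e l + (l == l0))%N.
Proof.
elim: r => // l r IH /= /andP[lr ur]; rewrite in_cons !big_cons -mulrA => l0r hc.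
case: (eqVneq l l0) l0r hc => [<- _|ll0 /= l0r] hc.
  rewrite addn1 exprSr -mulrA -commr_prod.
    congr (_ * (_ * _)); rewrite !big_seq; apply: eq_bigr => i ir.
    suff /negbTE -> : i != l by rewrite addn0.
    by apply: contraNneq lr => <-.
  by move=> i _; apply/commrX/commr_sym/hc.
by rewrite addn0 IH.
Qed.
End OrderedMonomials.

Section WeylLift.
Context {K : fieldType} {n : nat} {B : nzRingType}.
Variables (kap : {rmorphism K -> B}) (g : 'I_n + 'I_n -> B).
Hypothesis kap_comm : forall c l, GRing.comm (kap c) (g l).

Definition word_eval (w : fmonom ('I_n + 'I_n)%type) : B :=
  \prod_(l <- (w : seq _)) g l.

Fact word_eval_mmorphism : monalg.mmorphism word_eval.
Proof. by split=> [v w|]; rewrite /word_eval ?fmM ?big_cat // fm1 big_nil. Qed.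
HB.instance Definition _ := monalg.isMultiplicative.Build _ _ word_eval
  word_eval_mmorphism.

Definition free_eval (a : weyl_free) : B := monalg.mmap kap word_eval a.

Fact free_eval_zmod_morphism : zmod_morphism free_eval.
Proof. exact: monalg.mmapB. Qed.
Fact free_eval_monoid_morphism : monoid_morphism free_eval.
Proof.
have [a w v|HM H1] := @monalg.commr_mmap_is_multiplicative _ _ _ kap word_eval.
  by rewrite /= /word_eval; apply: commr_prod => l _; apply: kap_comm.
by split.
Qed.
HB.instance Definition _ := GRing.isZmodMorphism.Build _ _ free_eval
  free_eval_zmod_morphism.
HB.instance Definition _ := GRing.isMonoidMorphism.Build _ _ free_eval
  free_eval_monoid_morphism.

Fact free_evalB (a b : weyl_free) : free_eval (a - b) = free_eval a - free_eval b.
Proof. exact: (rmorphB free_eval). Qed.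
Fact free_evalM (a b : weyl_free) : free_eval (a * b) = free_eval a * free_eval b.
Proof. exact: (rmorphM free_eval). Qed.

Lemma free_eval_gen l : free_eval (free_gen l) = g l.
Proof.
rewrite /free_eval [LHS]monalg.mmapU.
by rewrite /= rmorph1 mul1r /word_eval fmU big_seq1.
Qed.

Fact free_eval_gen2 l l' : free_eval (free_gen l * free_gen l') = g l * g l'.
Proof. by apply: etrans (free_evalM _ _) _; rewrite !free_eval_gen. Qed.

Fact free_eval_comm l l' :
  free_eval (free_gen l * free_gen l' - free_gen l' * free_gen l) =
  g l * g l' - g l' * g l.
Proof.
by apply: etrans (free_evalB _ _) _; congr (_ - _); exact: free_eval_gen2.
Qed.

Hypothesis gXX : forall i j, GRing.comm (g (inl i)) (g (inl j)).
Hypothesis gDD : forall i j, GRing.comm (g (inr i)) (g (inr j)).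
Hypothesis gDX : forall i j,
  g (inr i) * g (inl j) - g (inl j) * g (inr i) = (i == j)%:R.

Fact free_eval_ideal a : weyl_ideal a -> free_eval a = 0.
Proof.
elim=> {a} [i j|i j|i j||a b _ IHa _ IHb|a b _ IH|a b _ IH].
- by apply: etrans (free_eval_comm _ _) _; rewrite gXX subrr.
- by apply: etrans (free_eval_comm _ _) _; rewrite gDD subrr.
- rewrite free_evalB free_eval_comm gDX.
  by rewrite (rmorph_nat free_eval) subrr.
- exact: rmorph0.
- by rewrite free_evalB IHa IHb subrr.
- by rewrite free_evalM IH mulr0.
- by rewrite free_evalM IH mul0r.
Qed.

Definition weyl_eval (u : weyl K n) : B := free_eval (sval (to_weyl_surj u)).

Fact weyl_eval_to_weyl a : weyl_eval (to_weyl a) = free_eval a.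
Proof.
rewrite /weyl_eval; case: to_weyl_surj => b /= /to_weyl_eq/free_eval_ideal.
by rewrite rmorphB /= => /subr0_eq.
Qed.

Fact weyl_eval_zmod_morphism : zmod_morphism weyl_eval.
Proof.
move=> u v; have [[a ->] [b ->]] := (to_weyl_surj u, to_weyl_surj v).
by rewrite -rmorphB !weyl_eval_to_weyl rmorphB.
Qed.
Fact weyl_eval_monoid_morphism : monoid_morphism weyl_eval.
Proof.
split=> [|u v]; first by rewrite -(rmorph1 to_weyl) weyl_eval_to_weyl rmorph1.
have [[a ->] [b ->]] := (to_weyl_surj u, to_weyl_surj v).
by rewrite -rmorphM !weyl_eval_to_weyl rmorphM.
Qed.
HB.instance Definition _ := GRing.isZmodMorphism.Build _ _ weyl_eval
  weyl_eval_zmod_morphism.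
HB.instance Definition _ := GRing.isMonoidMorphism.Build _ _ weyl_eval
  weyl_eval_monoid_morphism.

Definition weyl_gen (l : 'I_n + 'I_n) : weyl K n := to_weyl (free_gen l).

(** The target is a bare ring and the scalars enter through [kap]: in the application the scalars
    are C(z), while the target is an algebra over C only. *)
Lemma weyl_lift : exists phi : {rmorphism weyl K n -> B},
  (forall c, phi c%:A = kap c) /\ forall l, phi (weyl_gen l) = g l.
Proof.
exists weyl_eval; split=> [c|l]; last first.
  by rewrite /= weyl_eval_to_weyl free_eval_gen.
rewrite -(rmorph1 to_weyl) -linearZ /= weyl_eval_to_weyl.
by apply: etrans (monalg.mmapZ _ _) _; rewrite monalg.mmap1 mulr1.
Qed.

End WeylLift.

(** * Normal forms and injectivity for the Weyl algebra *)

Section WeylBasis.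
Context {K : fieldType} {n : nat}.

Lemma weyl_ind (P : weyl K n -> Prop) :
  P 1 -> (forall u v, P u -> P v -> P (u + v)) ->
  (forall c u, P u -> P (c *: u)) -> (forall l u, P u -> P (weyl_gen l * u)) ->
  forall u, P u.
Proof.
move=> P1 PD PZ PM u; have [a ->] := to_weyl_surj u.
have P0 : P 0 by rewrite -(scale0r 1); apply: PZ.
suff PU w c : P (to_weyl (mkmalgU w c)).
  by rewrite [a]monalgE raddf_sum; apply: (big_ind P) => // w _; exact: PU.
have -> : mkmalgU w c = c *: mkmalgU w 1 :> weyl_free by rewrite free_scaleU mulr1.
rewrite to_weylZ; apply: PZ.
case: w => w; elim: w => [|l w IH].
  have -> : FMonom [::] = monalg.mone :> fmonom ('I_n + 'I_n)%type.
    by apply/eqP; rewrite fmP fm1.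
  by rewrite -[mkmalgU _ _]/(1 : weyl_free) (rmorph1 to_weyl).
have -> : FMonom (l :: w) = monalg.mmul (fmu l) (FMonom w).
  by apply/eqP; rewrite fmP fmM fmU.
suff -> : mkmalgU (monalg.mmul (fmu l) (FMonom w)) 1 =
    free_gen l * (mkmalgU (FMonom w) 1 : @weyl_free K n).
  by rewrite to_weylM; apply: PM.
apply/esym; apply: etrans (monalg.fgmulUU _ _ _ _) _.
by rewrite mulr1.
Qed.

Lemma weyl_gen_comm (l l' : 'I_n + 'I_n) :
  @weyl_ideal K n (free_gen l * free_gen l' - free_gen l' * free_gen l) ->
  weyl_gen l * weyl_gen l' = weyl_gen l' * weyl_gen l :> weyl K n.
Proof.
move=> I; apply: etrans (esym (to_weylM _ _)) _; apply: etrans _ (to_weylM _ _).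
exact/to_weyl_eq.
Qed.

Lemma weyl_genDX i j : weyl_gen (inr i) * weyl_gen (inl j) =
  weyl_gen (inl j) * weyl_gen (inr i) + (i == j)%:R :> weyl K n.
Proof.
apply/eqP; rewrite addrC -subr_eq; apply/eqP.
apply: etrans (congr2 _ (esym (to_weylM _ _)) (congr1 _ (esym (to_weylM _ _)))) _.
apply: etrans (esym (raddfB to_weyl _ _)) _; apply: etrans _ (rmorph_nat to_weyl _).
exact/to_weyl_eq/weyl_ideal_DX.
Qed.

Section NormalForm.
Variable B : nzRingType.
Variable phi : {rmorphism weyl K n -> B}.

Local Notation x i := (phi (weyl_gen (inl i))).
Local Notation d i := (phi (weyl_gen (inr i))).

Fact weyl_map_comm u v : u * v = v * u -> GRing.comm (phi u) (phi v).
Proof. by move=> uv; rewrite /GRing.comm -(rmorphM phi) uv (rmorphM phi). Qed.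
Let xC i j : GRing.comm (x i) (x j).
Proof. exact/weyl_map_comm/weyl_gen_comm/weyl_ideal_XX. Qed.
Let dC i j : GRing.comm (d i) (d j).
Proof. exact/weyl_map_comm/weyl_gen_comm/weyl_ideal_DD. Qed.
Let dx i j : d i * x j - x j * d i = (i == j)%:R.
Proof.
apply/eqP; rewrite subr_eq addrC -(rmorph_nat phi) -!(rmorphM phi) -(rmorphD phi).
by rewrite weyl_genDX.
Qed.
Definition weyl_scalar (c : K) : B := phi c%:A.
Fact weyl_scalar_zmod_morphism : zmod_morphism weyl_scalar.
Proof. by move=> a b; rewrite /weyl_scalar scalerBl rmorphB. Qed.
Fact weyl_scalar_monoid_morphism : monoid_morphism weyl_scalar.
Proof.
split=> [|a b]; first by rewrite /weyl_scalar scale1r rmorph1.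
by rewrite /weyl_scalar -(rmorphM phi) mulr_algl scalerA.
Qed.
HB.instance Definition _ := GRing.isZmodMorphism.Build _ _ weyl_scalar
  weyl_scalar_zmod_morphism.
HB.instance Definition _ := GRing.isMonoidMorphism.Build _ _ weyl_scalar
  weyl_scalar_monoid_morphism.
Let scC c u : GRing.comm (weyl_scalar c) (phi u).
Proof. by apply: weyl_map_comm; rewrite mulr_algl mulr_algr. Qed.

Let xd (l : 'I_(n + n)) : B :=
  match split l with inl i => x i | inr i => d i end.
(** Commutation with [dual l] is differentiation in the letter [xd l], because [d_i, x_i] = 1 and
    [-x_i, d_i] = 1. *)
Let dual (l : 'I_(n + n)) : B :=
  match split l with inl i => d i | inr i => - x i end.

Let dual_xd l l0 : dual l0 * xd l - xd l * dual l0 = (l == l0)%:R.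
Proof.
rewrite /dual /xd -[in RHS](splitK l) -[in RHS](splitK l0) (can_eq unsplitK).
case: (split l) => i; case: (split l0) => i0.
- by rewrite dx eq_sym.
- by rewrite mulNr mulrN opprK addrC xC subrr.
- by rewrite dC subrr.
- by rewrite mulNr mulrN opprK addrC dx.
Qed.

(* The normally ordered element [\sum_(a, b) p_(a, b) x^a d^b]. *)
Definition normal_form (p : {mpoly K[n + n]}) : B := mpoly.mmap weyl_scalar xd p.

Lemma normal_formD p q : normal_form (p + q) = normal_form p + normal_form q.
Proof. exact: raddfD. Qed.

Let ad_normal_form p l :
  dual l * normal_form p - normal_form p * dual l = normal_form (mderiv l p).
Proof.
rewrite /normal_form [in LHS]/mpoly.mmap mulr_sumr mulr_suml -sumrB.
rewrite /mderiv raddf_sum; apply: eq_bigr => m _ /=.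
have cl c : GRing.comm (dual l) (weyl_scalar c).
  by rewrite /dual; case: (split l) => i; rewrite -?rmorphN; apply/commr_sym/scC.
rewrite mulrA cl -!mulrA -mulrBr mpoly.mmapZ mpoly.mmapX /=.
have := @ad_ordered_monomial _ _ (dual l) xd m (index_enum 'I_(n + n)) l (index_enum_uniq _).
move=> -> //; rewrite mem_index_enum rmorphM rmorph_nat -[_%:R * weyl_scalar _]commr_nat.
rewrite -!mulrA; congr (_ * (_ * _)).
by apply: eq_bigr => i _; rewrite mnmBE mnmE eq_sym.
Qed.

Hypothesis K0 : [pchar K] =i pred0.

(** Induction on the size of [p]: the commutator of a vanishing normal form with [dual l] is the
    normal form of a partial derivative, which is smaller. Hence all partial derivatives vanish, and
    in characteristic 0 only a constant remains, on which the scalar embedding is injective. *)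
Lemma normal_form_inj p : normal_form p = 0 -> p = 0.
Proof.
move: {2}(msize p) (leqnn (msize p)) => s; elim: s p => [|s IH] p ps np.
  by apply/eqP; rewrite -msize_poly_eq0 -leqn0.
have dp l : mderiv l p = 0.
  apply: IH; last by rewrite -ad_normal_form np mulr0 mul0r subrr.
  rewrite mmeasureE; apply/bigmax_leqP_seq => m.
  rewrite mcoeff_msupp mcoeff_mderiv => mp _.
  have /msize_mdeg_lt : (m + U_(l))%MM \in msupp p.
    by rewrite mcoeff_msupp; apply: contraNneq mp => ->; rewrite mul0rn.
  by rewrite mdegD mdeg1 addn1 => /leq_trans/(_ ps).
have pC : p = (p@_0)%:MP.
  apply/mpolyP => m; rewrite mcoeffC; case: eqVneq => [<-|m0]; first by rewrite mulr1.
  rewrite mulr0; have [l ml] : exists l, m l != 0%N.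
    apply/existsP; apply: contraNT m0; rewrite negb_exists => /forallP m0.
    apply/eqP/mnmP => l; rewrite mnm0E.
    by have := m0 l; rewrite negbK => /eqP.
  have := congr1 (mcoeff (m - U_(l))%MM) (dp l).
  rewrite mcoeff_mderiv mcoeff0 submK; last by rewrite lep1mP.
  by move/eqP; rewrite -mulr_natr mulf_eq0 (pcharf0P K).1 // orbF => /eqP.
move: np; rewrite pC /normal_form mpoly.mmapC => np.
suff -> : p@_0 = 0 by rewrite mpolyC0.
by apply/eqP; rewrite -(fmorph_eq0 weyl_scalar) np.
Qed.

Let mmap1_split m : mpoly.mmap1 xd m =
  (\prod_(i < n) x i ^+ m (lshift n i)) * (\prod_(i < n) d i ^+ m (rshift n i)).
Proof.
rewrite /mpoly.mmap1 big_split_ord; congr (_ * _); apply: eq_bigr => i _.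
  by rewrite /xd (unsplitK (inl _)).
by rewrite /xd (unsplitK (inr _)).
Qed.

Let mmap1_x m i : mpoly.mmap1 xd (m + U_(lshift n i)) = x i * mpoly.mmap1 xd m.
Proof.
rewrite !mmap1_split mulrA; congr (_ * _); last first.
  by apply: eq_bigr => l _; rewrite mnmDE mnm1E eq_lrshift addn0.
rewrite commr_prod => [|l _]; last exact/commrX/xC.
rewrite (ordered_monomial_mulr _ (index_enum_uniq _)) ?mem_index_enum //.
by apply: eq_bigr => l _; rewrite mnmDE mnm1E (inj_eq (@lshift_inj _ _)) eq_sym.
Qed.

Let mmap1_d m i : mpoly.mmap1 xd (m + U_(rshift n i)) = mpoly.mmap1 xd m * d i.
Proof.
rewrite !mmap1_split -mulrA; congr (_ * _).
  by apply: eq_bigr => l _; rewrite mnmDE mnm1E eq_rlshift addn0.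
rewrite (ordered_monomial_mulr _ (index_enum_uniq _)) ?mem_index_enum //.
by apply: eq_bigr => l _; rewrite mnmDE mnm1E (inj_eq (@rshift_inj _ _)) eq_sym.
Qed.

Let normal_form_mulX p l : normal_form (p * 'X_l) =
  \sum_(m <- msupp p) weyl_scalar p@_m * mpoly.mmap1 xd (m + U_(l)).
Proof.
rewrite {1}[p]mpolyE mulr_suml /normal_form raddf_sum; apply: eq_bigr => m _ /=.
by rewrite -scalerAl -mpolyXD mpoly.mmapZ mpoly.mmapX.
Qed.

(** Left multiplication by x_i keeps the normal order. For d_i, [ad_normal_form] moves d_i to the
    right at the cost of the normal form of the derivative in x_i. *)
Lemma normal_form_ex u : exists p, phi u = normal_form p.
Proof.
elim/weyl_ind: u => [|u v [p up] [q vq]|c u [p up]|l u [p up]].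
- by exists 1; rewrite (rmorph1 phi) /normal_form -mpolyC1 mpoly.mmapC /= rmorph1.
- by exists (p + q); rewrite (rmorphD phi) up vq normal_formD.
- exists (c *: p); rewrite /normal_form mpoly.mmapZ /= -[weyl_scalar c]/(phi _).
  by rewrite -[mpoly.mmap _ _ _]/(normal_form _) -up -(rmorphM phi) mulr_algl.
suff [q qE] : exists q, phi (weyl_gen l) * normal_form p = normal_form q.
  exists q; apply: etrans qE; rewrite -up.
  exact: (rmorphM phi).
case: l {u up} => i.
  exists (p * 'X_(lshift n i)); rewrite normal_form_mulX {1}/normal_form.
  rewrite mulr_sumr; apply: eq_bigr => m _.
  by rewrite mmap1_x mulrA -scC mulrA.
exists (mderiv (lshift n i) p + p * 'X_(rshift n i)).
rewrite normal_formD -ad_normal_form normal_form_mulX /dual (unsplitK (inl _)).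
suff -> : normal_form p * d i =
    \sum_(m <- msupp p) weyl_scalar p@_m * mpoly.mmap1 xd (m + U_(rshift n i)).
  by rewrite subrK.
rewrite {1}/normal_form mulr_suml; apply: eq_bigr => m _.
by rewrite mmap1_d mulrA.
Qed.

End NormalForm.

Lemma normal_form_map (B : nzRingType) (phi : {rmorphism weyl K n -> B}) p :
  phi (normal_form idfun p) = normal_form phi p.
Proof.
rewrite /normal_form /mpoly.mmap (rmorph_sum phi); apply: eq_bigr => m _.
rewrite (rmorphM phi) (rmorph_prod phi); congr (_ * _).
by apply: eq_bigr => l _; rewrite (rmorphXn phi); case: (split l).
Qed.

(** The argument of [normal_form_inj] takes place in the target, so it applies to every nonzero
    ring; in other words the Weyl algebra is simple. *)
Lemma weyl_map_inj (B : nzRingType) (phi : {rmorphism weyl K n -> B}) :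
  [pchar K] =i pred0 -> injective phi.
Proof.
move=> K0; apply: raddf_inj => u; have [p up] := normal_form_ex idfun u.
have {}up : u = normal_form idfun p by [].
rewrite up => e; suff -> : p = 0 by rewrite /normal_form raddf0.
by apply: (@normal_form_inj B phi K0); rewrite -normal_form_map.
Qed.

End WeylBasis.

(** * Skew algebras of lattice actions are Ore domains *)

Section SkewSum.
Context {k : fieldType} {M : nmodType} {L : comAlgType k} {act : alg_action M L}.
Local Notation S := (Defs.skew act).
Variables (V : zmodType) (F : M -> L -> V).
Hypothesis FB : forall s, zmod_morphism (F s).

(** Additive extension of a family of maps given on the terms f s. The anti-automorphism [skew_tau]
    and the action of G on the skew algebra both have this form. *)
Definition skew_sum (x : S) : V := \sum_(s <- skew_supp x) F s (skew_coef s x).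

Let F0 s : F s 0 = 0.
Proof. by rewrite -(subrr (0 : L)) FB subrr. Qed.

Let skew_sumEw (d : {fset M}) x : fsubset (skew_supp x) d ->
  skew_sum x = \sum_(s <- d) F s (skew_coef s x).
Proof.
move=> le; rewrite /skew_sum (big_fset_incl _ le) //= => s _ /skew_suppP ->.
exact: F0.
Qed.

Lemma skew_sumB : zmod_morphism skew_sum.
Proof.
move=> x y; set d := fsetU (skew_supp x) (skew_supp y).
rewrite (@skew_sumEw d (x - y)) ?monalg.msuppB_le //.
rewrite (@skew_sumEw d x) ?fsubsetUl // (@skew_sumEw d y) ?fsubsetUr //.
by rewrite -sumrB; apply: eq_bigr => s _; rewrite skew_coefB FB.
Qed.

Lemma skew_sumU f s : skew_sum (skewU f s) = F s f.
Proof.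
by rewrite (skew_sumEw monalg.msuppU_le) big_seq_fset1 skew_coefU eqxx.
Qed.

End SkewSum.

Section SkewShift.
Context {k : fieldType} {n q : nat}.
Local Notation L := (ratfun k q).
Local Notation M := 'rV[int]_n.
Context {act : alg_action M L}.
Local Notation S := (Defs.skew act).
Implicit Types (x y z : S) (s t u : M) (f g : L).

Lemma skew_elim (P : S -> Prop) : P 0 -> (forall x y, P x -> P y -> P (x + y)) ->
  (forall f s, P (skewU f s)) -> forall x, P x.
Proof. exact: skew_ind. Qed.

Lemma skew_coef_sum (I : Type) (r : seq I) (F : I -> S) u :
  skew_coef u (\sum_(i <- r) F i) = \sum_(i <- r) skew_coef u (F i).
Proof.
by apply: (big_morph (skew_coef u) (skew_coefD u)); exact: monalg.mcoeff0.
Qed.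

Lemma skew_coef_neq0 s x : s \in skew_supp x -> skew_coef s x != 0.
Proof.
move=> sx; have := monalg.mcoeff_neq0 x s.
by rewrite [RHS]sx.
Qed.

Lemma skew_coef0 s : skew_coef s (0 : S) = 0.
Proof. exact: monalg.mcoeff0. Qed.

Lemma actK s f : act (- s) (act s f) = f.
Proof. by have := act_funD act (- s) s f; rewrite addNr act_fun0 /=. Qed.

Lemma skew_coefM u x y : skew_coef u (x * y) =
  \sum_(s <- skew_supp x) \sum_(t <- skew_supp y)
     (skew_coef s x * act s (skew_coef t y)) *+ (s + t == u).
Proof.
rewrite skew_coef_sum; apply: eq_bigr => s _.
by rewrite skew_coef_sum; apply: eq_bigr => t _; rewrite skew_coefU.
Qed.

Lemma skew_coefUM u f s y : skew_coef u (skewU f s * y) = f * act s (skew_coef (u - s) y).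
Proof.
move: y; apply: skew_elim => [|x y IHx IHy|g t].
- by rewrite mulr0 !skew_coef0 rmorph0 mulr0.
- rewrite mulrDr; apply: etrans (skew_coefD _ _ _) _.
  apply: etrans (congr2 _ IHx IHy) _.
  by rewrite -mulrDr -rmorphD -skew_coefD.
rewrite skewUM !skew_coefU raddfMn mulrnAr; congr (_ *+ nat_of_bool _).
by rewrite [t == _]eq_sym subr_eq [t + s]addrC eq_sym.
Qed.

(** A vector is read as the coefficients of an integer polynomial, and the functional is evaluation
    at an integer [B]. The product of the polynomials attached to [V] is nonzero, so one of
    sufficiently many integers is not a root of it. *)
Lemma int_functional_sep (V : seq M) : (forall v, v \in V -> v != 0) ->
  exists lam : M -> int, {morph lam : u v / u + v} /\ forall v, v \in V -> lam v != 0.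
Proof.
move=> V0; pose P (v : M) : {poly int} := rVpoly v.
pose Q := \prod_(v <- V) P v.
have Q0 : Q != 0.
  rewrite prodf_seq_neq0; apply/allP => v vV; apply/implyP => _.
  apply: contraNneq (V0 v vV) => Pv; rewrite -[v]rVpolyK -[rVpoly v]/(P v) Pv.
  by rewrite linear0.
have [B QB] : exists B : nat, ~~ root Q B%:Z.
  apply/not_existsP => QB.
  pose r := [seq i%:Z | i <- iota 0 (size Q)].
  suff : (size r < size Q)%N by rewrite size_map size_iota ltnn.
  apply: max_poly_roots => //; last by rewrite map_inj_uniq ?iota_uniq // => i j [].
  by apply/allP => _ /mapP[i _ ->]; apply: contraPT (QB i) => ->; apply.
exists (fun v => (P v).[B%:Z]); split=> [u v|v vV].
  by rewrite /P linearD hornerD.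
move: QB; rewrite /root horner_prod prodf_seq_neq0 => /allP/(_ v vV).
by rewrite implyTb.
Qed.

Fact seq_argmax (T : eqType) (lam : T -> int) (r : seq T) : r != [::] ->
  exists2 a, a \in r & {in r, forall b, lam b <= lam a}.
Proof.
elim: r => // b r IH _; have [->|/IH[a ar lama]] := eqVneq r [::].
  by exists b; rewrite ?mem_seq1 // => c; rewrite mem_seq1 => /eqP ->.
have [le|/ltW le] := leP (lam b) (lam a).
  exists a; first by rewrite in_cons ar orbT.
  by move=> c; rewrite in_cons => /predU1P[->//|/lama].
exists b; first by rewrite mem_head.
by move=> c; rewrite in_cons => /predU1P[->//|/lama/le_trans]; apply.
Qed.

(* Leading terms with respect to a linear functional that is injective on the
   supports. *)
Lemma skew_mulf_eq0 x y : x * y = 0 -> x = 0 \/ y = 0.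
Proof.
move=> xy0; case: (eqVneq x 0) => [|x0]; first by left.
right; apply: contraTeq isT => y0; exfalso; move: xy0; apply/eqP.
pose D (d : {fset M}) := [seq p.1 - p.2 | p <- [seq (u, v) | u <- d, v <- d] & p.1 != p.2].
have [lam [lamD lamV]] : exists lam : M -> int, {morph lam : u v / u + v} /\
    forall v, v \in D (skew_supp x) ++ D (skew_supp y) -> lam v != 0.
  apply: int_functional_sep => v; rewrite mem_cat => vD.
  by case/orP: vD => /mapP[p]; rewrite mem_filter => /andP[p12 _] ->; rewrite subr_eq0.
have lam_inj d : {subset D d <= D (skew_supp x) ++ D (skew_supp y)} ->
    {in d &, injective lam}.
  move=> sub s t sd td lst; apply/eqP/negPn/negP => st.
  have /sub/lamV : s - t \in D d.
    apply/mapP; exists (s, t) => //; rewrite mem_filter st.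
    by apply/allpairsP; exists (s, t).
  have := lamD (s - t) t; rewrite subrK lst => /eqP.
  by rewrite -subr_eq subrr eq_sym => ->.
have lead z : z != 0 -> {subset D (skew_supp z) <= D (skew_supp x) ++ D (skew_supp y)} ->
  exists2 s0, s0 \in skew_supp z & {in skew_supp z, forall s, s != s0 -> lam s < lam s0}.
  move=> z0 /lam_inj inj.
  have [s0 s0z lams0] : exists2 s0, s0 \in (skew_supp z : seq M) &
      {in (skew_supp z : seq M), forall s, lam s <= lam s0}.
    apply: seq_argmax; apply: contra_neq z0 => z0.
    by rewrite [z]skewE z0 big_nil.
  exists s0 => // s sz ss0; rewrite lt_neqAle lams0 // andbT.
  by apply: contra_neq ss0; apply: inj.
have [|s0 s0x lts0] := lead x x0; first by move=> v vx; rewrite mem_cat vx.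
have [|t0 t0y ltt0] := lead y y0; first by move=> v vy; rewrite mem_cat vy orbT.
suff : skew_coef (s0 + t0) (x * y) != 0.
  by apply: contraNneq => ->; rewrite skew_coef0.
rewrite skew_coefM (bigD1_seq s0) ?fset_uniq //= (bigD1_seq t0) ?fset_uniq //=.
rewrite eqxx mulr1n big1_seq ?addr0 => [|t /andP[tt0 ty]]; last first.
  by rewrite (inj_eq (addrI s0)) (negbTE tt0).
rewrite big1_seq ?addr0 => [|s /andP[ss0 sx]]; last first.
  rewrite big1_seq // => t /andP[_ ty]; case: eqP => // /(congr1 lam).
  rewrite !lamD => e; have := lts0 s sx ss0.
  have : lam t <= lam t0 by have [->//|/(ltt0 t ty)/ltW] := eqVneq t t0.
  by move=> le lt; have := ltr_leD lt le; rewrite e ltxx.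
apply: mulf_neq0; first exact: skew_coef_neq0.
apply: contraTneq (skew_coef_neq0 t0y) => e.
by rewrite negbK -[skew_coef t0 y](actK s0) e rmorph0.
Qed.

(** For n > 0 this is Bernoulli's inequality, in the form [H]: with T = 2nc + 1 and D = T - c, one
    has (1 - c/T)^n >= 1 - nc/T > 1/2. *)
Fact box_growth (c : nat) : exists D : nat, ((D + c) ^ n < 2 * D ^ n)%N.
Proof.
pose T := (2 * n * c).+1; exists (T - c + (n == 0) * c)%N.
have [->|n0] := eqVneq n 0%N; first by rewrite !expn0.
have H i : (T ^ i * (T - i * c) <= (T - c) ^ i * T)%N.
  elim: i => [|i IH]; first by rewrite !expn0 mul0n subn0.
  (* Subtraction is truncated: the left side is 0 when (i + 1)c exceeds T, and otherwise the two
     sides differ by i c^2. *)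
  have step : (T * (T - i.+1 * c) <= (T - c) * (T - i * c))%N.
    rewrite mulSn; have [le|/ltnW] := leqP (c + i * c) T; last first.
      by rewrite -subn_eq0 => /eqP ->; rewrite muln0.
    clear IH; move: (i * c)%N T le => u t le; have [a ->] : exists a, t = (a + (c + u))%N.
      by exists (t - (c + u))%N; rewrite subnK.
    have -> : (a + (c + u) - (c + u) = a)%N by lia.
    have -> : (a + (c + u) - c = a + u)%N by lia.
    have -> : (a + (c + u) - u = a + c)%N by lia.
    by nia.
  rewrite !expnS -!mulnA [in X in (_ <= X)%N]mulnCA mulnCA.
  apply: leq_trans (leq_mul (leqnn _) step) _.
  by rewrite mulnCA [X in (_ <= X)%N]mulnCA; apply: leq_mul.
have cT : (c <= T)%N by rewrite /T; nia.
rewrite mul0n addn0 subnK //.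
have Hn := H n; have TE : (T = 2 * n * c + 1)%N by rewrite /T addn1.
have : (T * T ^ n < T * (2 * (T - c) ^ n))%N.
  have : (T * T ^ n < 2 * (T ^ n * (T - n * c)))%N; last by nia.
  have : (0 < T ^ n)%N by rewrite expn_gt0 TE addn1.
  have : (T - n * c = n * c + 1)%N by nia.
  by move=> ->; nia.
by rewrite ltn_pmul2l // TE addn1.
Qed.

Fact linear_dependence (F : fieldType) (I J : finType) (A : I -> J -> F) :
  (#|J| < #|I|)%N ->
  exists v : I -> F, (exists i, v i != 0) /\ forall j, \sum_i v i * A i j = 0.
Proof.
move=> lt; pose B := \matrix_(i < #|I|, j < #|J|) A (enum_val i) (enum_val j).
have : kermx B != 0.
  rewrite -mxrank_eq0 mxrank_ker subn_eq0 -ltnNge.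
  exact: leq_ltn_trans (rank_leq_col _) lt.
case/rowV0Pn => w wB w0; exists (fun i => w 0 (enum_rank i)); split.
  have /rV0Pn[i wi] := w0.
  by exists (enum_val i); rewrite enum_valK.
move=> j; move/sub_kermxP: wB => /rowP/(_ (enum_rank j)); rewrite !mxE => e.
rewrite -[RHS]e (reindex_onto enum_rank enum_val) => [|i _]; last exact: enum_valK.
apply: eq_big => [i|i _]; first by rewrite enum_rankK eqxx.
by rewrite mxE !enum_rankK.
Qed.

(* The elements supported in a box of side [D] form a space of dimension [D^n]
   over [L], and multiplication on the right by [a] or [b] enlarges the side by a constant. *)
Lemma skew_ore_left a b : b != 0 -> exists c d : S, c != 0 /\ c * a = d * b.
Proof.
move=> b0.
(* [r] bounds every coordinate of both supports, so right multiplication by [a] or [b] maps the box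
   of side [0, D) into the one of side [-r, D + r), which [wide] parametrizes. *)
pose r := (\sum_(s <- (skew_supp a : seq M) ++ skew_supp b) \sum_j `|(s : M) 0%R j|)%N.
have rP (s : M) j : s \in (skew_supp a : seq M) ++ skew_supp b -> (`|s 0%R j| <= r)%N.
  move=> sab; rewrite /r (big_rem s) //= (bigD1 j) //=.
  by rewrite -!addnA leq_addr.
have [D growth] := box_growth (2 * r).
pose vec (f : {ffun 'I_n -> 'I_D}) : M := \row_j (f j)%:Z.
pose wide (f : {ffun 'I_n -> 'I_(D + 2 * r)}) : M := \row_j ((f j)%:Z - r%:Z).
have vec_inj : injective vec.
  by move=> f g /rowP fg; apply/ffunP => j; apply/val_inj; have := fg j; rewrite !mxE => -[].
pose ab (i : {ffun 'I_n -> 'I_D} + {ffun 'I_n -> 'I_D}) : S * M :=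
  match i with inl f => (a, vec f) | inr f => (b, vec f) end.
pose A i h := act (ab i).2 (skew_coef (wide h - (ab i).2) (ab i).1).
(* There are 2 D^n unknowns, the coefficients of [c] and of [d], against (D + 2r)^n equations, one
   for each point of the large box. *)
have [|v [[i0 vi0] vA]] := @linear_dependence _ _ _ A.
  by rewrite card_sum !card_ffun !card_ord addnn -mul2n.
pose c := \sum_h skewU (act := act) (v (inl h)) (vec h).
pose d := \sum_h skewU (act := act) (v (inr h)) (vec h).
have coef_sum (w : {ffun 'I_n -> 'I_D} -> L) x u :
    skew_coef u ((\sum_h skewU (w h) (vec h) : S) * x) =
    \sum_h w h * act (vec h) (skew_coef (u - vec h) x).
  by rewrite mulr_suml skew_coef_sum; apply: eq_bigr => f _; exact: skew_coefUM.
have abE : c * a + d * b = 0.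
  apply: Defs.skewP => u; apply: etrans (skew_coefD _ _ _) _.
  apply: etrans (congr2 _ (coef_sum _ _ _) (coef_sum _ _ _)) _.
  apply: etrans _ (esym (skew_coef0 u)).
  case: (pselect (exists h, u = wide h)) => [[h ->]|uh].
    by rewrite -[RHS](vA h) big_sumType.
  have out x (h : {ffun 'I_n -> 'I_D}) :
      {subset skew_supp x <= (skew_supp a : seq M) ++ skew_supp b} ->
      skew_coef (u - vec h) x = 0.
    move=> sub; apply/skew_suppP/negP => /sub uhab; apply: uh.
    have ltu j : (`|(u 0 j + r%:Z)%R| < D + 2 * r)%N /\ 0 <= u 0 j + r%:Z.
      have := rP _ j uhab; rewrite !mxE; have := ltn_ord (h j).
      by move: (u 0 j) (nat_of_ord _) => x0 y0; split; lia.
    exists [ffun j => Ordinal (proj1 (ltu j))]; apply/rowP => j.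
    by rewrite mxE ffunE /= gez0_abs ?addrK //; case: (ltu j).
  by rewrite !big1 ?addr0 // => f _; rewrite out ?rmorph0 ?mulr0 // => s ss; rewrite mem_cat ss ?orbT.
exists c, (- d); split; last by apply/eqP; rewrite mulNr -addr_eq0 abE.
(* If [c] were 0, then [d * b = 0] would force [d = 0], and the dependence [v] would be trivial. *)
apply: contraNneq vi0 => c0; move: abE; rewrite c0 mul0r add0r => /skew_mulf_eq0[d0|/eqP]; last first.
  by rewrite (negbTE b0).
have coef_v (w : {ffun 'I_n -> 'I_D} -> L) (h : {ffun 'I_n -> 'I_D}) :
    skew_coef (vec h) (\sum_h skewU (w h) (vec h) : S) = w h.
  rewrite skew_coef_sum (bigD1 h) //= big1 ?addr0 ?skew_coefU ?eqxx //.
  by move=> g gf; rewrite skew_coefU (inj_eq vec_inj) (negbTE gf).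
case: i0 => h.
  rewrite -(coef_v (fun h => v (inl h))).
  by rewrite -/c c0 skew_coef0.
rewrite -(coef_v (fun h => v (inr h))).
by rewrite -/d d0 skew_coef0.
Qed.

Lemma act_comp s t f : act s (act t f) = act (s + t) f.
Proof. by rewrite act_funD. Qed.

(* The anti-automorphism that fixes [L] and inverts the elements of [M]. *)
Definition skew_tau : S -> S :=
  skew_sum (act := act) (fun s f => skewU (act (- s) f) (- s)).

Fact skew_tau_term s : zmod_morphism (fun f => skewU (act := act) (act (- s) f) (- s)).
Proof. by move=> f g; rewrite rmorphB; exact: monalg.monalgUB. Qed.
Lemma skew_tauB : zmod_morphism skew_tau.
Proof. exact/skew_sumB/skew_tau_term. Qed.
HB.instance Definition _ := GRing.isZmodMorphism.Build S S skew_tau skew_tauB.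

Lemma skew_tauD x y : skew_tau (x + y) = skew_tau x + skew_tau y.
Proof. exact: (raddfD skew_tau). Qed.
Lemma skew_tau0 : skew_tau 0 = 0.
Proof. exact: (raddf0 skew_tau). Qed.
Lemma skew_tauU f s : skew_tau (skewU f s) = skewU (act (- s) f) (- s).
Proof. exact/skew_sumU/skew_tau_term. Qed.

Lemma skew_tauK : involutive skew_tau.
Proof.
apply: skew_elim => [|x y IHx IHy|f s]; first by rewrite !skew_tau0.
  rewrite 2!skew_tauD; exact: congr2 IHx IHy.
by rewrite (skew_tauU f) skew_tauU opprK act_comp subrr act_fun0.
Qed.

Lemma skew_tauM x y : skew_tau (x * y) = skew_tau y * skew_tau x.
Proof.
move: x; apply: skew_elim => [|x x' IH IH'|f s].
- by rewrite mul0r skew_tau0 mulr0.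
- rewrite (skew_tauD x) mulrDr -(congr2 _ IH IH') mulrDl; exact: skew_tauD.
move: y; apply: skew_elim => [|y y' IH IH'|g t].
- by rewrite mulr0 skew_tau0 mul0r.
- rewrite (skew_tauD y) mulrDl -(congr2 _ IH IH') mulrDr; exact: skew_tauD.
apply: etrans (congr1 skew_tau (skewUM _ _ _ _ _)) _.
apply: etrans (skew_tauU _ _) _.
apply: etrans _ (esym (congr2 _ (skew_tauU _ _) (skew_tauU _ _))).
apply: etrans _ (esym (skewUM _ _ _ _ _)).
have eM : - (s + t) = - t - s by rewrite opprD addrC.
suff eL : act (- (s + t)) (f * act s g) = act (- t) g * act (- t) (act (- s) f).
  exact: congr2 eL eM.
apply: etrans (rmorphM (act _) _ _) _; apply: etrans (mulrC _ _) _.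
apply: congr2; last by apply: etrans _ (esym (act_comp _ _ _)); rewrite eM.
by apply: etrans (act_comp _ _ _) _; rewrite opprD addrAC addNr add0r.
Qed.

Lemma skew_ore_right a b : b != 0 -> exists c d : S, c != 0 /\ a * c = b * d.
Proof.
move=> b0; have tau0 x : x != 0 -> skew_tau x != 0.
  by rewrite (raddf_eq0 _ (inv_inj skew_tauK)).
have [c [d [c0 e]]] := skew_ore_left (skew_tau a) (tau0 b b0).
exists (skew_tau c), (skew_tau d); split; first exact: tau0.
rewrite -[a]skew_tauK -[b]skew_tauK; apply: etrans (esym (skew_tauM _ _)) _.
by rewrite e; exact: skew_tauM.
Qed.

Definition skew_ore : ore_domain k :=
  OreDomain skew_mulf_eq0 skew_ore_right skew_ore_left.

End SkewShift.
Arguments skew_ore {k n q} act.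

(** * Invariants of classical reflection groups *)

(** Each factor is extended by 0 outside [A i], so that the sum runs over all dependent functions
    and distributivity applies. With this, orbit sums over a product of groups factor block by
    block. *)
Lemma big_setXn_distr (R : comNzRingType) (I : finType) (T : I -> finType)
    (A : forall i, {set T i}) (h : forall i, T i -> R) :
  \sum_(g in setXn A) \prod_i h i (g i) = \prod_i \sum_(j in A i) h i j.
Proof.
pose P i : {ffun T i -> R} := [ffun j => if j \in A i then h i j else 0].
transitivity (\sum_(g : {dffun forall i, T i}) \prod_i P i (g i)).
  rewrite big_mkcond; apply: eq_bigr => g _; case: (setXnP (A := A)) => gA.
    by apply: eq_bigr => i _; rewrite ffunE gA.
  have [i gi] : exists i, g i \notin A i.
    apply/existsP; rewrite -negb_forall; apply/negP => /forallP gA'.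
    exact: gA.
  by rewrite (bigD1 i) //= ffunE (negbTE gi) mul0r.
rewrite (reindex (@dffun_of_fprod I T)); last exact/onW_bij/dffun_of_fprod_bij.
transitivity (\sum_(t : fprod T) \prod_i P i (t i)).
  by apply: eq_bigr => t _; apply: eq_bigr => i _; congr (P i _); rewrite ffunE.
rewrite big_fprod; apply: etrans (esym (bigA_distr_big_dep (fun i => tagged_with T i) (fun i => untag 0 (P i)))) _.
apply: eq_bigr => i _.
apply: etrans (esym (big_tag (fun i => P i) i)) _; rewrite [RHS]big_mkcond; apply: eq_bigr => j _.
by rewrite ffunE.
Qed.

Section SymSum.
Variables (F : fieldType) (r : nat) (H : {pred F}).
Hypothesis H_closed : subring_closed H.
Implicit Types u z : 'I_r -> F.

Let H1 : 1 \in H. Proof. by case: H_closed. Qed.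
Let HB : {in H &, forall a b, a - b \in H}. Proof. by case: H_closed. Qed.
Let HM : {in H &, forall a b, a * b \in H}. Proof. by case: H_closed. Qed.
Let H0 : 0 \in H. Proof. by rewrite -(subrr 1) HB. Qed.
Let HN a : a \in H -> - a \in H. Proof. by move=> aH; rewrite -sub0r HB. Qed.
Let HD : {in H &, forall a b, a + b \in H}.
Proof. by move=> a b aH bH; rewrite -[b]opprK HB ?HN. Qed.
Let Hnat n : n%:R \in H.
Proof. by elim: n => // n IH; rewrite -natr1 HD. Qed.
Let Hint (i : int) : i%:~R \in H.
Proof. by case: i => i; rewrite ?NegzE ?mulrNz ?HN //; apply: Hnat. Qed.
Let HX a i : a \in H -> a ^+ i \in H.
Proof. by move=> aH; elim: i => [|i IH]; rewrite ?expr0 // exprS HM. Qed.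

Definition esym_val i u : F := mmap intr u (mesym r int i).

Lemma sym_poly_val (q : {mpoly int[r]}) u : q \is symmetric ->
  (forall i, (i < r)%N -> esym_val i.+1 u \in H) -> mmap intr u q \in H.
Proof.
move=> /sym_fundamental[t [<- _]] uH.
rewrite [t]mpolyE (raddf_sum (comp_mpoly _)) raddf_sum; apply: (big_ind (fun a => a \in H)) => // m _.
rewrite /= comp_mpolyZ /= mmapZ /=; apply: HM; first exact: Hint.
rewrite comp_mpolyX rmorph_prod; apply: (big_ind (fun a => a \in H)) => // i _.
by rewrite rmorphXn; apply: HX; rewrite tnth_mktuple; apply: uH.
Qed.

(** The sum is the value at [u] of a symmetric polynomial with integer coefficients, so the
    fundamental theorem expresses it through the elementary symmetric values. *)
Lemma sym_sum (P : 'I_r -> {poly int}) u :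
  (forall i, (i < r)%N -> esym_val i.+1 u \in H) ->
  \sum_(p : 'S_r) \prod_j (map_poly intr (P j)).[u (p j)] \in H.
Proof.
move=> uH; pose X i : {mpoly int[r]} := 'X_i.
pose q := \sum_(p : 'S_r) \prod_j (map_poly (@mpolyC r int) (P j)).[X (p j)].
suff [qsym <-] : q \is symmetric /\ mmap intr u q =
    \sum_(p : 'S_r) \prod_j (map_poly intr (P j)).[u (p j)].
  exact: sym_poly_val.
have horner_morph (R : comNzRingType) (f : {rmorphism {mpoly int[r]} -> R}) (Q : {poly int}) (a : {mpoly int[r]}) :
    f (map_poly (@mpolyC r int) Q).[a] = (map_poly intr Q).[f a].
  rewrite -horner_map -map_poly_comp; congr (_.[_]).
  apply: eq_map_poly => c /=; rewrite -[c]intz !rmorph_int.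
  by [].
split.
  apply/issymP => s; rewrite raddf_sum [RHS](reindex_inj (mulIg s)) /=.
  apply: eq_bigr => p _; rewrite rmorph_prod; apply: eq_bigr => j _ /=.
  apply: etrans (horner_morph _ (msym s) _ _) _.
  apply: etrans _ (esym (horner_morph _ idfun _ _)); congr (_.[_]).
  rewrite /X /= permM msymX; congr 'X_[_]; apply/mnmP => i.
  by rewrite mnmE !mnm1E -(inj_eq (@perm_inj _ s)) permKV.
rewrite raddf_sum; apply: eq_bigr => p _; rewrite /= rmorph_prod; apply: eq_bigr => j _.
by rewrite /= horner_morph /= mmapX mmap1U.
Qed.

End SymSum.

(* Chebyshev polynomials normalized so that z^i + z^-i = T_i(z + 1/z), and
   z^i - z^-i = (z - 1/z) U_i(z + 1/z); the pair is (P_i, P_(i+1)). *)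
Fixpoint chebT (i : nat) : {poly int} * {poly int} :=
  if i is i'.+1 then ((chebT i').2, 'X * (chebT i').2 - (chebT i').1) else (2%:R, 'X).
Fixpoint chebU (i : nat) : {poly int} * {poly int} :=
  if i is i'.+1 then ((chebU i').2, 'X * (chebU i').2 - (chebU i').1) else (0, 1).

Section Chebyshev.
Variables (F : fieldType) (z : F).
Hypothesis z0 : z != 0.
Local Notation ev P := (map_poly (intr : int -> F) P).[z + z^-1].

Lemma chebTE i : ev (chebT i).1 = z ^+ i + z ^- i.
Proof.
suff [] : ev (chebT i).1 = z ^+ i + z ^- i /\
          ev (chebT i).2 = z ^+ i.+1 + z ^- i.+1 by [].
elim: i => [|i [IH1 IH2]] /=.
  rewrite rmorph_nat map_polyX hornerX expr0 invr1 expr1; split=> //.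
  by rewrite -polyC_natr hornerC.
split=> //; rewrite rmorphB rmorphM /= map_polyX !hornerE IH1 IH2.
rewrite !exprS; have := expf_neq0 i z0; move: (z ^+ i) => w w0.
by field; rewrite w0 z0.
Qed.

Lemma chebUE i : (z - z^-1) * ev (chebU i).1 = z ^+ i - z ^- i.
Proof.
suff [] : (z - z^-1) * ev (chebU i).1 = z ^+ i - z ^- i /\
          (z - z^-1) * ev (chebU i).2 = z ^+ i.+1 - z ^- i.+1 by [].
elim: i => [|i [IH1 IH2]] /=.
  by rewrite rmorph0 rmorph1 !hornerE expr0 invr1 subrr expr1.
split=> //; rewrite rmorphB rmorphM /= map_polyX !hornerE mulrBr IH1.
rewrite mulrCA IH2.
rewrite !exprS; have := expf_neq0 i z0; move: (z ^+ i) => w w0.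
by field; rewrite w0 z0.
Qed.

Definition power_sum (a : int) : {poly int} := (chebT `|a|).1.
Definition power_diff (a : int) : {poly int} :=
  if (0 <= a)%R then (chebU `|a|).1 else - (chebU `|a|).1.

Lemma power_sumE (a : int) : z ^ a + z^-1 ^ a = ev (power_sum a).
Proof.
rewrite /power_sum chebTE exprz_inv.
case: a => a; first by rewrite absz_nat -invr_expz.
by rewrite NegzE opprK abszN absz_nat -invr_expz addrC.
Qed.

Lemma power_diffE (a : int) : z ^ a - z^-1 ^ a = (z - z^-1) * ev (power_diff a).
Proof.
rewrite /power_diff exprz_inv; case: a => a.
  by rewrite absz_nat chebUE -invr_expz.
rewrite NegzE opprK abszN absz_nat.
have -> : (0 <= - (a.+1)%:Z) = false by [].
by rewrite rmorphN hornerN mulrN chebUE -invr_expz opprB.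
Qed.
End Chebyshev.

(** * Invariants of a single block under permutations and inversions *)

Section Block.
Variables (F : fieldType) (r : nat).
Hypothesis F0 : [pchar F] =i pred0.
Implicit Types (z : 'I_r -> F) (g : signed_perm r) (c : classical_type).

Definition inv_sum z : 'I_r -> F := fun i => z i + (z i)^-1.

(* In type D, with u = z + 1/z, the product of the u_i - 2 and u_i + 2 is the
   square of the first generator; the second one and the e_i(u) for i <= r - 2
   then give the values of the polynomial of roots u_i at 2 and -2, hence
   e_(r-1)(u) and e_r(u). *)
Definition block_gen c z (j : 'I_r) : F :=
  match c with
  | TypeS => esym_val j.+1 z
  | TypeB => esym_val j.+1 (inv_sum z)
  | TypeD => if (r <= 1)%N then z j else
      match val j with
      | 0 => \prod_i (z i - (z i)^-1)
      | 1 => \prod_i (2 - inv_sum z i)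
      | i.+2 => esym_val i.+1 (inv_sum z)
      end
  end.

(** The multiplicative form of the action: a sign change of t_j becomes the inversion of x_j. *)
Definition sp_act g z : 'I_r -> F :=
  fun j => if sp_neg g j then (z (sp_perm g j))^-1 else z (sp_perm g j).

Lemma prod_sign (e : 'I_r -> bool) :
  \prod_i (-1) ^+ e i = (-1) ^+ odd #|[set i | e i]| :> F.
Proof.
rewrite signr_odd -prodr_const [RHS]big_mkcond; apply: eq_bigr => i _.
by rewrite inE; case: (e i).
Qed.

Lemma esym_val_perm i z (p : 'S_r) : esym_val i (fun j => z (p j)) = esym_val i z.
Proof.
rewrite /esym_val -[in RHS](issymP _ (mesym_sym r int i) p).
move: (mesym r int i) => q; rewrite [q]mpolyE (raddf_sum (msym p)) !raddf_sum.
apply: eq_bigr => m _ /=; rewrite msymZ !mmapZ msymX !mmapX; congr (_ * _).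
rewrite /mmap1 [RHS](reindex_inj (@perm_inj _ p)) /=.
by apply: eq_bigr => j _; rewrite mnmE permK.
Qed.

Lemma inv_sum_act g z : inv_sum (sp_act g z) =1 fun j => inv_sum z (sp_perm g j).
Proof.
by move=> j; rewrite /inv_sum /sp_act; case: ifP => // _; rewrite invrK addrC.
Qed.

Lemma esym_val_ext i z z' : z =1 z' -> esym_val i z = esym_val i z'.
Proof. by move=> zz'; have -> : z = z' by apply/funext. Qed.

Lemma block_gen_fixed c g z : g \in classical_set c r ->
  block_gen c (sp_act g z) =1 block_gen c z.
Proof.
have uE i : esym_val i (inv_sum (sp_act g z)) = esym_val i (inv_sum z).
  by rewrite (esym_val_ext _ (inv_sum_act g z)) esym_val_perm.
case: c => /= gc j.
- move: gc; rewrite inE => /forallP gc; rewrite -[RHS](esym_val_perm _ _ (sp_perm g)).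
  by apply: esym_val_ext => l; rewrite /sp_act (negbTE (gc l)).
- exact: uE.
move: gc; rewrite inE => gc.
have sgn : \prod_i (-1) ^+ sp_neg g i = 1 :> F by rewrite prod_sign (negbTE gc).
(* On one variable an even number of sign changes means none, so the group is trivial and the
   coordinate itself is an invariant. *)
rewrite /block_gen; have [r1|_] := leqP r 1.
  have g1 : sp_neg g j = false.
    apply: contraNF gc => gj; suff -> : [set i | sp_neg g i] = [set j] by rewrite cards1.
    apply/setP => i; rewrite !inE; have -> : i = j; last by rewrite eqxx.
    by apply/val_inj => /=; have := ltn_ord i; have := ltn_ord j; lia.
  rewrite /sp_act g1; congr (z _); apply/val_inj => /=.
  by have := ltn_ord (sp_perm g j); have := ltn_ord j; lia.
case: (val j) => [|[|i]] /=; last exact: uE.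
  rewrite [RHS](reindex_inj (@perm_inj _ (sp_perm g))) /=.
  apply: etrans (etrans (congr1 ( *%R^~ _) sgn) (mul1r _)).
  rewrite -big_split; apply: eq_bigr => i _; rewrite /sp_act /=; case: ifP => _; last by rewrite mul1r.
  by rewrite invrK mulN1r opprB.
rewrite [RHS](reindex_inj (@perm_inj _ (sp_perm g))) /=.
by apply: eq_bigr => i _; rewrite inv_sum_act.
Qed.


Section BlockSum.
Variables (H : {pred F}) (z : 'I_r -> F).
Hypothesis H_closed : divring_closed H.
Hypotheses (z0 : forall i, z i != 0) (z1 : forall i, z i != 1).

Let H1 : 1 \in H. Proof. by case: H_closed. Qed.
Let HB : {in H &, forall a b, a - b \in H}. Proof. by case: H_closed. Qed.
Let Hdiv : {in H &, forall a b, a / b \in H}. Proof. by case: H_closed. Qed.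
Let HV a : a \in H -> a^-1 \in H. Proof. by move=> aH; rewrite -[a^-1]mul1r Hdiv. Qed.
Let HM : {in H &, forall a b, a * b \in H}.
Proof. by move=> a b aH bH; rewrite -[b]invrK Hdiv ?HV. Qed.
Let H0 : 0 \in H. Proof. by rewrite -(subrr 1) HB. Qed.
Let HN a : a \in H -> - a \in H. Proof. by move=> aH; rewrite -sub0r HB. Qed.
Let HD : {in H &, forall a b, a + b \in H}.
Proof. by move=> a b aH bH; rewrite -[b]opprK HB ?HN. Qed.
Let Hnat i : i%:R \in H.
Proof. by elim: i => // i IH; rewrite -natr1 HD. Qed.
Let HX a i : a \in H -> a ^+ i \in H.
Proof. by move=> aH; elim: i => [|i IH]; rewrite ?expr0 // exprS HM. Qed.

Let sum_signed (f : signed_perm r -> F) (A : {set signed_perm r}) :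
  \sum_(g in A) f g =
  \sum_(p : 'S_r) \sum_(e : {ffun 'I_r -> bool} | SignedPerm p e \in A) f (SignedPerm p e).
Proof.
rewrite pair_big_dep /= (reindex (fun q : 'S_r * _ => SignedPerm q.1 q.2)) //=.
by exists (fun g => (sp_perm g, sp_neg g)) => [[]|[]].
Qed.

(** Multiplication by the power [c] of the product of the coordinates makes all exponents
    nonnegative, since [c] dominates every |a j|. That product is itself the last elementary
    symmetric function, so it can be divided out again. *)
Lemma block_sum_S (a : 'I_r -> int) : (forall j, block_gen TypeS z j \in H) ->
  \sum_(g in classical_set TypeS r) \prod_j sp_act g z j ^ a j \in H.
Proof.
move=> genH; have eH i : (i < r)%N -> esym_val i.+1 z \in H.
  by move=> ir; have := genH (Ordinal ir).
pose c := (\sum_j absz (a j))%N.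
have ac j : a j + c%:Z = absz (a j + c%:Z).
  rewrite gez0_abs //; have : (absz (a j) <= c)%N by rewrite /c (bigD1 j) //= leq_addr.
  by lia.
have prodH : \prod_j z j \in H.
  case: (posnP r) => [r0|rpos].
    by rewrite big1 // => j; have := ltn_ord j; rewrite {2}r0.
  have := eH r.-1; rewrite prednK // => /(_ (leqnn _)).
  rewrite /esym_val mesymnnE rmorph_prod /= => h; rewrite (eq_bigr (fun j => z j)) in h => //.
  by move=> j _; rewrite mmapX mmap1U.
have -> : \sum_(g in classical_set TypeS r) \prod_j sp_act g z j ^ a j =
  (\prod_j z j) ^- c * \sum_(p : 'S_r) \prod_j (map_poly intr 'X^(absz (a j + c%:Z))).[z (p j)].
  rewrite sum_signed mulr_sumr; apply: eq_bigr => p _.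
  rewrite (big_pred1 [ffun=> false]) => [|e]; last first.
    rewrite /= inE /=; apply/forallP/eqP => [e0|-> j]; last by rewrite ffunE.
    by apply/ffunP => j; rewrite ffunE; apply/negbTE.
  have -> : \prod_j z j = \prod_j z (p j) by rewrite (reindex_inj (@perm_inj _ p)).
  rewrite -prodrXl -prodfV -big_split; apply: eq_bigr => j _ /=.
  rewrite /sp_act ffunE /= map_polyXn hornerXn; apply: (canRL (mulKf _)).
    exact: expf_neq0.
  by rewrite (exprnP (z (p j)) (absz _)) -ac expfzDr ?z0 // mulrC.
apply: HM; first by apply/HV/HX.
exact: sym_sum.
Qed.


(** For a fixed permutation, the sum over all sign patterns is the product of the factors z^a +
    z^-a, each a polynomial in z + 1/z. *)
Lemma block_sum_even (a : 'I_r -> int) :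
  (forall i, (i < r)%N -> esym_val i.+1 (inv_sum z) \in H) ->
  \sum_(g in [set: signed_perm r]) \prod_j sp_act g z j ^ a j \in H.
Proof.
move=> eH; rewrite sum_signed.
have -> : \sum_(p : 'S_r) \sum_(e | SignedPerm p e \in [set: signed_perm r])
     \prod_j sp_act (SignedPerm p e) z j ^ a j =
  \sum_(p : 'S_r) \prod_j (map_poly intr (power_sum (a j))).[inv_sum z (p j)].
  apply: eq_bigr => p _; rewrite [LHS](eq_bigl predT) => [|e]; last by rewrite inE.
  under [RHS]eq_bigr do rewrite -power_sumE ?z0 //.
  pose w j (b : bool) := (if b then (z (p j))^-1 else z (p j)) ^ a j.
  rewrite -[LHS](bigA_distr_bigA w); apply: eq_bigr => j _.
  by rewrite big_bool addrC.
exact: sym_sum.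
Qed.

(** The sign character turns the factors into z^a - z^-a. Each is z - 1/z times a polynomial in z +
    1/z, and the product of the z - 1/z comes out of the sum up to reordering. *)
Lemma block_sum_odd (a : 'I_r -> int) :
  (forall i, (i < r)%N -> esym_val i.+1 (inv_sum z) \in H) ->
  \prod_i (z i - (z i)^-1) \in H ->
  \sum_(g in [set: signed_perm r])
    (\prod_j (-1) ^+ sp_neg g j) * (\prod_j sp_act g z j ^ a j) \in H.
Proof.
move=> eH dH; rewrite sum_signed.
have -> : \sum_(p : 'S_r) \sum_(e | SignedPerm p e \in [set: signed_perm r])
     (\prod_j (-1) ^+ sp_neg (SignedPerm p e) j) * \prod_j sp_act (SignedPerm p e) z j ^ a j =
  \prod_i (z i - (z i)^-1) *
  \sum_(p : 'S_r) \prod_j (map_poly intr (power_diff (a j))).[inv_sum z (p j)].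
  rewrite mulr_sumr; apply: eq_bigr => p _; rewrite [LHS](eq_bigl predT) => [|e]; last by rewrite inE.
  rewrite (reindex_inj (@perm_inj _ p)) /= -big_split /=.
  under [RHS]eq_bigr do rewrite -power_diffE ?z0 //.
  pose w j (b : bool) : F := (-1) ^+ b * (if b then (z (p j))^-1 else z (p j)) ^ a j.
  transitivity (\sum_(e : {ffun 'I_r -> bool}) \prod_j w j (e j)).
    by apply: eq_bigr => e _; rewrite -big_split.
  rewrite -bigA_distr_bigA; apply: eq_bigr => j _.
  by rewrite big_bool /w /= mul1r mulN1r addrC.
apply: HM => //; exact: sym_sum.
Qed.

Lemma prod_sub_esym (u : 'I_r -> F) (b : F) :
  \prod_i (b - u i) = \sum_(k < r.+1) (-1) ^+ k * (esym_val k u * b ^+ (r - k)).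
Proof.
have := congr1 (fun P => (map_poly (mmap (intr : int -> F) u) P).[b]) (Viete r).
rewrite rmorph_prod raddf_sum horner_prod /= => e.
transitivity (\prod_(i < r) (map_poly (mmap (intr : int -> F) u) ('X - ('X_i)%:P)).[b]).
  apply: eq_bigr => i _; rewrite rmorphB /= map_polyX map_polyC !hornerE /= mmapX mmap1U.
  by [].
rewrite {}e horner_sum; apply: eq_bigr => k _ /=.
rewrite -!mul_polyC !rmorphM /= !map_polyC /= map_polyXn !hornerE /= rmorphXn /= rmorphN1.
by [].
Qed.

Let four0 : 4 != 0 :> F. Proof. by rewrite (pcharf0P F).1. Qed.
Let two0 : 2 != 0 :> F. Proof. by rewrite (pcharf0P F).1. Qed.

Lemma esym_typeD : (2 <= r)%N -> (forall j, block_gen TypeD z j \in H) ->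
  forall i, (i < r)%N -> esym_val i.+1 (inv_sum z) \in H.
Proof.
move=> r2; set u := inv_sum z.
have [r' rE] : exists r', r = r'.+2 by exists r.-2; lia.
have r1 : (r <= 1)%N = false by lia.
move=> genH; have genD j := genH j; rewrite /block_gen r1 in genD.
have dH : \prod_i (z i - (z i)^-1) \in H.
  have lt0 : (0 < r)%N by lia.
  exact: genD (Ordinal lt0).
have AH : \prod_i (2 - u i) \in H.
  have lt1 : (1 < r)%N by lia.
  exact: genD (Ordinal lt1).
have eH i : (i <= r')%N -> esym_val i u \in H.
  case: i => [|i] lti; first by rewrite /esym_val mesym0E rmorph1.
  have lt2 : (i.+2 < r)%N by lia.
  exact: genD (Ordinal lt2).
(* With u = z + 1/z, (2 - u)(-2 - u) = u^2 - 4 = (z - 1/z)^2. The division is legitimate because 2 -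
   u = -(z - 1)^2 / z and no coordinate equals 1. *)
have A2H : \prod_i (- 2 - u i) \in H.
  suff -> : \prod_i (- 2 - u i) = (\prod_i (z i - (z i)^-1)) ^+ 2 / \prod_i (2 - u i).
    by apply: Hdiv => //; apply: HX.
  have A0 : \prod_i (2 - u i) != 0.
    apply/prodf_neq0 => i _; rewrite /u /inv_sum.
    have -> : 2 - (z i + (z i)^-1) = - (z i - 1) ^+ 2 / z i by field.
    by rewrite mulf_neq0 ?invr_eq0 // oppr_eq0 expf_neq0 // subr_eq0.
  apply: (canRL (mulfK A0)); rewrite -prodrXl -big_split; apply: eq_bigr => i _ /=.
  by rewrite /u /inv_sum; field.
pose K b := \sum_(k < r'.+1) (-1) ^+ k * (esym_val k u * b ^+ (r - k)).
have KH b : b \in H -> K b \in H.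
  move=> bH; apply: (big_ind (fun a => a \in H)) => // k _.
  by apply: HM; [apply/HX/HN|apply: HM; [apply: eH; rewrite -ltnS|apply: HX]].
have prodE b : \prod_i (b - u i) = K b + (-1) ^+ r'.+1 * (esym_val r'.+1 u * b)
    + (-1) ^+ r'.+2 * esym_val r'.+2 u.
  rewrite prod_sub_esym -(big_mkord xpredT (fun k => (-1) ^+ k * (esym_val k u * b ^+ (r - k)))).
  have -> : index_iota 0 r.+1 = index_iota 0 r'.+3 by rewrite rE.
  rewrite big_mkord 2!big_ord_recr /= -/(K b).
  have [-> ->] : (r - r'.+1 = 1 /\ r - r'.+2 = 0)%N by lia.
  by rewrite expr1 expr0 mulr1.
move: A2H AH; rewrite !prodE => A2H AH.
(* Subtracting the values at 2 and -2 cancels the term of e_r. Besides the known parts [K], it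
   leaves 4 times the signed e_(r-1), and 4 is invertible in characteristic 0. *)
have Ks2 : (-1) ^+ r'.+1 * esym_val r'.+1 u =
  (((K 2 + (-1) ^+ r'.+1 * (esym_val r'.+1 u * 2) + (-1) ^+ r'.+2 * esym_val r'.+2 u)
   - (K (-2) + (-1) ^+ r'.+1 * (esym_val r'.+1 u * -2) + (-1) ^+ r'.+2 * esym_val r'.+2 u))
   - (K 2 - K (-2))) / 4 by field.
have KH2 := KH _ (Hnat 2); have KHm2 := KH _ (HN (Hnat 2)).
have s1H : (-1) ^+ r'.+1 * esym_val r'.+1 u \in H.
  by rewrite Ks2; apply: Hdiv; [apply: HB; apply: HB|apply: (Hnat 4)].
have s2H : (-1) ^+ r'.+2 * esym_val r'.+2 u \in H.
  have -> : (-1) ^+ r'.+2 * esym_val r'.+2 u =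
    (K 2 + (-1) ^+ r'.+1 * (esym_val r'.+1 u * 2) + (-1) ^+ r'.+2 * esym_val r'.+2 u)
    - (K 2 + ((-1) ^+ r'.+1 * esym_val r'.+1 u) * 2) by ring.
  by apply: HB => //; apply: HD => //; apply: HM => //; apply: (Hnat 2).
have sgnH i a : (-1) ^+ i * a \in H -> a \in H.
  by move=> /(HM (HX i (HN H1))); rewrite signrMK.
move=> i ir; have [le|lt] := leqP i.+1 r'; first exact: eH.
have [->|ne] := eqVneq i r'; first exact: sgnH s1H.
suff -> : i = r'.+1 by exact: sgnH s2H.
apply/eqP; rewrite eqn_leq; move: ir; rewrite {1}rE ltnS => ->.
by rewrite ltn_neqAle eq_sym ne -ltnS.
Qed.

(** D_r is the kernel of the character of B_r given by the parity of the sign changes, so its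
    indicator is half the sum of 1 and this character. The two resulting sums are [block_sum_even]
    and [block_sum_odd]. For r at most 1, type D coincides with type S. *)
Lemma block_sum c (a : 'I_r -> int) : (forall j, block_gen c z j \in H) ->
  \sum_(g in classical_set c r) \prod_j sp_act g z j ^ a j \in H.
Proof.
case: c => genH; first exact: block_sum_S.
  by apply: block_sum_even => i ir; have := genH (Ordinal ir).
have [r1|r2] := leqP r 1.
  have -> : classical_set TypeD r = classical_set TypeS r.
    apply/setP => g; rewrite !inE.
    have : (#|[set j | sp_neg g j]| <= 1)%N.
      by apply: leq_trans (max_card _) _; rewrite card_ord.
    case E: #|_| => [|[|//]] _; apply/esym; last first.
      apply/negbTE/negP => /forallP e; move/eqP: E; rewrite eqn_leq andbC => /andP[+ _].
      by case/card_gt0P => j; rewrite inE (negbTE (e j)).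
    by apply/forallP => j; move/cards0_eq/setP/(_ j): E; rewrite !inE => ->.
  apply: block_sum_S => j; have := genH j; rewrite /= r1.
  suff -> : esym_val j.+1 z = z j by [].
  have j0 : val j = 0%N by have := ltn_ord j => /=; lia.
  rewrite /esym_val j0 mesym1E raddf_sum (bigD1 j) //= big1 => [|i /negP[]].
    by rewrite addr0 mmapX mmap1U.
  by apply/eqP/val_inj => /=; have := ltn_ord i; have := ltn_ord j; lia.
have eH := esym_typeD r2 genH.
have dH : \prod_i (z i - (z i)^-1) \in H.
  have lt0 : (0 < r)%N by lia.
  by have := genH (Ordinal lt0); rewrite /= leqNgt r2.
have -> : \sum_(g in classical_set TypeD r) \prod_j sp_act g z j ^ a j =
  (\sum_(g in [set: signed_perm r]) \prod_j sp_act g z j ^ a j +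
   \sum_(g in [set: signed_perm r])
     (\prod_j (-1) ^+ sp_neg g j) * (\prod_j sp_act g z j ^ a j)) / 2.
  rewrite -big_split mulr_suml big_mkcond [RHS]big_mkcond /=.
  apply: eq_bigr => g _; rewrite !inE prod_sign.
  by case: (odd _) => /=; field.
by apply: Hdiv; [apply: HD; [apply: block_sum_even|apply: block_sum_odd]|apply: (Hnat 2)].
Qed.

End BlockSum.
End Block.

Inductive ring_gen (R : nzRingType) (P : R -> Prop) : R -> Prop :=
| ring_gen_base a : P a -> ring_gen P a
| ring_gen_1 : ring_gen P 1
| ring_gen_B a b : ring_gen P a -> ring_gen P b -> ring_gen P (a - b)
| ring_gen_M a b : ring_gen P a -> ring_gen P b -> ring_gen P (a * b).

Inductive div_gen (R : unitRingType) (P : R -> Prop) : R -> Prop :=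
| div_gen_base a : P a -> div_gen P a
| div_gen_1 : div_gen P 1
| div_gen_B a b : div_gen P a -> div_gen P b -> div_gen P (a - b)
| div_gen_div a b : div_gen P a -> div_gen P b -> div_gen P (a / b).

Lemma ring_gen_0 (R : nzRingType) (P : R -> Prop) : ring_gen P 0.
Proof. by rewrite -(subrr 1); do 2?constructor. Qed.
Lemma ring_gen_N (R : nzRingType) (P : R -> Prop) a : ring_gen P a -> ring_gen P (- a).
Proof. by move=> Pa; rewrite -sub0r; apply: ring_gen_B => //; apply: ring_gen_0. Qed.
Lemma ring_gen_D (R : nzRingType) (P : R -> Prop) a b :
  ring_gen P a -> ring_gen P b -> ring_gen P (a + b).
Proof. by move=> Pa Pb; rewrite -[b]opprK; apply: ring_gen_B => //; apply: ring_gen_N. Qed.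

Lemma div_gen_0 (R : unitRingType) (P : R -> Prop) : div_gen P 0.
Proof. by rewrite -(subrr 1); do 2?constructor. Qed.
Lemma div_gen_V (R : unitRingType) (P : R -> Prop) a : div_gen P a -> div_gen P a^-1.
Proof. by move=> Pa; rewrite -[_^-1]mul1r; apply: div_gen_div => //; apply: div_gen_1. Qed.
Lemma div_gen_M (R : unitRingType) (P : R -> Prop) a b :
  div_gen P a -> div_gen P b -> div_gen P (a * b).
Proof. by move=> Pa Pb; rewrite -[b]invrK; apply: div_gen_div => //; apply: div_gen_V. Qed.

Definition coord_gens (K : fieldType) (R : nzRingType) (I : Type) (kap : K -> R)
  (x : I -> R) (e : R) : Prop := (exists c, e = kap c) \/ exists i, e = x i.

Lemma div_gen_frac (F : fieldType) (P : F -> Prop) f : div_gen P f ->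
  exists a b, [/\ ring_gen P a, ring_gen P b, b != 0 & f = a / b].
Proof.
have g1 := @ring_gen_1 F P.
elim=> {f} [a Pa||f f' _ [a [b [Pa Pb b0 ->]]] _ [a' [b' [Pa' Pb' b'0 ->]]]
            |f f' _ [a [b [Pa Pb b0 ->]]] _ [a' [b' [Pa' Pb' b'0 ->]]]].
- by exists a, 1; rewrite oner_neq0 divr1; split=> //; apply: ring_gen_base.
- by exists 1, 1; rewrite oner_neq0 divr1.
- exists (a * b' - a' * b), (b * b'); split.
  + by apply: ring_gen_B; apply: ring_gen_M.
  + exact: ring_gen_M.
  + exact: mulf_neq0.
  + by field; rewrite b0 b'0.
have [->|a'0] := eqVneq a' 0.
  by exists 0, 1; rewrite !mul0r invr0 mulr0 oner_neq0; split=> //; apply: ring_gen_0.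
exists (a * b'), (b * a'); split.
+ exact: ring_gen_M.
+ exact: ring_gen_M.
+ exact: mulf_neq0.
+ by field; rewrite b0 b'0 a'0.
Qed.

Section BlockMorphism.
Variables (F : fieldType) (r : nat).

Lemma block_gen_ext c (z z' : 'I_r -> F) : z =1 z' -> block_gen c z =1 block_gen c z'.
Proof. by move=> zz' j; have -> : z = z' by apply/funext. Qed.

Lemma rmorph_esym_val (s : {rmorphism F -> F}) i (z : 'I_r -> F) :
  s (esym_val i z) = esym_val i (s \o z).
Proof.
rewrite /esym_val /mmap rmorph_sum; apply: eq_bigr => m _.
rewrite rmorphM /= rmorph_int rmorph_prod; congr (_ * _).
by apply: eq_bigr => j _; rewrite rmorphXn.
Qed.

Lemma rmorph_block_gen (s : {rmorphism F -> F}) c (z : 'I_r -> F) j :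
  s (block_gen c z j) = block_gen c (s \o z) j.
Proof.
have uE : s \o inv_sum z =1 inv_sum (s \o z).
  by move=> i; rewrite /inv_sum /= rmorphD fmorphV.
have eE i : s (esym_val i (inv_sum z)) = esym_val i (inv_sum (s \o z)).
  by rewrite rmorph_esym_val; apply: esym_val_ext.
rewrite /block_gen; case: c; first exact: rmorph_esym_val.
  exact: eE.
case: leqP => // _; case: (val j) => [|[|i]]; last exact: eE.
  rewrite rmorph_prod; apply: eq_bigr => i _.
  by rewrite rmorphB fmorphV.
rewrite rmorph_prod; apply: eq_bigr => i _.
by rewrite rmorphB rmorph_nat -uE.
Qed.
End BlockMorphism.

(** * Rational invariants of the product group *)

Section Invariants.
Context {K F : fieldType} {N : nat} {n_ : 'I_N -> nat}.
Local Notation n := (\sum_(s < N) n_ s)%N.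
Local Notation W := {dffun forall s : 'I_N, signed_perm (n_ s)}.
Variables (kap : {rmorphism K -> F}) (cl : 'I_N -> classical_type).
Variables (x : 'I_n -> F) (sig : W -> {rmorphism F -> F}).
Local Notation G := (reflection_group n_ cl).
Hypothesis F0 : [pchar F] =i pred0.
Hypotheses (x0 : forall a, x a != 0) (x1 : forall a, x a != 1).
Hypothesis sig1 : sig 1%g =1 id.
Hypothesis sigM : forall g h, sig (g * h)%g =1 sig h \o sig g.
Hypothesis sig_kap : forall g c, sig g (kap c) = kap c.
Hypothesis sig_x : forall g a, sig g (x a) =
  if refl_neg g a then (x (refl_idx g a))^-1 else x (refl_idx g a).

Definition block_coord (s : 'I_N) (j : 'I_(n_ s)) : F := x (tagnat.Rank s j).

Definition invariant_gen (a : 'I_n) : F :=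
  block_gen (cl (tag (tagnat.sig a))) (@block_coord (tag (tagnat.sig a)))
    (tagged (tagnat.sig a)).

Lemma sig_block_coord g s j :
  sig g (block_coord j) = sp_act (g s) (@block_coord s) j.
Proof.
by rewrite sig_x /sp_act /refl_neg /refl_idx /tagnat.Rank tagnat.rankK.
Qed.

Lemma invariant_gen_fixed g a : g \in G -> sig g (invariant_gen a) = invariant_gen a.
Proof.
move=> /setXnP gG; rewrite /invariant_gen rmorph_block_gen.
have E s : sig g \o @block_coord s =1 sp_act (g s) (@block_coord s).
  by move=> j; apply: sig_block_coord.
by rewrite (block_gen_ext _ (E _)) block_gen_fixed //; apply: gG.
Qed.

Let H : {pred F} := fun f => `[< div_gen (coord_gens kap invariant_gen) f >].
Let H_closed : divring_closed H.
Proof.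
split=> [|a b /asboolP aH /asboolP bH|a b /asboolP aH /asboolP bH]; apply/asboolP.
- exact: div_gen_1.
- exact: div_gen_B.
- exact: div_gen_div.
Qed.

(** The group is a direct product acting on disjoint sets of variables, so the orbit sum of a
    Laurent monomial is the product of the sums treated in [block_sum]. *)
Let orbit_sumH (e : 'I_n -> int) :
  \sum_(g in G) \prod_a sig g (x a) ^ e a \in H.
Proof.
have -> : \sum_(g in G) \prod_a sig g (x a) ^ e a =
    \sum_(g in G) \prod_s \prod_j sp_act (g s) (@block_coord s) j ^ e (tagnat.Rank s j).
  apply: eq_bigr => g _; rewrite sig_big_dep /= (reindex (@tagnat.rank _ n_)) /=.
    apply: eq_bigr => -[s j] _ /=; rewrite -sig_block_coord.
    by rewrite /block_coord /tagnat.Rank.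
  by apply: onW_bij; exists tagnat.sig; [exact: tagnat.rankK|exact: tagnat.sigK].
rewrite (big_setXn_distr _ (fun s (h : signed_perm (n_ s)) =>
  \prod_j sp_act h (@block_coord s) j ^ e (tagnat.Rank s j))).
case: (H_closed) => H1 _ Hdiv.
apply: (big_ind (fun f => f \in H)) => // [a b aH bH|s _].
  by rewrite -[b]invrK Hdiv // -[b^-1]mul1r Hdiv.
apply: (block_sum F0 H_closed) => [j|j|j]; rewrite ?x0 ?x1 //.
apply/asboolP/div_gen_base; right; exists (tagnat.Rank s j).
suff genE p : invariant_gen (tagnat.rank p) =
    block_gen (cl (tag p)) (@block_coord (tag p)) (tagged p) by rewrite /tagnat.Rank genE.
by rewrite /invariant_gen tagnat.rankK.
Qed.

Local Notation laurent := (ring_gen (fun e => coord_gens kap x e \/ exists a, e = (x a)^-1)).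

Let laurent_sum f : laurent f -> exists r : seq (K * ('I_n -> int)),
  f = \sum_(p <- r) kap p.1 * \prod_a x a ^ p.2 a.
Proof.
have kapE c : kap c = \sum_(p <- [:: (c, fun=> 0)]) kap p.1 * \prod_a x a ^ p.2 a :> F.
  by rewrite big_seq1 [X in _ * X]big1 ?mulr1.
have xE i (e : int) : x i ^ e = \sum_(p <- [:: (1, fun b => if b == i then e else 0)])
    kap p.1 * \prod_a x a ^ p.2 a.
  rewrite big_seq1 rmorph1 mul1r (bigD1 i) //= eqxx [X in _ * X]big1 ?mulr1 // => b /negbTE ->.
  by [].
elim=> {f} [a [[[c ->]|[i ->]]|[i ->]]||a b _ [r ->] _ [r' ->]|a b _ [r ->] _ [r' ->]].
- by eexists; apply: kapE.
- by eexists; rewrite -[LHS]expr1z; apply: xE.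
- by eexists; rewrite -[LHS]/(x i ^ -1); apply: xE.
- by eexists; rewrite -[LHS](rmorph1 kap); apply: kapE.
- exists (r ++ [seq (- p.1, p.2) | p <- r']); rewrite big_cat big_map /=; congr (_ + _).
  by rewrite -sumrN; apply: eq_bigr => p _; rewrite rmorphN mulNr.
exists [seq (p.1 * p'.1, fun b => p.2 b + p'.2 b) | p <- r, p' <- r'].
rewrite big_allpairs_dep /= big_distrlr /=; apply: eq_bigr => p _; apply: eq_bigr => p' _.
rewrite rmorphM mulrACA -big_split; congr (_ * _); apply: eq_bigr => l _.
by rewrite expfzDr.
Qed.

Let laurent_sig g f : laurent f -> laurent (sig g f).
Proof.
elim=> {f} [a [[[c ->]|[i ->]]|[i ->]]||a b _ IHa _ IHb|a b _ IHa _ IHb].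
- by rewrite sig_kap; apply: ring_gen_base; left; left; exists c.
- rewrite sig_x; apply: ring_gen_base; case: ifP => _; first by right; eexists.
  by left; right; eexists.
- rewrite fmorphV sig_x; apply: ring_gen_base; case: ifP => _; last by right; eexists.
  by left; right; rewrite invrK; eexists.
- by rewrite rmorph1; apply: ring_gen_1.
- by rewrite rmorphB; apply: ring_gen_B.
- by rewrite rmorphM; apply: ring_gen_M.
Qed.

(** An invariant Laurent polynomial equals its average over G, which is a combination of orbit sums
    of monomials. *)
Let laurent_fixed f : laurent f -> (forall g, g \in G -> sig g f = f) -> f \in H.
Proof.
move=> /laurent_sum[r fE] fG.
case: (H_closed) => H1 HB Hdiv.
have HM a b : a \in H -> b \in H -> a * b \in H.
  by move=> aH bH; rewrite -[b]invrK Hdiv // -[b^-1]mul1r Hdiv.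
have H0 : 0 \in H by rewrite -(subrr 1) HB.
have HD a b : a \in H -> b \in H -> a + b \in H.
  by move=> aH bH; rewrite -[b]opprK HB // -sub0r HB.
have -> : f = (\sum_(p <- r) kap p.1 * \sum_(g in G) \prod_a sig g (x a) ^ p.2 a) / #|G|%:R.
  have G0 : #|G|%:R != 0 :> F.
    by rewrite (pcharf0P F).1 // -lt0n cardG_gt0.
  apply: (canRL (mulfK G0)); rewrite mulr_natr -sumr_const.
  transitivity (\sum_(g in G) \sum_(p <- r) kap p.1 * \prod_a sig g (x a) ^ p.2 a).
    apply: eq_bigr => g gG; rewrite -[LHS](fG g gG) fE rmorph_sum; apply: eq_bigr => p _.
    rewrite rmorphM /= sig_kap rmorph_prod; congr (_ * _); apply: eq_bigr => a _.
    by rewrite fmorphXz.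
  by rewrite exchange_big; apply: eq_bigr => p _; rewrite mulr_sumr.
apply: Hdiv; last by elim: #|G| => // i IH; rewrite -natr1 HD.
apply: (big_ind (fun f => f \in H)) => // p _; apply: HM; last exact: orbit_sumH.
by apply/asboolP/div_gen_base; left; exists p.1.
Qed.

(** Multiplication by the norm [b'] of the denominator reduces an invariant fraction to a quotient
    of two invariant Laurent polynomials. *)
Lemma fixed_div_gen f : div_gen (coord_gens kap x) f ->
  (forall g, g \in G -> sig g f = f) ->
  div_gen (coord_gens kap invariant_gen) f.
Proof.
move=> /div_gen_frac[a [b [aP bP b0 fE]]] fG.
have sub e : ring_gen (coord_gens kap x) e -> laurent e.
  elim=> {e} [e eP||e e' _ IH _ IH'|e e' _ IH _ IH'].
  - by apply: ring_gen_base; left.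
  - exact: ring_gen_1.
  - exact: ring_gen_B.
  - exact: ring_gen_M.
pose b' := \prod_(g in G) sig g b.
have b'0 : b' != 0 by apply/prodf_neq0 => g _; rewrite fmorph_eq0.
have prodL (A : {pred W}) : laurent (\prod_(g in A) sig g b).
  apply: (big_ind laurent) => [|u v|g _]; [exact: ring_gen_1|exact: ring_gen_M|].
  exact/laurent_sig/sub.
have b'G g : g \in G -> sig g b' = b'.
  move=> gG; rewrite /b' rmorph_prod [RHS](reindex_inj (mulIg g)).
  apply: eq_big => h; first by rewrite groupMr.
  by move=> _; rewrite sigM.
have b'L : laurent b' by exact: prodL.
have a'L : laurent (f * b').
  rewrite /b' (bigD1 1%g) ?group1 //= sig1 fE mulrA divfK //.
  apply: ring_gen_M; first exact: sub.
  exact: prodL [pred g in G | g != 1%g].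
have -> : f = f * b' / b' by rewrite mulfK.
case: (H_closed) => _ _ Hdiv; apply/asboolP; apply: Hdiv; apply: laurent_fixed => //.
by move=> g gG; rewrite rmorphM fG ?b'G.
Qed.
End Invariants.

(** * Derivations and characters of skew fields *)

Section DerivationFixed.
Variables (F : fieldType) (gT : finGroupType) (G : {group gT}).
Variables (sig : gT -> {rmorphism F -> F}) (D : F -> F).
Hypothesis sig1 : sig 1%g =1 id.
Hypothesis sigM : forall g h, sig (g * h)%g =1 sig h \o sig g.
Hypothesis DB : zmod_morphism D.
Hypothesis DM : forall f h, D (f * h) = D f * h + f * D h.
Hypothesis D_fixed : forall f, (forall g, g \in G -> sig g f = f) -> D f = 0.

(* [f] is a simple root of the product of [X - r] over its orbit, whose
   coefficients are invariant. *)
Lemma derivation_fixed f : D f = 0.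
Proof.
have D0 : D 0 = 0 by have := DB 0 0; rewrite !subrr.
have DD : {morph D : u v / u + v}.
  move=> u v; have -> : u + v = u - (0 - v) by rewrite sub0r opprK.
  by rewrite !DB D0 sub0r opprK.
have DP (P : {poly F}) : (forall i, D P`_i = 0) -> D P.[f] = P^`().[f] * D f.
  elim/poly_ind: P => [_|Q c IH]; first by rewrite deriv0 horner0 mul0r D0.
  move=> DQ; rewrite derivD derivM derivX derivC addr0 mulr1 !hornerE DD DM IH.
    have := DQ 0%N; rewrite coefD coefMX coefC add0r => ->.
    by rewrite addr0 mulrDl mulrAC.
  by move=> i; have := DQ i.+1; rewrite coefD coefMX coefC addr0.
pose s := undup [seq sig g f | g <- enum G].
have fs : f \in s.
  by rewrite mem_undup; apply/mapP; exists 1%g; rewrite ?mem_enum ?group1 ?sig1.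
pose P := \prod_(r <- s) ('X - r%:P).
have P_fixed i : D P`_i = 0.
  apply: D_fixed => g gG; rewrite -coef_map.
  suff -> : map_poly (sig g) P = P by [].
  rewrite /P rmorph_prod /=.
  transitivity (\prod_(r <- [seq sig g r | r <- s]) ('X - r%:P)).
    by rewrite big_map; apply: eq_bigr => r _; rewrite rmorphB /= map_polyX map_polyC.
  apply: perm_big; apply: uniq_perm.
  - by rewrite map_inj_uniq ?undup_uniq //; apply: fmorph_inj.
  - exact: undup_uniq.
  - suff sub : {subset [seq sig g r | r <- s] <= s}.
      apply: (uniq_min_size _ sub _).2; last by rewrite size_map.
      by rewrite map_inj_uniq ?undup_uniq //; apply: fmorph_inj.
    move=> _ /mapP[r rs ->]; move: rs; rewrite !mem_undup => /mapP[h hG ->].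
    apply/mapP; exists (h * g)%g; last by rewrite sigM.
    by rewrite mem_enum groupM // -mem_enum.
have PE : P = ('X - f%:P) * \prod_(r <- rem f s) ('X - r%:P) by rewrite /P (big_rem f).
have P'f : P^`().[f] != 0.
  rewrite PE derivM derivXsubC mul1r hornerD hornerM hornerXsubC subrr mul0r addr0.
  rewrite horner_prod prodf_seq_neq0; apply/allP => r; rewrite mem_rem_uniq ?undup_uniq //.
  by rewrite inE hornerXsubC subr_eq0 eq_sym => /andP[-> _].
have := DP P P_fixed; have -> : P.[f] = 0 by rewrite PE hornerM hornerXsubC subrr mul0r.
by rewrite D0 => /esym/eqP; rewrite mulf_eq0 (negbTE P'f) => /eqP.
Qed.
End DerivationFixed.

Section SkewFieldTheory.
Variables (E : unitRingType).
Hypothesis E_skew : skew_field E.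

Lemma skew_mulf_eq0' (a b : E) : a * b = 0 -> a = 0 \/ b = 0.
Proof.
move=> ab; have [->|a0] := eqVneq a 0; first by left.
by right; rewrite -[b](mulKr (E_skew a0)) ab mulr0.
Qed.

Lemma skew_mulf_neq0 (a b : E) : a != 0 -> b != 0 -> a * b != 0.
Proof. by move=> a0 b0; apply/eqP => /skew_mulf_eq0'[]; apply/eqP. Qed.

Lemma skew_invM (a b : E) : a != 0 -> b != 0 -> (a * b)^-1 = b^-1 * a^-1.
Proof. by move=> a0 b0; rewrite invrM ?E_skew. Qed.

Lemma skew_inv_neq0 (a : E) : a != 0 -> a^-1 != 0.
Proof. by move=> a0; apply: contraNneq a0 => e; rewrite -[a]invrK e invr0. Qed.

(** * Independence of characters with values in a skew field *)

Section Dedekind.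
Variables (I : eqType) (chi : I -> {rmorphism E -> E}) (Lam : E -> Prop).
Hypothesis Lam1 : Lam 1.
Hypothesis LamM : forall c d, Lam c -> Lam d -> Lam (c * d).
Hypothesis chiC : forall i j c d, Lam c -> Lam d -> GRing.comm (chi i c) (chi j d).
Hypothesis chi_sep : forall i j, i != j -> exists2 d, Lam d & chi i d != chi j d.

(** The classical elimination: the relation at [c], multiplied on the right by [chi i0 d], is
    subtracted from the relation at [d * c]. Only values of the characters on [Lam] are exchanged,
    and these commute by [chiC]; the coefficients [e i] stay on the left and may be arbitrary. *)
Lemma dedekind_right (s : seq I) (e : I -> E) : uniq s ->
  (forall c, Lam c -> \sum_(i <- s) e i * chi i c = 0) -> {in s, forall i, e i = 0}.
Proof.
elim: s e => [|i0 s IH] e //= /andP[i0s us] He.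
have es : {in s, forall i, e i = 0}.
  move=> i si; have i_i0 : i != i0 by apply: contraNneq i0s => <-.
  have [d Ld dN] := chi_sep i_i0.
  suff /skew_mulf_eq0'[//|/subr0_eq/eqP] : e i * (chi i d - chi i0 d) = 0.
    by rewrite (negbTE dN).
  move: i si {i_i0 dN}; apply: IH => // c Lc.
  have := He (d * c) (LamM Ld Lc); have := congr1 ( *%R^~ (chi i0 d)) (He c Lc).
  rewrite mul0r !big_cons mulrDl mulr_suml => e1 e2.
  apply: etrans (_ : _ = (e i0 * chi i0 (d * c) + \sum_(j <- s) e j * chi j (d * c)) -
    (e i0 * chi i0 c * chi i0 d + \sum_(j <- s) e j * chi j c * chi i0 d)) _; last first.
    by rewrite e1 e2 subrr.
  have -> : e i0 * chi i0 (d * c) = e i0 * chi i0 c * chi i0 d.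
    by rewrite rmorphM -mulrA chiC.
  rewrite opprD addrACA subrr add0r -sumrB; apply: eq_bigr => j _.
  by rewrite rmorphM -!mulrA -mulrBr mulrBl [chi j c * _]chiC.
move=> i; rewrite in_cons => /predU1P[->|]; last exact: es.
have := He 1 Lam1; rewrite big_cons rmorph1 mulr1 big1_seq ?addr0 // => j /= sj.
by rewrite es // mul0r.
Qed.

Lemma dedekind_left (s : seq I) (e : I -> E) : uniq s ->
  (forall c, Lam c -> \sum_(i <- s) chi i c * e i = 0) -> {in s, forall i, e i = 0}.
Proof.
elim: s e => [|i0 s IH] e //= /andP[i0s us] He.
have es : {in s, forall i, e i = 0}.
  move=> i si; have i_i0 : i != i0 by apply: contraNneq i0s => <-.
  have [d Ld dN] := chi_sep i_i0.
  suff /skew_mulf_eq0'[/subr0_eq/eqP|//] : (chi i d - chi i0 d) * e i = 0.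
    by rewrite (negbTE dN).
  move: i si {i_i0 dN}; apply: IH => // c Lc.
  have := He (c * d) (LamM Lc Ld); have := congr1 ( *%R (chi i0 d)) (He c Lc).
  rewrite mulr0 !big_cons mulrDr mulr_sumr => e1 e2.
  apply: etrans (_ : _ = (chi i0 (c * d) * e i0 + \sum_(j <- s) chi j (c * d) * e j) -
    (chi i0 d * (chi i0 c * e i0) + \sum_(j <- s) chi i0 d * (chi j c * e j))) _; last first.
    by rewrite e1 e2 subrr.
  have -> : chi i0 (c * d) * e i0 = chi i0 d * (chi i0 c * e i0).
    by rewrite rmorphM chiC // -mulrA.
  rewrite opprD addrACA subrr add0r -sumrB; apply: eq_bigr => j _.
  by rewrite rmorphM !mulrA -mulrBl mulrBr [chi i0 d * _]chiC.
move=> i; rewrite in_cons => /predU1P[->|]; last exact: es.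
have := He 1 Lam1; rewrite big_cons rmorph1 mul1r big1_seq ?addr0 // => j /= sj.
by rewrite es // mulr0.
Qed.
End Dedekind.

Section LocalFractions.
Variables (A B : E -> Prop).
Hypothesis AM : forall a b, A a -> A b -> A (a * b).
Hypothesis BA : forall b, B b -> A b.
Hypothesis BC : forall b c, B b -> B c -> GRing.comm b c.

(** Since the denominators commute, a1 b1^-1 b2 a2^-1 = (a1 b2)(a2 b1)^-1; no Ore condition on [A]
    enters. *)
Lemma local_frac_right a1 b1 a2 b2 : A a1 -> B b1 -> b1 != 0 -> A a2 -> B b2 -> b2 != 0 ->
  a2 != 0 -> exists a b, [/\ A a, A b, b != 0 & (a1 / b1) / (a2 / b2) = a / b].
Proof.
move=> Aa1 Bb1 b10 Aa2 Bb2 b20 a20; exists (a1 * b2), (a2 * b1); split.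
- exact/AM/BA.
- exact/AM/BA.
- exact: skew_mulf_neq0.
rewrite !skew_invM ?skew_inv_neq0 // invrK -!mulrA; congr (_ * _); rewrite !mulrA.
by have := commrV (BC Bb2 Bb1); rewrite /GRing.comm => ->.
Qed.

Lemma local_frac_left a1 b1 a2 b2 : A a1 -> B b1 -> b1 != 0 -> A a2 -> B b2 -> b2 != 0 ->
  a2 != 0 -> exists a b, [/\ A a, A b, b != 0 & (b2^-1 * a2)^-1 * (b1^-1 * a1) = b^-1 * a].
Proof.
move=> Aa1 Bb1 b10 Aa2 Bb2 b20 a20; exists (b2 * a1), (b1 * a2); split.
- by apply: AM => //; apply: BA.
- by apply: AM => //; apply: BA.
- exact: skew_mulf_neq0.
rewrite !skew_invM ?skew_inv_neq0 // invrK -!mulrA; congr (_ * _); rewrite !mulrA.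
by have := commrV (BC Bb2 Bb1); rewrite /GRing.comm => ->.
Qed.
End LocalFractions.

End SkewFieldTheory.

Section Subfield.
Variables (E : unitRingType) (P : {pred E}).

(** The three proofs are arguments of the type itself, so that its field structure can be inferred
    from the type. *)
Definition subfield_of of skew_field E & divring_closed P & {in P &, commutative *%R} :=
  {e : E | e \in P}.

Variables (E_skew : skew_field E) (P_div : divring_closed P).
Variable P_comm : {in P &, commutative *%R}.
Local Notation F := (subfield_of E_skew P_div P_comm).

HB.instance Definition _ := SubType.on F.
HB.instance Definition _ := [Choice of F by <:].
#[local] HB.instance Definition _ := GRing.isDivringClosed.Build E P P_div.
HB.instance Definition _ := [SubChoice_isSubUnitRing of F by <:].
Fact subfield_mulC : commutative (@GRing.mul F).
Proof. by move=> f h; apply/val_inj; rewrite !rmorphM /=; apply: P_comm; apply: valP. Qed.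
HB.instance Definition _ := GRing.PzRing_hasCommutativeMul.Build F subfield_mulC.
Fact subfield_field : GRing.field_axiom F.
Proof.
move=> f f0; apply: (@E_skew (val f)).
by apply: contra f0 => /eqP e; apply/eqP/val_inj.
Qed.
HB.instance Definition _ := GRing.ComUnitRing_isField.Build F subfield_field.

Definition in_subfield (e : E) (eP : e \in P) : F := exist _ e eP.
End Subfield.

(** * Invariant Weyl algebras *)

Lemma comm_div_gen (E : unitRingType) (P : E -> Prop) c :
  (forall a, P a -> GRing.comm c a) -> forall a, div_gen P a -> GRing.comm c a.
Proof.
move=> Pc a; elim=> {a} [a /Pc//||a b _ IHa _ IHb|a b _ IHa _ IHb].
- exact: commr1.
- exact: commrB.
- by apply: commrM => //; apply: commrV.
Qed.

Lemma div_gen_comm (E : unitRingType) (P : E -> Prop) :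
  (forall a b, P a -> P b -> GRing.comm a b) ->
  forall a b, div_gen P a -> div_gen P b -> GRing.comm a b.
Proof.
move=> PC a b aP bP; apply: (comm_div_gen _ bP) => d dP; apply: commr_sym.
by apply: (comm_div_gen _ aP) => d' d'P; apply: PC.
Qed.

(** * Vector fields over C(z)(x) and the partial derivatives in the invariants *)

Section Core.
Context {K : fieldType} {E : unitRingType} {N : nat} {n_ : 'I_N -> nat}.
Local Notation n := (\sum_(s < N) n_ s)%N.
Local Notation W := {dffun forall s : 'I_N, signed_perm (n_ s)}.
Variables (kap : {rmorphism K -> E}) (cl : 'I_N -> classical_type).
Variables (x t : 'I_n -> E) (sig : W -> {rmorphism E -> E}).
Local Notation G := (reflection_group n_ cl).
Hypothesis E_skew : skew_field E.
Hypothesis K0 : [pchar K] =i pred0.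
Hypothesis kap_comm : forall c d, GRing.comm (kap c) (kap d).
Hypothesis kapx : forall c a, GRing.comm (kap c) (x a).
Hypothesis kapt : forall c a, GRing.comm (kap c) (t a).
Hypothesis xx : forall a b, GRing.comm (x a) (x b).
Hypothesis tt : forall a b, GRing.comm (t a) (t b).
Hypothesis tx : forall a b, t a * x b - x b * t a = (a == b)%:R * x b.
Hypothesis x0 : forall a, x a != 0.
Hypothesis sig1 : sig 1%g =1 id.
Hypothesis sigM : forall g h, sig (g * h)%g =1 sig h \o sig g.
Hypothesis sig_kap : forall g c, sig g (kap c) = kap c.
Hypothesis sig_x : forall g a, sig g (x a) =
  if refl_neg g a then (x (refl_idx g a))^-1 else x (refl_idx g a).
Hypothesis sig_t : forall g a, sig g (t a) = (-1) ^+ refl_neg g a * t (refl_idx g a).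

(** This is the commutative subfield C(z)(x) of E, which carries the coefficients of the vector
    fields and the Jacobian matrix. *)
Definition core_pred : {pred E} := fun e => `[< div_gen (coord_gens kap x) e >].

Fact core_div : divring_closed core_pred.
Proof.
split=> [|a b /asboolP aH /asboolP bH|a b /asboolP aH /asboolP bH]; apply/asboolP.
- exact: div_gen_1.
- exact: div_gen_B.
- exact: div_gen_div.
Qed.

Fact core_comm : {in core_pred &, commutative *%R}.
Proof.
move=> a b /asboolP aP /asboolP bP; apply: (div_gen_comm _ aP bP).
move=> {aP bP}a {}b [[c ->]|[i ->]] [[d ->]|[l ->]] //.
exact/commr_sym/kapx.
Qed.

Local Notation F := (subfield_of E_skew core_div core_comm).
Implicit Types f h : F.

Let valC f h : GRing.comm (val f) (val h).
Proof. by rewrite /GRing.comm -!rmorphM mulrC. Qed.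

Let mkF e (eP : div_gen (coord_gens kap x) e) : F :=
  in_subfield E_skew core_div core_comm (introT (asboolP _) eP).
Let valP' f : div_gen (coord_gens kap x) (val f).
Proof. exact/asboolP/(valP f). Qed.

Let kapP c : div_gen (coord_gens kap x) (kap c).
Proof. by apply: div_gen_base; left; exists c. Qed.
Let xP a : div_gen (coord_gens kap x) (x a).
Proof. by apply: div_gen_base; right; exists a. Qed.

Definition kapF c : F := mkF (kapP c).
Definition xF a : F := mkF (xP a).
Fact kapF_zmod_morphism : zmod_morphism kapF.
Proof. by move=> c d; apply/val_inj; rewrite rmorphB /= rmorphB. Qed.
Fact kapF_monoid_morphism : monoid_morphism kapF.
Proof.
by split=> [|c d]; apply/val_inj; rewrite ?rmorphM ?rmorph1 //= ?rmorphM ?rmorph1.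
Qed.
HB.instance Definition _ := GRing.isZmodMorphism.Build _ _ kapF kapF_zmod_morphism.
HB.instance Definition _ := GRing.isMonoidMorphism.Build _ _ kapF kapF_monoid_morphism.

Let sigP g f : div_gen (coord_gens kap x) (sig g (val f)).
Proof.
elim: (valP' f) => {f} [_ [[c ->]|[a ->]]||a b _ IHa _ IHb|a b _ IHa _ IHb].
- by rewrite sig_kap.
- by rewrite sig_x; case: ifP => _ //; apply: div_gen_V.
- by rewrite rmorph1; apply: div_gen_1.
- by rewrite rmorphB; apply: div_gen_B.
have [->|b0] := eqVneq b 0.
  by rewrite invr0 mulr0 rmorph0; apply: div_gen_0.
by rewrite rmorphM rmorphV ?E_skew //; apply: div_gen_div.
Qed.

Definition sigF g f : F := mkF (sigP g f).
Fact sigF_zmod_morphism g : zmod_morphism (sigF g).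
Proof. by move=> f h; apply/val_inj; rewrite rmorphB /= !rmorphB. Qed.
Fact sigF_monoid_morphism g : monoid_morphism (sigF g).
Proof.
split=> [|f h]; apply/val_inj; first by rewrite /= !rmorph1.
by rewrite rmorphM /= !rmorphM.
Qed.
HB.instance Definition _ g := GRing.isZmodMorphism.Build _ _ (sigF g) (sigF_zmod_morphism g).
HB.instance Definition _ g := GRing.isMonoidMorphism.Build _ _ (sigF g) (sigF_monoid_morphism g).

Let core_gen f : div_gen (coord_gens kapF xF) f.
Proof.
suff gen e (eP : e \in core_pred) : div_gen (coord_gens kap x) e ->
    div_gen (coord_gens kapF xF) (in_subfield E_skew core_div core_comm eP).
  suff -> : f = in_subfield E_skew core_div core_comm (valP f) by apply/gen/valP'.
  exact/val_inj.
move=> eg; elim: eg eP => {e} [e [[c eE]|[a eE]]||a b aP IHa bP IHb|a b aP IHa bP IHb] eP.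
- by apply: div_gen_base; left; exists c; apply/val_inj.
- by apply: div_gen_base; right; exists a; apply/val_inj.
- suff -> : in_subfield E_skew core_div core_comm eP = 1 by apply: div_gen_1.
  exact/val_inj.
- have aP' := introT (asboolP _) aP; have bP' := introT (asboolP _) bP.
  suff -> : in_subfield E_skew core_div core_comm eP =
    in_subfield E_skew core_div core_comm aP' - in_subfield E_skew core_div core_comm bP'.
    exact: div_gen_B.
  by apply/val_inj; rewrite rmorphB.
have aP' := introT (asboolP _) aP; have bP' := introT (asboolP _) bP.
suff -> : in_subfield E_skew core_div core_comm eP =
  in_subfield E_skew core_div core_comm aP' / in_subfield E_skew core_div core_comm bP'.
  exact: div_gen_div.
by apply/val_inj; rewrite rmorphM.
Qed.

Let E0 i : i%:R = 0 :> E -> i = 0%N.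
Proof.
rewrite -(rmorph_nat kap) -(rmorph0 kap) => e.
suff : i%:R = 0 :> K by move/eqP; rewrite (pcharf0P K).1 // => /eqP.
apply/eqP; case: eqP => // /eqP i0; move: e.
move/(congr1 ( *%R (kap i%:R^-1))); rewrite -!rmorphM mulVf // mulr0 rmorph1 rmorph0.
by move/eqP; rewrite oner_eq0.
Qed.

Let F0 : [pchar F] =i pred0.
Proof.
apply: (pcharf0P F).2 => i; apply/eqP/eqP => [e|->//].
by apply: E0; rewrite -[LHS](rmorph_nat (val : F -> E)) e rmorph0.
Qed.

Let xF0 a : xF a != 0.
Proof. by apply: contra (x0 a) => /eqP e; rewrite -[x a]/(val (xF a)) e rmorph0. Qed.
(** 1 commutes with t_a, while [t_a, x_a] = x_a is nonzero. This keeps the second generator of type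
    D from vanishing. *)
Let xF1 a : xF a != 1.
Proof.
apply/eqP => e; have := tx a a; rewrite -[x a]/(val (xF a)) e rmorph1 eqxx.
by rewrite !mulr1 mul1r subrr => /esym/eqP; rewrite oner_eq0.
Qed.

Definition core_y : 'I_n -> F := invariant_gen cl xF.

Let sigF1 : sigF 1%g =1 id.
Proof. by move=> f; apply/val_inj; rewrite /= sig1. Qed.
Let sigFM g g' : sigF (g * g')%g =1 sigF g' \o sigF g.
Proof. by move=> f; apply/val_inj; rewrite /= sigM. Qed.
Let sigF_kap g c : sigF g (kapF c) = kapF c.
Proof. exact/val_inj/sig_kap. Qed.
Let sigF_x g a : sigF g (xF a) =
  if refl_neg g a then (xF (refl_idx g a))^-1 else xF (refl_idx g a).
Proof. by apply/val_inj; rewrite /= sig_x; case: ifP. Qed.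

Let fixed_gen f : (forall g, g \in G -> sigF g f = f) -> div_gen (coord_gens kapF core_y) f.
Proof.
apply: (@fixed_div_gen K F N n_ kapF cl xF sigF) => //.
Qed.
Let core_y_fixed g a : g \in G -> sigF g (core_y a) = core_y a.
Proof.
exact: (@invariant_gen_fixed F N n_ cl xF sigF).
Qed.

Let valM f h : val (f * h) = val f * val h. Proof. exact: rmorphM. Qed.
Let valB f h : val (f - h) = val f - val h. Proof. exact: rmorphB. Qed.
Let val_sum (I : Type) (r : seq I) (Q : pred I) (f : I -> F) :
  val (\sum_(i <- r | Q i) f i) = \sum_(i <- r | Q i) val (f i).
Proof. exact: rmorph_sum. Qed.

Let sub4 (a b c d : E) : (a - b) - (c - d) = (a - c) - (b - d).
Proof. by rewrite !opprB !addrA [LHS]addrAC [a - b - c]addrAC [LHS]addrAC. Qed.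

Let ad_div (u v w : E) : v != 0 -> w * (u / v) - u / v * w =
  (w * u - u * w) / v - u / v * ((w * v - v * w) / v).
Proof.
move=> v0; have uv := E_skew v0.
rewrite !mulrBl mulrBr.
have -> : u / v * (w * v / v) = u / v * w by rewrite mulrK.
have -> : u / v * (v * w / v) = u * w / v by rewrite !mulrA mulrVK.
by rewrite !mulrA opprB addrA subrK.
Qed.

Let deltaP a f : div_gen (coord_gens kap x) (t a * val f - val f * t a).
Proof.
elim: (valP' f) => {f} [_ [[c ->]|[b ->]]||u v uP IHu vP IHv|u v uP IHu vP IHv].
- by rewrite kapt subrr; apply: div_gen_0.
- rewrite tx; case: (a == b); first by rewrite mul1r.
  by rewrite mul0r; apply: div_gen_0.
- by rewrite mulr1 mul1r subrr; apply: div_gen_0.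
- have -> : t a * (u - v) - (u - v) * t a = (t a * u - u * t a) - (t a * v - v * t a).
    by rewrite mulrBr mulrBl sub4.
  exact: div_gen_B.
have [->|v0] := eqVneq v 0.
  by rewrite invr0 !mulr0 mul0r subrr; apply: div_gen_0.
rewrite ad_div //; apply: div_gen_B; first exact: div_gen_div.
by apply: div_gen_M; apply: div_gen_div.
Qed.

(** On C(z)(x) the commutator with t_a is the Euler operator x_a d/dx_a. *)
Definition delta a f : F := mkF (deltaP a f).

Let val_delta a f : val (delta a f) = t a * val f - val f * t a.
Proof. by []. Qed.

Fact deltaB a : zmod_morphism (delta a).
Proof.
move=> f h; apply/val_inj; rewrite [RHS]rmorphB !val_delta.
have -> : val (f - h) = val f - val h by rewrite rmorphB.
by rewrite mulrBr mulrBl sub4.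
Qed.
Fact deltaM a f h : delta a (f * h) = delta a f * h + f * delta a h.
Proof.
apply/val_inj; rewrite [RHS]rmorphD !rmorphM !val_delta.
have -> : val (f * h) = val f * val h by rewrite rmorphM.
by rewrite mulrBl mulrBr !mulrA addrA subrK.
Qed.
Fact delta_kap a c : delta a (kapF c) = 0.
Proof. by apply/val_inj; rewrite /= kapt subrr. Qed.
Fact delta_x a b : delta a (xF b) = (a == b)%:R * xF b.
Proof. by apply/val_inj; rewrite rmorphM rmorph_nat /= tx. Qed.

Implicit Types c d : 'I_n -> F.

Definition vderiv c f : F := \sum_a c a * delta a f.

Fact vderivB c : zmod_morphism (vderiv c).
Proof.
by move=> f h; rewrite /vderiv -sumrB; apply: eq_bigr => a _; rewrite deltaB mulrBr.
Qed.
Fact vderivM c f h : vderiv c (f * h) = vderiv c f * h + f * vderiv c h.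
Proof.
rewrite /vderiv mulr_suml mulr_sumr -big_split; apply: eq_bigr => a _ /=.
by rewrite deltaM mulrDr mulrA mulrCA.
Qed.

(* A derivation that kills the invariants is zero, because x is algebraic over
   them; this makes the Jacobian matrix of core_y invertible. *)
Lemma vderiv_eq0 c : (forall i, vderiv c (core_y i) = 0) -> forall a, c a = 0.
Proof.
move=> cy; have D1 : vderiv c 1 = 0.
  have := vderivM c 1 1; rewrite !mulr1 mul1r => /eqP.
  by rewrite -[X in X == _]addr0 (inj_eq (addrI _)) eq_sym => /eqP.
have Dgen f : div_gen (coord_gens kapF core_y) f -> vderiv c f = 0.
  elim=> {f} [_ [[k ->]|[i ->]]||u v _ IHu _ IHv|u v _ IHu _ IHv] //.
  - by rewrite /vderiv [LHS]big1 // => a _; rewrite delta_kap mulr0.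
  - by rewrite vderivB IHu IHv subrr.
  have [->|v0] := eqVneq v 0.
    by rewrite invr0 mulr0; have := vderivB c 0 0; rewrite !subrr.
  have := vderivM c (u / v) v; rewrite mulfVK // IHu IHv mulr0 addr0 => /esym/eqP.
  by rewrite mulf_eq0 (negbTE v0) orbF => /eqP.
have D0 := @derivation_fixed F _ G sigF (vderiv c) sigF1 sigFM (vderivB c) (vderivM c)
  (fun f fG => Dgen f (fixed_gen fG)).
move=> a; have := D0 (xF a); rewrite /vderiv (bigD1 a) //= delta_x eqxx mul1r.
rewrite [X in _ + X]big1 ?addr0 => [|b /negbTE ba]; last by rewrite delta_x ba mul0r mulr0.
by move/eqP; rewrite mulf_eq0 (negbTE (xF0 a)) orbF => /eqP.
Qed.

Definition jacobian : 'M[F]_n := \matrix_(i, a) delta a (core_y i).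

(** A kernel vector of the matrix would be the coefficients of a nonzero derivation that kills every
    [core_y i]. *)
Lemma jacobian_unit : jacobian \in unitmx.
Proof.
rewrite unitmxE unitfE -det_tr; apply/det0P => -[v v0 vJ].
case/rV0Pn: v0 => a; rewrite (_ : v 0 a = 0) ?eqxx //.
apply: (vderiv_eq0 (c := fun a => v 0 a)) => i.
by move/rowP/(_ i): vJ; rewrite !mxE => <-; apply: eq_bigr => b _; rewrite !mxE.
Qed.

Definition vect c : E := \sum_a val (c a) * t a.

Lemma vect_ad c f : vect c * val f - val f * vect c = val (vderiv c f).
Proof.
rewrite /vect /vderiv mulr_suml mulr_sumr -sumrB val_sum; apply: eq_bigr => a _.
by rewrite valM val_delta mulrBr !mulrA [val f * _]valC.
Qed.

(** The second order terms cancel, since the t_a commute with each other and so do the coefficients.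
    The commutator of two vector fields is thus again a vector field. *)
Lemma vect_bracket c d : vect c * vect d - vect d * vect c =
  vect (fun b => vderiv c (d b) - vderiv d (c b)).
Proof.
have mulV c' d' : vect c' * vect d' =
    \sum_b val (vderiv c' (d' b)) * t b + \sum_b \sum_a val (d' b * c' a) * (t a * t b).
  rewrite {2}/vect mulr_sumr -big_split; apply: eq_bigr => b _ /=.
  rewrite mulrA; have /eqP := vect_ad c' (d' b); rewrite subr_eq => /eqP ->.
  rewrite mulrDl; congr (_ + _); rewrite /vect mulr_sumr mulr_suml; apply: eq_bigr => a _.
  by rewrite !mulrA.
rewrite !mulV opprD addrACA.
have -> : \sum_b \sum_a val (d b * c a) * (t a * t b) =
          \sum_b \sum_a val (c b * d a) * (t a * t b).
  rewrite exchange_big; apply: eq_bigr => b _; apply: eq_bigr => a _.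
  by rewrite mulrC tt.
rewrite subrr addr0 /vect -sumrB; apply: eq_bigr => b _.
by rewrite valB mulrBl.
Qed.

(* By [partial_yE], it acts on C(z)(y) as the partial derivative in [core_y i]. *)
Definition partial_y i : E := vect (fun a => invmx jacobian a i).

Lemma partial_yE i l :
  partial_y i * val (core_y l) - val (core_y l) * partial_y i = (i == l)%:R.
Proof.
rewrite vect_ad; suff -> : vderiv (fun a => invmx jacobian a i) (core_y l) = (i == l)%:R.
  by rewrite rmorph_nat.
have := mulmxV jacobian_unit => /matrixP/(_ l i); rewrite !mxE eq_sym => <-.
by apply: eq_bigr => a _; rewrite !mxE mulrC.
Qed.

Lemma vect_eq c d : (forall l, vderiv c (core_y l) = vderiv d (core_y l)) -> vect c = vect d.
Proof.
move=> cd; have cd0 : forall a, c a - d a = 0.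
  apply: vderiv_eq0 => l; apply/eqP; rewrite -(subrr (vderiv d (core_y l))) -{1}cd.
  by rewrite /vderiv -sumrB; apply/eqP/eq_bigr => a _; rewrite mulrBl.
by apply: eq_bigr => a _; rewrite (subr0_eq (cd0 a)).
Qed.

(** By [vect_bracket] the commutator is a vector field, so by [vect_eq] it suffices that it kills
    each [core_y m]. It does, because both operators send [core_y m] to a constant. *)
Lemma partial_y_comm i l : GRing.comm (partial_y i) (partial_y l).
Proof.
apply/subr0_eq; rewrite vect_bracket.
have -> : 0 = vect (fun=> 0) by rewrite /vect big1 // => a _; rewrite rmorph0 mul0r.
apply: vect_eq => m; apply/val_inj; rewrite -!vect_ad -vect_bracket.
have -> : vect (fun=> 0) = 0 by rewrite /vect big1 // => a _; rewrite rmorph0 mul0r.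
rewrite mul0r mulr0 subrr -!/(partial_y _).
have Py j : partial_y j * val (core_y m) = val (core_y m) * partial_y j + (j == m)%:R.
  by apply/eqP; rewrite addrC -subr_eq partial_yE.
move: (Py i) (Py l); move: (partial_y i) (partial_y l) (val (core_y m)) => P Q y Pi Ql.
have PQy : P * Q * y = y * (P * Q) + ((i == m)%:R * Q + (l == m)%:R * P).
  by rewrite -mulrA Ql mulrDr mulrA Pi mulrDl -!mulrA [P * _%:R]commr_nat addrA.
have QPy : Q * P * y = y * (Q * P) + ((i == m)%:R * Q + (l == m)%:R * P).
  by rewrite -mulrA Pi mulrDr mulrA Ql mulrDl -!mulrA [Q * _%:R]commr_nat -addrA [_ * P + _]addrC.
rewrite mulrBl mulrBr PQy QPy (opprD (y * (Q * P))).
by rewrite addrACA subrr addr0 subrr.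
Qed.

Lemma weyl_hom_ex : exists phi : {rmorphism weyl K n -> E},
  [/\ forall k, phi k%:A = kap k, forall i, phi (weyl_gen (inl i)) = val (core_y i)
    & forall i, phi (weyl_gen (inr i)) = partial_y i].
Proof.
pose gen (l : 'I_n + 'I_n) := match l with inl i => val (core_y i) | inr i => partial_y i end.
have [k [i|i]|i j|i j|i j|phi [phi_kap phi_gen]] := @weyl_lift K n E kap gen.
- exact: (valC (kapF k)).
- rewrite /= /partial_y /vect; apply: commr_sum => a _; apply: commrM; last exact: kapt.
  exact: (valC (kapF k)).
- exact: valC.
- exact: partial_y_comm.
- exact: partial_yE.
by exists phi; split=> // i; rewrite phi_gen.
Qed.

Let val_sign (i : nat) : val ((-1) ^+ i : F) = (-1) ^+ i.
Proof. by rewrite rmorphXn rmorphN1. Qed.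
Let sig_valF g f : val (sigF g f) = sig g (val f). Proof. by []. Qed.

(** G permutes the t_a up to sign, so the image of [partial_y i] is again a vector field. Its action
    on the invariants [core_y l] is unchanged, and this action determines it. *)
Lemma sig_partial_y g i : g \in G -> sig g (partial_y i) = partial_y i.
Proof.
move=> gG; have [c cE] : exists c, sig g (partial_y i) = vect c.
  exists (fun b => (-1) ^+ refl_neg g (refl_idx g^-1%g b) *
                   sigF g (invmx jacobian (refl_idx g^-1%g b) i)).
  have idxK a : refl_idx g^-1%g (refl_idx g a) = a by rewrite -refl_idxM mulgV refl_idx1.
  have idxKV a : refl_idx g (refl_idx g^-1%g a) = a by rewrite -refl_idxM mulVg refl_idx1.
  rewrite /partial_y /vect rmorph_sum [RHS](reindex (refl_idx g)) /=; last first.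
    by exists (refl_idx g^-1%g) => a _.
  apply: eq_bigr => a _; rewrite rmorphM sig_t idxK mulrA; congr (_ * _).
  by apply: etrans (commr_sign _ _) _; congr (_ * _); exact: esym (val_sign _).
rewrite cE; apply: vect_eq => l; apply/val_inj; rewrite -!vect_ad -cE -/(partial_y i).
rewrite partial_yE -[RHS](rmorph_nat (sig g)) -partial_yE rmorphB !rmorphM -sig_valF.
by rewrite core_y_fixed.
Qed.

(** * Fixed elements as fractions of the image of the Weyl algebra *)

Section WeylImage.
Variable phi : {rmorphism weyl K n -> E}.
Hypothesis phi_kap : forall k, phi k%:A = kap k.
Hypothesis phi_y : forall i, phi (weyl_gen (inl i)) = val (core_y i).
Hypothesis phi_d : forall i, phi (weyl_gen (inr i)) = partial_y i.
Implicit Types u v : weyl K n.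

Let phiM u v : phi (u * v) = phi u * phi v. Proof. exact: rmorphM. Qed.
Let phiD u v : phi (u + v) = phi u + phi v. Proof. exact: rmorphD. Qed.
Let phiZ k u : phi (k *: u) = kap k * phi u.
Proof. by rewrite -phi_kap -phiM mulr_algl. Qed.
Let phi1 : phi 1 = 1. Proof. exact: rmorph1. Qed.

Lemma phi_fixed g u : g \in G -> sig g (phi u) = phi u.
Proof.
move=> gG; move: u; apply: (@weyl_ind K n) => [|u v IHu IHv|k u IH|l u IH].
- by rewrite phi1 rmorph1.
- by rewrite phiD rmorphD IHu IHv.
- by rewrite phiZ rmorphM sig_kap IH.
rewrite phiM rmorphM IH; congr (_ * _); case: l => i.
  by rewrite phi_y -sig_valF core_y_fixed.
by rewrite phi_d sig_partial_y.
Qed.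

(** The image of the Weyl algebra with coefficients extended from C(z)[y] to C(z)(x). Moving a
    coefficient across [partial_y i] costs only its derivative, so this is a ring, and writing
    coefficients on the left, as in [field_weyl], loses nothing. It contains the x_a, their inverses
    and the t_a. *)
Definition weyl_field e := exists r : seq (weyl K n * F), e = \sum_(p <- r) phi p.1 * val p.2.
Definition field_weyl e := exists r : seq (weyl K n * F), e = \sum_(p <- r) val p.2 * phi p.1.

Let WF0 : weyl_field 0. Proof. by exists [::]; rewrite big_nil. Qed.
Let WFD a b : weyl_field a -> weyl_field b -> weyl_field (a + b).
Proof. by move=> [r ->] [r' ->]; exists (r ++ r'); rewrite big_cat. Qed.
Let WFphi u a : weyl_field a -> weyl_field (phi u * a).
Proof.
move=> [r ->]; exists [seq (u * p.1, p.2) | p <- r]; rewrite big_map mulr_sumr.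
by apply: eq_bigr => p _; rewrite phiM mulrA.
Qed.
Let WFval f a : weyl_field a -> weyl_field (a * val f).
Proof.
move=> [r ->]; exists [seq (p.1, p.2 * f) | p <- r]; rewrite big_map mulr_suml.
by apply: eq_bigr => p _; rewrite valM mulrA.
Qed.
Let WF_of_phi u : weyl_field (phi u).
Proof. by exists [:: (u, 1)]; rewrite big_seq1 rmorph1 mulr1. Qed.
Let WF_of_val f : weyl_field (val f).
Proof. by exists [:: (1, f)]; rewrite big_seq1 phi1 mul1r. Qed.
Let WFN a : weyl_field a -> weyl_field (- a).
Proof.
move=> /(WFval (-1)).
by rewrite (_ : val (-1 : F) = -1) ?mulrN1 // rmorphN rmorph1.
Qed.

Let val_phi_WF f u : weyl_field (val f * phi u).
Proof.
move: u f; apply: (@weyl_ind K n (fun u => forall f, weyl_field (val f * phi u)))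
  => [|u v IHu IHv|k u IH|[i|i] u IH] f.
- by rewrite phi1 mulr1; apply: WF_of_val.
- by rewrite phiD mulrDr; apply: WFD.
- rewrite phiZ mulrA [val f * _](valC f (kapF k)) -mulrA -[val (kapF k)]/(kap k) -phi_kap.
  exact: WFphi.
- rewrite phiM phi_y mulrA valC -mulrA -phi_y; exact: WFphi.
rewrite phiM phi_d mulrA.
have -> : val f * partial_y i = partial_y i * val f - val (vderiv (fun a => invmx jacobian a i) f).
  by rewrite -vect_ad opprB addrC subrK.
rewrite mulrBl -mulrA -phi_d; apply: WFD; first exact: WFphi.
by apply: WFN; apply: IH.
Qed.

Let WF_M a b : weyl_field a -> weyl_field b -> weyl_field (a * b).
Proof.
move=> [r ->] [r' ->]; rewrite mulr_suml; apply: (big_ind weyl_field) => // p _.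
rewrite -mulrA; apply: WFphi; rewrite mulr_sumr; apply: (big_ind weyl_field) => // p' _.
by rewrite mulrA; apply: WFval.
Qed.

Let phi_FW u a : field_weyl a -> field_weyl (phi u * a).
Proof.
have FWD b (c : E) : field_weyl b -> field_weyl c -> field_weyl (b + c).
  by move=> [r ->] [r' ->]; exists (r ++ r'); rewrite big_cat.
have FWval f b : field_weyl b -> field_weyl (val f * b).
  move=> [r ->]; exists [seq (p.1, f * p.2) | p <- r]; rewrite big_map mulr_sumr.
  by apply: eq_bigr => p _; rewrite valM mulrA.
move: u a; apply: (@weyl_ind K n
    (fun u => forall a, field_weyl a -> field_weyl (phi u * a)))
  => [|u v IHu IHv|k u IH|l u IH] a aFW.
- by rewrite phi1 mul1r.
- by rewrite phiD mulrDl; apply: FWD; [apply: IHu|apply: IHv].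
- by rewrite phiZ -mulrA; apply: (FWval (kapF k)); apply: IH.
rewrite phiM -mulrA; have [r ->] := IH a aFW; rewrite mulr_sumr.
apply: (big_ind field_weyl) => [|b c|p _]; [by exists [::]; rewrite big_nil|exact: FWD|].
case: l => i.
  rewrite phi_y mulrA valC -mulrA -phi_y; apply: FWval.
  by exists [:: (weyl_gen (inl i) * p.1, 1)]; rewrite big_seq1 rmorph1 mul1r phiM.
rewrite phi_d mulrA; have /eqP := vect_ad (fun a => invmx jacobian a i) p.2.
rewrite subr_eq -/(partial_y i) => /eqP ->; rewrite mulrDl; apply: FWD.
  by apply: FWval; exists [:: (p.1, 1)]; rewrite big_seq1 rmorph1 mul1r.
rewrite -mulrA; apply: FWval.
by exists [:: (weyl_gen (inr i) * p.1, 1)]; rewrite big_seq1 rmorph1 mul1r phiM phi_d.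
Qed.

Let WF_FW a : weyl_field a -> field_weyl a.
Proof.
move=> [r ->]; apply: (big_ind field_weyl) => [|b c [s ->] [s' ->]|p _].
- by exists [::]; rewrite big_nil.
- by exists (s ++ s'); rewrite big_cat.
apply: phi_FW; exists [:: (1, p.2)].
by rewrite big_seq1 phi1 mulr1.
Qed.

Definition core_gens e : Prop :=
  [\/ coord_gens kap x e, exists a, e = (x a)^-1 | exists a, e = t a].

(** The chain rule: [partial_y] was obtained from the t_a through the inverse of the Jacobian
    matrix, and the matrix itself goes back. *)
Let t_sum a : t a = \sum_i val (jacobian i a) * partial_y i.
Proof.
rewrite /partial_y /vect; under eq_bigr do rewrite mulr_sumr.
rewrite exchange_big (bigD1 a) //= [X in _ + X]big1 ?addr0 => [|b ba].
  under eq_bigr do rewrite mulrA -valM mulrC.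
  rewrite -mulr_suml -val_sum.
  have := mulVmx jacobian_unit => /matrixP/(_ a a); rewrite mxE => ->.
  by rewrite mxE eqxx rmorph1 mul1r.
under eq_bigr do rewrite mulrA -valM mulrC.
rewrite -mulr_suml -val_sum.
have := mulVmx jacobian_unit => /matrixP/(_ b a); rewrite mxE => ->.
by rewrite mxE (negbTE ba) rmorph0 mul0r.
Qed.

Let core_gens_WF e : ring_gen core_gens e -> weyl_field e.
Proof.
elim=> {e} [e [[[k ->]|[a ->]]|[a ->]|[a ->]]||a b _ IHa _ IHb|a b _ IHa _ IHb].
- exact: (WF_of_val (kapF k)).
- exact: (WF_of_val (xF a)).
- exact: (WF_of_val (xF a)^-1).
- rewrite t_sum; apply: (big_ind weyl_field) => // i _.
  by rewrite -phi_d; apply: val_phi_WF.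
- by rewrite -phi1; apply: WF_of_phi.
- by apply: WFD => //; apply: WFN.
- exact: WF_M.
Qed.

Let P := ring_gen (coord_gens kapF core_y).

Let P_phi b : P b -> exists u, val b = phi u.
Proof.
elim=> {b} [b [[k ->]|[i ->]]||a b _ [u au] _ [v bv]|a b _ [u au] _ [v bv]].
- by exists k%:A; rewrite phi_kap.
- by exists (weyl_gen (inl i)); rewrite phi_y.
- by exists 1; rewrite phi1 rmorph1.
- by exists (u - v); rewrite valB au bv (rmorphB phi).
- by exists (u * v); rewrite valM au bv phiM.
Qed.

Let fixedF f : exists h, [/\ div_gen (coord_gens kapF core_y) h &
  \sum_(g in G) sig g (val f) = val h].
Proof.
exists (\sum_(g in G) sigF g f); split; last by rewrite val_sum.
apply: fixed_gen => h hG; rewrite rmorph_sum [RHS](reindex_inj (mulIg h)).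
by apply: eq_big => g; rewrite ?groupMr // => _; rewrite sigFM.
Qed.

Let G_neq0 : #|G|%:R != 0 :> E.
Proof. by apply/eqP => /E0/eqP; rewrite -[_ == _]negbK -lt0n cardG_gt0. Qed.

Let average e : (forall g, g \in G -> sig g e = e) -> #|G|%:R * e = \sum_(g in G) sig g e.
Proof.
move=> eG; rewrite mulr_natl -sumr_const; apply: eq_bigr => g gG.
by rewrite eG.
Qed.

(** Denominators are taken in the commutative ring C(z)[y], where products serve as common
    denominators. *)
Let frac_r e := exists u b, [/\ P b, b != 0 & e = phi u * val b^-1].
Let frac_l e := exists u b, [/\ P b, b != 0 & e = val b^-1 * phi u].

Let frac_r0 : frac_r 0.
Proof.
by exists 0, 1; rewrite oner_neq0 (rmorph0 phi) mul0r; split=> //; apply: ring_gen_1.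
Qed.
Let frac_l0 : frac_l 0.
Proof.
by exists 0, 1; rewrite oner_neq0 (rmorph0 phi) mulr0; split=> //; apply: ring_gen_1.
Qed.
Let val_inv_split f h : f != 0 -> h != 0 ->
  val f^-1 = val h * val (f * h)^-1 /\ val h^-1 = val f * val (f * h)^-1.
Proof.
move=> f0 h0; split; apply: etrans (valM _ _); congr (val _).
  by rewrite invfM mulrCA mulfV ?mulr1.
by rewrite invfM mulrA mulfV ?mul1r.
Qed.
Let frac_rD e e' : frac_r e -> frac_r e' -> frac_r (e + e').
Proof.
move=> [u [b [Pb b0 ->]]] [u' [b' [Pb' b'0 ->]]].
have [[v bv] [v' bv']] := (P_phi Pb, P_phi Pb').
exists (u * v' + u' * v), (b * b'); split; first exact: ring_gen_M; first exact: mulf_neq0.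
have [-> ->] := val_inv_split b0 b'0; rewrite phiD mulrDl.
by congr (_ + _); rewrite phiM mulrA; congr (_ * _); congr (_ * _).
Qed.
Let frac_lD e e' : frac_l e -> frac_l e' -> frac_l (e + e').
Proof.
move=> [u [b [Pb b0 ->]]] [u' [b' [Pb' b'0 ->]]].
have [[v bv] [v' bv']] := (P_phi Pb, P_phi Pb').
exists (v' * u + v * u'), (b * b'); split; first exact: ring_gen_M; first exact: mulf_neq0.
have [-> ->] := val_inv_split b0 b'0; rewrite phiD mulrDr.
by congr (_ + _); rewrite phiM mulrA; congr (_ * _); rewrite valC; congr (_ * _).
Qed.

Let frac_rZ k e : frac_r e -> frac_r (kap k * e).
Proof. by move=> [u [b [Pb b0 ->]]]; exists (k *: u), b; rewrite phiZ mulrA. Qed.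
Let frac_lZ k e : frac_l e -> frac_l (kap k * e).
Proof.
move=> [u [b [Pb b0 ->]]]; exists (k *: u), b; rewrite phiZ !mulrA.
by split=> //; congr (_ * _); exact: (valC (kapF k)).
Qed.

Let fixed_average e : (forall g, g \in G -> sig g e = e) ->
  e = kap #|G|%:R^-1 * \sum_(g in G) sig g e.
Proof.
move=> /average <-; have cG : #|G|%:R = kap #|G|%:R by rewrite rmorph_nat.
rewrite mulrA cG -rmorphM mulVf ?rmorph1 ?mul1r //.
by apply: contraNneq G_neq0 => cG0; rewrite cG cG0 rmorph0.
Qed.

(** A fixed element is its own average. As the elements [phi u] are fixed, averaging only replaces
    each coefficient in C(z)(x) by its trace, and the trace lies in C(z)(y), so it is a fraction
    over C(z)[y]. *)
Let fixed_frac_r e : weyl_field e -> (forall g, g \in G -> sig g e = e) -> frac_r e.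
Proof.
move=> [r eE] /fixed_average ->; apply: frac_rZ.
have -> : \sum_(g in G) sig g e = \sum_(p <- r) phi p.1 * \sum_(g in G) sig g (val p.2).
  under [RHS]eq_bigr do rewrite mulr_sumr.
  rewrite exchange_big; apply: eq_bigr => g gG; rewrite eE rmorph_sum.
  by apply: eq_bigr => p _; rewrite rmorphM phi_fixed.
apply: (big_ind frac_r) => // p _; have [h [/div_gen_frac[a [b [Pa Pb b0 ->]]] ->]] := fixedF p.2.
have [u au] := P_phi Pa; exists (p.1 * u), b; split=> //.
by rewrite valM au phiM mulrA.
Qed.

Let fixed_frac_l e : weyl_field e -> (forall g, g \in G -> sig g e = e) -> frac_l e.
Proof.
move=> /WF_FW[r eE] /fixed_average ->; apply: frac_lZ.
have -> : \sum_(g in G) sig g e = \sum_(p <- r) (\sum_(g in G) sig g (val p.2)) * phi p.1.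
  under [RHS]eq_bigr do rewrite mulr_suml.
  rewrite exchange_big; apply: eq_bigr => g gG; rewrite eE rmorph_sum.
  by apply: eq_bigr => p _; rewrite rmorphM phi_fixed.
apply: (big_ind frac_l) => // p _; have [h [/div_gen_frac[a [b [Pa Pb b0 ->]]] ->]] := fixedF p.2.
have [u au] := P_phi Pa; exists (u * p.1), b; split=> //.
by rewrite mulrC valM au phiM mulrA.
Qed.

Let t_gens e := exists a, e = t a.

Let sig_t_comm (g h : W) (c d : E) : ring_gen t_gens c -> ring_gen t_gens d ->
  GRing.comm (sig g c) (sig h d).
Proof.
move=> cP dP; elim: cP => {c} [_ [a ->]||b b' _ IH _ IH'|b b' _ IH _ IH'].
- elim: dP => {d} [_ [b ->]||b b' _ IH _ IH'|b b' _ IH _ IH'].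
  + rewrite !sig_t; apply: commrM; first exact: commr_sign.
    by apply: commr_sym; apply: commrM; [apply: commr_sign|apply: tt].
  + by rewrite rmorph1; apply: commr1.
  + by rewrite (rmorphB (sig h)); apply: commrB.
  + by rewrite (rmorphM (sig h)); apply: commrM.
- by rewrite rmorph1; apply/commr_sym/commr1.
- by rewrite (rmorphB (sig g)); apply/commr_sym/commrB; apply/commr_sym.
- by rewrite (rmorphM (sig g)); apply/commr_sym/commrM; apply/commr_sym.
Qed.

(** The commutators of [sig g (t a)] with the x_b reveal the index and the sign of the image of t_a,
    the two signs being distinct in characteristic 0. Hence [g] is determined by its action on the
    t_a. *)
Let sig_t_sep (g h : W) : g != h -> exists2 d : E, ring_gen t_gens d & sig g d != sig h d.
Proof.
move=> gh; apply: contrapT => nsep; case/eqP: gh.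
have gh a : sig g (t a) = sig h (t a).
  apply/eqP; apply: contrapT => /negP ne; apply: nsep.
  by exists (t a) => //; apply: ring_gen_base; exists a.
have idx_neg a : refl_idx g a = refl_idx h a /\ refl_neg g a = refl_neg h a.
  have ad (f : W) b : ((-1) ^+ refl_neg f a * t (refl_idx f a)) * x b -
      x b * ((-1) ^+ refl_neg f a * t (refl_idx f a)) =
      (-1) ^+ refl_neg f a * ((refl_idx f a == b)%:R * x b).
    rewrite -tx mulrBr -mulrA; congr (_ - _); rewrite !mulrA; congr (_ * _).
    exact: commr_sign.
  have := ad g (refl_idx g a); rewrite -sig_t gh sig_t ad eqxx !mulrA mulr1.
  move/(congr1 ( *%R^~ (x (refl_idx g a))^-1)); rewrite !mulrK ?E_skew //.
  case: eqP => [->|_] /eqP.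
    rewrite mulr1; case: (refl_neg g a) (refl_neg h a) => [] [] //=; rewrite expr1 expr0.
      by rewrite -subr_eq0 opprK -(natrD _ 1 1) => /eqP/E0.
    by rewrite eq_sym -subr_eq0 opprK -(natrD _ 1 1) => /eqP/E0.
  by rewrite mulr0 eq_sym signr_eq0.
apply/ffunP => s; apply: signed_permP => [|j].
  apply/permP => j; have [+ _] := idx_neg (tagnat.rank (Tagged (fun s => 'I_(n_ s)) j)).
  by rewrite /refl_idx !tagnat.rankK => /(can_inj tagnat.rankK)/eqP; rewrite eq_Tagged => /eqP.
have [_] := idx_neg (tagnat.rank (Tagged (fun s => 'I_(n_ s)) j)).
by rewrite /refl_neg tagnat.rankK.
Qed.

Let ring_t_sub (D : E -> Prop) (D1 : D 1) (DB : forall a b, D a -> D b -> D (a - b))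
    (DM : forall a b, D a -> D b -> D (a * b)) (Dt : forall a, D (t a)) :
  forall e, ring_gen t_gens e -> D e.
Proof. by move=> e; elim=> {e} [_ [a ->]||a b _ IH _ IH'|a b _ IH _ IH'] //; eauto. Qed.

Definition core_trace e := \sum_(g in G) sig g e.

Let core_trace_fixed e g : g \in G -> sig g (core_trace e) = core_trace e.
Proof.
move=> gG; rewrite /core_trace rmorph_sum [RHS](reindex_inj (mulIg g)).
by apply: eq_big => g'; rewrite ?groupMr // => _; rewrite sigM.
Qed.

Let core_trace_Ml e (c : E) : (forall g, g \in G -> sig g e = e) ->
  core_trace (e * c) = e * core_trace c.
Proof. by move=> eG; rewrite mulr_sumr; apply: eq_bigr => g gG; rewrite rmorphM eG. Qed.
Let core_trace_Mr e (c : E) : (forall g, g \in G -> sig g e = e) ->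
  core_trace (c * e) = core_trace c * e.
Proof. by move=> eG; rewrite mulr_suml; apply: eq_bigr => g gG; rewrite rmorphM eG. Qed.

(** * Fixed fractions over a G-stable ring containing the t_a *)

Section FixedFractions.
Variable D : E -> Prop.
Hypothesis D1 : D 1.
Hypothesis DB : forall a b, D a -> D b -> D (a - b).
Hypothesis DM : forall a b, D a -> D b -> D (a * b).
Hypothesis Dt : forall a, D (t a).
Hypothesis Dsig : forall g a, g \in G -> D a -> D (sig g a).

Let DT a : D a -> D (core_trace a).
Proof.
move=> aD; have D0 : D 0 by rewrite -(subrr 1); apply: DB.
apply: (big_ind D) => // [b b' bD b'D|g gG]; last exact: Dsig.
by rewrite -[b']opprK -[- b']add0r; apply: DB => //; apply: DB.
Qed.

(* By Dedekind independence some c in the algebra of the t_a makes the trace of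
   b c nonzero; then q is the quotient of the traces of a c and b c. *)
Lemma fixed_fraction_right q a b : (forall g, g \in G -> sig g q = q) ->
    D a -> D b -> b != 0 -> q = a / b ->
  exists a' b', [/\ D a', D b', b' != 0, q = a' / b' &
    forall g, g \in G -> sig g a' = a' /\ sig g b' = b'].
Proof.
move=> qG aD bD b0 qE; have [c cP cN] : exists2 c : E, ring_gen t_gens c & core_trace (b * c) != 0.
  apply: contrapT => nc; case/eqP: b0.
  have := @dedekind_right E E_skew W sig _ (ring_gen_1 _) (@ring_gen_M _ _) sig_t_comm
    sig_t_sep (enum G) (fun g => sig g b) (enum_uniq _).
  move=> /(_ _ 1%g); rewrite mem_enum group1 sig1; apply=> // e eP.
  rewrite big_enum; apply/eqP/negPn/negP => nz; apply: nc; exists e => //.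
  by rewrite /core_trace; under eq_bigr do rewrite rmorphM.
have cD := ring_t_sub D1 DB DM Dt cP.
exists (core_trace (a * c)), (core_trace (b * c)); split=> //.
- exact/DT/DM.
- exact/DT/DM.
- apply: (canRL (mulrK (E_skew cN))); rewrite -core_trace_Ml // mulrA qE mulrVK //.
  exact: E_skew.
- by move=> g gG; rewrite !core_trace_fixed.
Qed.

Lemma fixed_fraction_left q a b : (forall g, g \in G -> sig g q = q) ->
    D a -> D b -> b != 0 -> q = b^-1 * a ->
  exists a' b', [/\ D a', D b', b' != 0, q = b'^-1 * a' &
    forall g, g \in G -> sig g a' = a' /\ sig g b' = b'].
Proof.
move=> qG aD bD b0 qE; have [c cP cN] : exists2 c : E, ring_gen t_gens c & core_trace (c * b) != 0.
  apply: contrapT => nc; case/eqP: b0.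
  have := @dedekind_left E E_skew W sig _ (ring_gen_1 _) (@ring_gen_M _ _) sig_t_comm
    sig_t_sep (enum G) (fun g => sig g b) (enum_uniq _).
  move=> /(_ _ 1%g); rewrite mem_enum group1 sig1; apply=> // e eP.
  rewrite big_enum; apply/eqP/negPn/negP => nz; apply: nc; exists e => //.
  by rewrite /core_trace; under eq_bigr do rewrite rmorphM.
have cD := ring_t_sub D1 DB DM Dt cP.
exists (core_trace (c * a)), (core_trace (c * b)); split=> //.
- exact/DT/DM.
- exact/DT/DM.
- apply: (canRL (mulKr (E_skew cN))); rewrite -core_trace_Mr // -mulrA qE mulVKr //.
  exact: E_skew.
- by move=> g gG; rewrite !core_trace_fixed.
Qed.

End FixedFractions.

Let core_gens_sig g e : ring_gen core_gens e -> ring_gen core_gens (sig g e).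
Proof.
elim=> {e} [e [[[k ->]|[a ->]]|[a ->]|[a ->]]||a b _ IHa _ IHb|a b _ IHa _ IHb].
- by rewrite sig_kap; apply: ring_gen_base; apply: Or31; left; exists k.
- rewrite sig_x; apply: ring_gen_base; case: ifP => _; [apply: Or32|apply: Or31; right].
    by exists (refl_idx g a).
  by exists (refl_idx g a).
- rewrite rmorphV ?E_skew // sig_x; apply: ring_gen_base.
  case: ifP => _; [rewrite invrK; apply: Or31; right|apply: Or32].
    by exists (refl_idx g a).
  by exists (refl_idx g a).
- have Ht : ring_gen core_gens (t (refl_idx g a)).
    by apply: ring_gen_base; apply: Or33; exists (refl_idx g a).
  rewrite sig_t; case: refl_neg; last by rewrite mul1r.
  by rewrite mulN1r; apply: ring_gen_N.
- by rewrite rmorph1; apply: ring_gen_1.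
- by rewrite rmorphB; apply: ring_gen_B.
- by rewrite rmorphM; apply: ring_gen_M.
Qed.

Let core_gens_t a : ring_gen core_gens (t a).
Proof. by apply: ring_gen_base; apply: Or33; exists a. Qed.

Let Aphi e := exists u, e = phi u.
Let Bphi e := exists2 b, P b & e = val b.

Let AphiM a b : Aphi a -> Aphi b -> Aphi (a * b).
Proof. by move=> [u ->] [v ->]; exists (u * v); rewrite phiM. Qed.
Let Bphi_A b : Bphi b -> Aphi b.
Proof. by move=> [f Pf ->]; apply: P_phi. Qed.
Let BphiC b b' : Bphi b -> Bphi b' -> GRing.comm b b'.
Proof. by move=> [f _ ->] [h _ ->]; apply: valC. Qed.

Let val_neq0 (f : F) : f != 0 -> val f != 0.
Proof. by apply: contraNneq => f0; apply/eqP/val_inj; rewrite f0 rmorph0. Qed.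
(** The trace argument makes numerator and denominator invariant. Each is then a fraction over
    C(z)[y], and the quotient of two such fractions is handled by [local_frac_right]. *)
Lemma fixed_weyl_right q : (forall g, g \in G -> sig g q = q) ->
    (exists a b, [/\ ring_gen core_gens a, ring_gen core_gens b, b != 0 & q = a / b]) ->
  exists u v, phi v != 0 /\ q = phi u / phi v.
Proof.
move=> qG [a [b [aP bP b0 qE]]].
have [|a' [b' [a'P b'P b'0 -> fixed]]] := fixed_fraction_right (D := ring_gen core_gens)
  (ring_gen_1 _) (@ring_gen_B _ _) (@ring_gen_M _ _) core_gens_t _ qG aP bP b0 qE.
  by move=> g e _; apply: core_gens_sig.
have [u1 [b1 [Pb1 b10 E1]]] := fixed_frac_r (core_gens_WF a'P) (fun g gG => (fixed g gG).1).
have [u2 [b2 [Pb2 b20 E2]]] := fixed_frac_r (core_gens_WF b'P) (fun g gG => (fixed g gG).2).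
have u20 : phi u2 != 0 by apply: contraNneq b'0 => u20; rewrite E2 u20 mul0r.
have [||||||a2 [b3 [[u ->] [v ->] v0 E3]]] := local_frac_right E_skew AphiM Bphi_A BphiC
  (a1 := phi u1) (b1 := val b1) (a2 := phi u2) (b2 := val b2) _ _ _ _ _ _ u20.
- by exists u1.
- by exists b1.
- exact: val_neq0.
- by exists u2.
- by exists b2.
- exact: val_neq0.
by exists u, v; rewrite E1 E2 -E3.
Qed.

Lemma fixed_weyl_left q : (forall g, g \in G -> sig g q = q) ->
    (exists a b, [/\ ring_gen core_gens a, ring_gen core_gens b, b != 0 & q = b^-1 * a]) ->
  exists u v, phi v != 0 /\ q = (phi v)^-1 * phi u.
Proof.
move=> qG [a [b [aP bP b0 qE]]].
have [|a' [b' [a'P b'P b'0 -> fixed]]] := fixed_fraction_left (D := ring_gen core_gens)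
  (ring_gen_1 _) (@ring_gen_B _ _) (@ring_gen_M _ _) core_gens_t _ qG aP bP b0 qE.
  by move=> g e _; apply: core_gens_sig.
have [u1 [b1 [Pb1 b10 E1]]] := fixed_frac_l (core_gens_WF a'P) (fun g gG => (fixed g gG).1).
have [u2 [b2 [Pb2 b20 E2]]] := fixed_frac_l (core_gens_WF b'P) (fun g gG => (fixed g gG).2).
have u20 : phi u2 != 0 by apply: contraNneq b'0 => u20; rewrite E2 u20 mulr0.
have [||||||a2 [b3 [[u ->] [v ->] v0 E3]]] := local_frac_left E_skew AphiM Bphi_A BphiC
  (a1 := phi u1) (b1 := val b1) (a2 := phi u2) (b2 := val b2) _ _ _ _ _ _ u20.
- by exists u1.
- by exists b1.
- exact: val_neq0.
- by exists u2.
- by exists b2.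
- exact: val_neq0.
by exists u, v; rewrite E1 E2 -E3.
Qed.

End WeylImage.

Theorem weyl_fixed_fractions : exists phi : {rmorphism weyl K n -> E},
  [/\ forall k, phi k%:A = kap k,
      forall g u, g \in G -> sig g (phi u) = phi u,
      forall q, (forall g, g \in G -> sig g q = q) ->
        (exists a b, [/\ ring_gen core_gens a, ring_gen core_gens b, b != 0 & q = a / b]) ->
        exists u v, phi v != 0 /\ q = phi u / phi v
    & forall q, (forall g, g \in G -> sig g q = q) ->
        (exists a b, [/\ ring_gen core_gens a, ring_gen core_gens b, b != 0 & q = b^-1 * a]) ->
        exists u v, phi v != 0 /\ q = (phi v)^-1 * phi u].
Proof.
have [phi [phi_kap phi_y phi_d]] := weyl_hom_ex; exists phi; split=> //.
- exact: (phi_fixed phi_kap phi_y phi_d).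
- exact: (fixed_weyl_right phi_kap phi_y phi_d).
- exact: (fixed_weyl_left phi_kap phi_y phi_d).
Qed.
End Core.

(** * Fixed subalgebras *)

Section FixedAlgebra.
Context {k : fieldType} {E : unitAlgType k} {I : Type}.
Variables (P : I -> Prop) (sig : I -> {lrmorphism E -> E}).

Definition fixed_alg_pred : {pred E} :=
  fun e => `[< forall g, P g -> sig g e = e >].

Fact fixed_alg_closed : divalg_closed fixed_alg_pred.
Proof.
split=> [|c u v /asboolP uP /asboolP vP|u v /asboolP uP /asboolP vP];
  apply/asboolP => g Pg.
- exact: rmorph1.
- by apply: etrans (linearP _ _ _ _) _; congr (c *: _ + _); [exact: uP|exact: vP].
apply: etrans (rmorphM _ _ _) _; congr (_ * _); first exact: uP.
have [v1|v1] := boolP (v \is a GRing.unit).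
  by apply: etrans (rmorphV _ v1) _; congr (_^-1); apply: vP.
by apply: etrans (congr1 (sig g) (invr_out v1)) _; apply: etrans (vP _ Pg) (esym (invr_out v1)).
Qed.

Definition fixed_alg : Type := {e : E | e \in fixed_alg_pred}.
HB.instance Definition _ := SubType.on fixed_alg.
HB.instance Definition _ := [Choice of fixed_alg by <:].
#[local] HB.instance Definition _ :=
  GRing.isDivalgClosed.Build k E fixed_alg_pred fixed_alg_closed.
HB.instance Definition _ := [SubChoice_isSubUnitRing of fixed_alg by <:].
HB.instance Definition _ := [SubZmodule_isSubLmodule of fixed_alg by <:].
HB.instance Definition _ := [SubNzRing_SubLmodule_isSubLalgebra of fixed_alg by <:].
HB.instance Definition _ := [SubLalgebra_isSubAlgebra of fixed_alg by <:].

Lemma fixed_algP (q : fixed_alg) g : P g -> sig g (val q) = val q.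
Proof. by have /asboolP := valP q; apply. Qed.

Lemma fixed_alg_skew : skew_field E -> skew_field fixed_alg.
Proof.
move=> E_skew d d0; apply: (E_skew (val d)).
by apply: contraNneq d0 => e; apply/eqP/val_inj.
Qed.

Section Corestriction.
Variables (A : algType k) (f : {lrmorphism A -> E}).
Hypothesis f_fixed : forall a g, P g -> sig g (f a) = f a.

Definition fixed_corestr (a : A) : fixed_alg :=
  exist _ (f a) (introT (asboolP _) (f_fixed a)).

Fact fixed_corestr_zmod_morphism : zmod_morphism fixed_corestr.
Proof. by move=> a b; apply/val_inj/(raddfB f). Qed.
Fact fixed_corestr_monoid_morphism : monoid_morphism fixed_corestr.
Proof. by split=> [|a b]; apply/val_inj; [exact: (rmorph1 f)|exact: (rmorphM f)]. Qed.
Fact fixed_corestr_scalable : scalable fixed_corestr.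
Proof. by move=> c a; apply/val_inj; exact: (linearZZ f). Qed.
HB.instance Definition _ := GRing.isZmodMorphism.Build _ _ fixed_corestr
  fixed_corestr_zmod_morphism.
HB.instance Definition _ := GRing.isMonoidMorphism.Build _ _ fixed_corestr
  fixed_corestr_monoid_morphism.
HB.instance Definition _ := GRing.isScalable.Build k _ _ _ fixed_corestr
  fixed_corestr_scalable.

Lemma fixed_skew_field_of_fractions : skew_field E -> injective f ->
    (forall q, (forall g, P g -> sig g q = q) ->
      exists a b, f b != 0 /\ q = f a / f b) ->
    (forall q, (forall g, P g -> sig g q = q) ->
      exists a b, f b != 0 /\ q = (f b)^-1 * f a) ->
  skew_field_of_fractions fixed_corestr.
Proof.
move=> E_skew f_inj fr fl; split.
- exact: fixed_alg_skew.
- by move=> a b /(congr1 val); apply: f_inj.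
- move=> d; have [a [b [fb0 dE]]] := fr (val d) (fixed_algP d).
  by exists a, b; split; [apply: contraNneq fb0 => ->; rewrite rmorph0|apply/val_inj].
move=> d; have [a [b [fb0 dE]]] := fl (val d) (fixed_algP d).
by exists a, b; split; [apply: contraNneq fb0 => ->; rewrite rmorph0|apply/val_inj].
Qed.
End Corestriction.
End FixedAlgebra.

(** * Fractions of the shift algebra *)

Section SkewReflection.
Context {k : fieldType} {N : nat} {n_ : 'I_N -> nat} {m : nat}.
Local Notation n := (\sum_(s < N) n_ s)%N.
Local Notation L := (ratfun k (n + m)).
Local Notation S := (shift_skew k n_ m).
Local Notation W := {dffun forall s : 'I_N, signed_perm (n_ s)}.
Local Notation act := (@shift_action k N n_ m).
Implicit Types (v w : 'rV[int]_n) (g h : W) (f : L) (x y : S).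

Lemma refl_shiftD g v w : refl_shift g (v + w) = refl_shift g v + refl_shift g w.
Proof. by apply/rowP => a; rewrite !mxE /= mxE mulrDr. Qed.

Lemma refl_shift0 g : refl_shift g 0 = 0.
Proof. by apply/rowP => a; rewrite !mxE /= mxE mulr0. Qed.

Lemma refl_shift1 v : refl_shift (1%g : W) v = v.
Proof. by apply/rowP => a; rewrite mxE /= invg1 refl_idx1 refl_neg1 mul1r. Qed.

Lemma refl_shiftM g h v : refl_shift (g * h)%g v = refl_shift h (refl_shift g v).
Proof.
apply/rowP => a; rewrite !mxE /= mxE /= invMg refl_idxM refl_negM.
by rewrite -[refl_idx g (refl_idx _ _)]refl_idxM mulVg refl_idx1 signr_addb mulrCA mulrA.
Qed.

Definition skew_refl g : S -> S := skew_gact refl refl_shift g.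

Let term_additive g v : zmod_morphism (fun f : L => skewU (act := act) (refl g f) (refl_shift g v)).
Proof. by move=> f f'; rewrite rmorphB; exact: monalg.monalgUB. Qed.
Fact skew_refl_zmod_morphism g : zmod_morphism (skew_refl g).
Proof. exact: (skew_sumB (term_additive g)). Qed.
HB.instance Definition _ g := GRing.isZmodMorphism.Build S S (skew_refl g)
  (skew_refl_zmod_morphism g).

Lemma skew_reflU g f v :
  skew_refl g (skewU f v) = skewU (refl g f) (refl_shift g v).
Proof. exact: (skew_sumU (term_additive g)). Qed.

Let reflD g x y : skew_refl g (x + y) = skew_refl g x + skew_refl g y.
Proof. exact: (raddfD (skew_refl g)). Qed.
Let refl_0 g : skew_refl g 0 = 0.
Proof. exact: (raddf0 (skew_refl g)). Qed.

(** Multiplicativity on terms amounts to [refl_conj], the compatibility between the action of G on L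
    and its conjugation action on the lattice. *)
Let skew_reflM g x y : skew_refl g (x * y) = skew_refl g x * skew_refl g y.
Proof.
move: x; apply: skew_elim => [|x x' IH IH'|f s].
- by rewrite mul0r refl_0 mul0r.
- apply: etrans (congr1 (skew_refl g) (mulrDl x x' y)) _; apply: etrans (reflD _ _ _) _.
  apply: etrans (congr2 +%R IH IH') _; apply: etrans (esym (mulrDl _ _ _)) _.
  exact: congr2 (esym (reflD _ _ _)) (erefl _).
move: y; apply: skew_elim => [|y y' IH IH'|f' t].
- by rewrite mulr0 refl_0 mulr0.
- apply: etrans (congr1 (skew_refl g) (mulrDr _ y y')) _; apply: etrans (reflD _ _ _) _.
  apply: etrans (congr2 +%R IH IH') _; apply: etrans (esym (mulrDr _ _ _)) _.
  exact: congr2 (erefl _) (esym (reflD _ _ _)).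
apply: etrans (congr1 _ (skewUM _ _ _ _ _)) _; apply: etrans (skew_reflU _ _ _) _.
apply: etrans _ (esym (congr2 *%R (skew_reflU _ _ _) (skew_reflU _ _ _))).
apply: etrans _ (esym (skewUM act (refl g f) (refl g f') (refl_shift g s) (refl_shift g t))).
apply: congr2; last exact: refl_shiftD.
by apply: etrans (rmorphM (refl g) _ _) _; apply: congr2 => //; exact: refl_conj.
Qed.

Let skew_refl_1 g : skew_refl g 1 = 1.
Proof.
by apply: etrans (skew_reflU _ _ _) _; rewrite (rmorph1 (refl g)) refl_shift0.
Qed.
HB.instance Definition _ g := GRing.isMonoidMorphism.Build S S (skew_refl g)
  (conj (skew_refl_1 g) (skew_reflM g)).

Fact skew_refl_scalable g : scalable (skew_refl g).
Proof.
move=> c x; apply: etrans (skew_reflM _ _ _) _; congr (_ * _).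
by apply: etrans (skew_reflU _ _ _) _; rewrite refl_shift0 rmorph_alg.
Qed.
HB.instance Definition _ g := GRing.isScalable.Build k S S _ (skew_refl g)
  (skew_refl_scalable g).

Lemma skew_refl1 : skew_refl 1%g =1 id.
Proof.
apply: skew_elim => [|x y IH IH'|f v]; first exact: refl_0.
  by rewrite reflD IH IH'.
by rewrite skew_reflU refl1 refl_shift1.
Qed.

Lemma skew_refl_comp g h : skew_refl (g * h)%g =1 skew_refl h \o skew_refl g.
Proof.
apply: skew_elim => [|x y IH IH'|f v] /=; first by rewrite !refl_0.
  by rewrite !reflD IH IH'.
by rewrite !skew_reflU reflM refl_shiftM.
Qed.

Lemma skew_refl_inj g : injective (skew_refl g).
Proof.
apply: (can_inj (g := skew_refl g^-1%g)) => x.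
by have := skew_refl_comp g g^-1%g x; rewrite mulgV skew_refl1.
Qed.

End SkewReflection.

(** * The field C(z) inside C(t, z) *)

Section ParamEmbedding.
Context {k : fieldType} {n m : nat}.
Local Notation L := (ratfun k (n + m)).
Implicit Types (p q : {mpoly k[m]}) (f : ratfun k m).

Definition param_mpoly p : {mpoly k[n + m]} := p \mPo [tuple 'X_(rshift n l) | l < m].
HB.instance Definition _ := GRing.LRMorphism.copy param_mpoly
  (comp_mpoly [tuple 'X_(rshift n l) | l < m]).

Lemma param_mpolyX l : param_mpoly 'X_l = 'X_(rshift n l).
Proof. by rewrite /param_mpoly comp_mpolyXU -tnth_nth tnth_mktuple. Qed.

(** Setting the variables t to 0 is a left inverse. *)
Lemma param_mpoly_inj : injective param_mpoly.
Proof.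
pose r (p : {mpoly k[n + m]}) : {mpoly k[m]} :=
  p \mPo [tuple if split i is inr l then 'X_l else 0 | i < n + m].
apply: (can_inj (g := r)).
apply: (@mpoly_lrmorph_ext _ _ _ (comp_mpoly _ \o param_mpoly) idfun) => l /=.
rewrite param_mpolyX comp_mpolyXU -tnth_nth tnth_mktuple.
by rewrite (unsplitK (inr l)).
Qed.

Let to_neq0 q : q != 0 -> to_ratfun (param_mpoly q) != 0.
Proof. by move=> q0; rewrite to_ratfun_eq0 (raddf_eq0 _ param_mpoly_inj). Qed.

Definition param f : L := to_ratfun (param_mpoly (numer f)) / to_ratfun (param_mpoly (denom f)).

Lemma paramE p q : q != 0 ->
  param (to_ratfun p / to_ratfun q) = to_ratfun (param_mpoly p) / to_ratfun (param_mpoly q).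
Proof.
move=> q0; set f := _ / _; have d0 := denom_neq0 f.
have E : p * denom f = numer f * q.
  have /eqP := numer_div_denom f.
  rewrite {1}/f eqr_div ?to_ratfun_eq0 // -2!(rmorphM to_ratfun).
  by rewrite /to_ratfun tofrac_eq => /eqP.
apply/eqP; rewrite /param eqr_div ?to_neq0 //.
by rewrite -2!(rmorphM to_ratfun) -2!(rmorphM param_mpoly) E.
Qed.

Lemma param_to_ratfun p : param (to_ratfun p) = to_ratfun (param_mpoly p).
Proof.
rewrite -[to_ratfun p]divr1 -(rmorph1 to_ratfun) paramE ?oner_neq0 //.
by rewrite !rmorph1 divr1.
Qed.

Fact param_is_zmod_morphism : zmod_morphism param.
Proof.
move=> f g; rewrite [f]numer_div_denom [g]numer_div_denom.
have := denom_neq0 f; have := denom_neq0 g.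
move: (numer f) (denom f) (numer g) (denom g) => p q p' q' q'0 q0.
rewrite -mulNr -rmorphN addf_div ?to_ratfun_eq0 // -!rmorphM -rmorphD.
rewrite !paramE ?mulf_neq0 // -mulNr -rmorphN addf_div ?to_neq0 //.
by rewrite -!rmorphM -rmorphD /= !(rmorphD, rmorphM, rmorphN).
Qed.

Fact param_is_monoid_morphism : monoid_morphism param.
Proof.
split=> [|f g]; first by rewrite -(rmorph1 to_ratfun) param_to_ratfun !rmorph1.
rewrite [f]numer_div_denom [g]numer_div_denom.
have := denom_neq0 f; have := denom_neq0 g.
move: (numer f) (denom f) (numer g) (denom g) => p q p' q' q'0 q0.
by rewrite mulf_div -!rmorphM !paramE ?mulf_neq0 // mulf_div !rmorphM.
Qed.
HB.instance Definition _ := GRing.isZmodMorphism.Build _ _ param param_is_zmod_morphism.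
HB.instance Definition _ := GRing.isMonoidMorphism.Build _ _ param
  param_is_monoid_morphism.

Lemma param_alg (c : k) : param c%:A = c%:A.
Proof.
have toA n' : c%:A = to_ratfun c%:A :> ratfun k n' by rewrite linearZ /= rmorph1.
by rewrite !toA param_to_ratfun linearZ /= rmorph1.
Qed.

Lemma param_fixed (h : {rmorphism L -> L}) :
    (forall p, h (to_ratfun (param_mpoly p)) = to_ratfun (param_mpoly p)) ->
  forall f, h (param f) = param f.
Proof. by move=> hp f; rewrite /param fmorph_div; congr (_ / _); exact: hp. Qed.

End ParamEmbedding.

Section ShiftReflParam.
Context {k : fieldType} {N : nat} {n_ : 'I_N -> nat} {m : nat}.
Local Notation n := (\sum_(s < N) n_ s)%N.
Local Notation W := {dffun forall s : 'I_N, signed_perm (n_ s)}.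
Implicit Type f : ratfun k m.

Lemma shift_param (v : 'rV[int]_n) f : shift v (param f) = param f.
Proof.
apply: param_fixed => p; rewrite [LHS]ratfun_map_to_ratfun; congr to_ratfun.
move: p; apply: (@mpoly_lrmorph_ext _ _ _ (mpoly_subst (shift_img v) \o param_mpoly)
  param_mpoly) => l /=.
by rewrite param_mpolyX mpoly_substX /shift_img (unsplitK (inr l)).
Qed.

Lemma refl_param (g : W) f : refl g (param f) = param f.
Proof.
apply: param_fixed => p; rewrite [LHS]ratfun_map_to_ratfun; congr to_ratfun.
move: p; apply: (@mpoly_lrmorph_ext _ _ _ (mpoly_subst (refl_img g) \o param_mpoly)
  param_mpoly) => l /=.
by rewrite param_mpolyX mpoly_substX /refl_img (unsplitK (inr l)).
Qed.

End ShiftReflParam.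

Lemma ore_frac_skew_field (k : fieldType) (A : ore_domain k) : skew_field (ore_frac A).
Proof. by move=> q; rewrite frac_unitE. Qed.

Lemma ore_frac_rmorph_ext (k : fieldType) (A : ore_domain k) (B : unitRingType)
    (h h' : {rmorphism ore_frac A -> B}) :
  (forall a : A, h (to_frac a) = h' (to_frac a)) -> h =1 h'.
Proof.
move=> hh' q; have [x [y [x0 ->]]] := frac_right q.
have ux : to_frac x \is a GRing.unit by rewrite frac_unitE to_frac_eq0.
by rewrite !rmorphM !rmorphV // !hh'.
Qed.

(** * The generators x_a, t_a and the scalars C(z) in E *)

Section SkewFractions.
Context {k : fieldType} {N : nat} {n_ : 'I_N -> nat} {m : nat}.
Local Notation n := (\sum_(s < N) n_ s)%N.
Local Notation L := (ratfun k (n + m)).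
Local Notation S := (shift_skew k n_ m).
Local Notation W := {dffun forall s : 'I_N, signed_perm (n_ s)}.
Local Notation act := (@shift_action k N n_ m).
Local Notation E := (ore_frac (skew_ore act)).
Local Notation fr := (@to_frac k (skew_ore act)).
Implicit Types (v w : 'rV[int]_n) (g h : W) (f : L) (s : S) (a b : 'I_n) (c : ratfun k m).

Definition frac_U f v : E := fr (skewU f v).
Definition frac_refl g : E -> E :=
  @frac_map k (skew_ore act) (skew_refl g) (@skew_refl_inj k N n_ m g) (@skew_refl_inj k N n_ m g).
HB.instance Definition _ g := GRing.LRMorphism.on (frac_refl g).

Lemma frac_U_M f v f' v' : frac_U f v * frac_U f' v' = frac_U (f * shift v f') (v + v').
Proof. by apply: etrans (esym (rmorphM fr _ _)) _; apply: (congr1 fr); exact: skewUM. Qed.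
Lemma frac_U_B f f' v : frac_U (f - f') v = frac_U f v - frac_U f' v.
Proof. by apply: etrans _ (rmorphB fr _ _); apply: (congr1 fr); exact: monalg.monalgUB. Qed.
Lemma frac_U_1 : frac_U 1 0 = 1.
Proof. exact: (rmorph1 fr). Qed.


Lemma frac_U_comm f v f' v' : f * shift v f' = f' * shift v' f ->
  GRing.comm (frac_U f v) (frac_U f' v').
Proof.
move=> ff'; apply: etrans (frac_U_M _ _ _ _) _; apply: etrans _ (esym (frac_U_M _ _ _ _)).
by apply: congr2 => //; exact: addrC.
Qed.

Lemma frac_U_eq0 f v : (frac_U f v == 0) = (f == 0).
Proof. by apply: etrans (to_frac_eq0 _) _; exact: monalg.monalgU_eq0. Qed.

Lemma frac_reflU g f v : frac_refl g (frac_U f v) = frac_U (refl g f) (refl_shift g v).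
Proof. by apply: etrans (frac_map_to_frac _ _) _; apply: (congr1 fr); exact: skew_reflU. Qed.

Lemma frac_refl1 : frac_refl 1%g =1 id.
Proof.
apply: (@ore_frac_rmorph_ext _ _ _ (frac_refl 1%g) idfun) => a.
by apply: etrans (frac_map_to_frac _ _) _; apply: (congr1 fr); exact: skew_refl1.
Qed.

Lemma frac_refl_comp g h : frac_refl (g * h)%g =1 frac_refl h \o frac_refl g.
Proof.
apply: (@ore_frac_rmorph_ext _ _ _ (frac_refl (g * h)%g) (frac_refl h \o frac_refl g)) => a /=.
apply: etrans (frac_map_to_frac _ _) _; apply: etrans _ (esym (congr1 _ (frac_map_to_frac _ _))).
by apply: etrans _ (esym (frac_map_to_frac _ _)); apply: (congr1 fr); exact: skew_refl_comp.
Qed.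

Definition frac_x a : E := frac_U 1 (delta_mx 0 a).
Definition frac_t a : E := frac_U (to_ratfun 'X_(lshift m a)) 0.
Definition frac_c c : E := frac_U (param c) 0.

Fact frac_c_zmod_morphism : zmod_morphism frac_c.
Proof. by move=> c d; apply: etrans _ (frac_U_B _ _ _); apply: congr2 => //; exact: rmorphB. Qed.
Fact frac_c_monoid_morphism : monoid_morphism frac_c.
Proof.
split=> [|c d]; first by rewrite /frac_c (rmorph1 param); exact: frac_U_1.
apply: etrans _ (esym (frac_U_M _ _ _ _)); apply: congr2; last exact: esym (addr0 _).
by rewrite shift_param; exact: rmorphM.
Qed.
HB.instance Definition _ := GRing.isZmodMorphism.Build _ _ frac_c frac_c_zmod_morphism.
HB.instance Definition _ := GRing.isMonoidMorphism.Build _ _ frac_c frac_c_monoid_morphism.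

Lemma frac_c_alg (e : k) : frac_c e%:A = e%:A.
Proof.
rewrite /frac_c param_alg; apply: etrans _ (rmorph_alg fr e); apply: (congr1 fr).
exact: esym (mulr1 _).
Qed.

Lemma frac_c_comm c d : GRing.comm (frac_c c) (frac_c d).
Proof. by apply: frac_U_comm; rewrite !shift0 mulrC. Qed.
Lemma frac_cx c a : GRing.comm (frac_c c) (frac_x a).
Proof. by apply: frac_U_comm; rewrite shift_param rmorph1 mulr1 mul1r. Qed.
Lemma frac_ct c a : GRing.comm (frac_c c) (frac_t a).
Proof. by apply: frac_U_comm; rewrite !shift0 mulrC. Qed.
Lemma frac_xx a b : GRing.comm (frac_x a) (frac_x b).
Proof. by apply: frac_U_comm; rewrite !rmorph1. Qed.
Lemma frac_tt a b : GRing.comm (frac_t a) (frac_t b).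
Proof. by apply: frac_U_comm; rewrite !shift0 mulrC. Qed.

(** The shift by minus one gives x_b t_b = (t_b - 1) x_b, whence the positive sign on the right. *)
Lemma frac_tx a b : frac_t a * frac_x b - frac_x b * frac_t a = (a == b)%:R * frac_x b.
Proof.
set T := to_ratfun 'X_(lshift m a) : L.
have e1 : frac_t a * frac_x b = frac_U T (delta_mx 0 b).
  apply: etrans (frac_U_M _ _ _ _) _; apply: congr2; last exact: add0r.
  by rewrite (rmorph1 (shift _)) mulr1.
have e2 : frac_x b * frac_t a = frac_U (shift (delta_mx 0 b) T) (delta_mx 0 b).
  by apply: etrans (frac_U_M _ _ _ _) _; apply: congr2; [exact: mul1r|exact: addr0].
apply: etrans (congr2 (fun u v : E => u - v) e1 e2) _.
apply: etrans (esym (frac_U_B _ _ _)) _.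
have -> : T - shift (delta_mx 0 b) T = (a == b)%:R.
  rewrite shiftX /shift_img (unsplitK (inl _)) mxE eqxx /= rmorphB opprB addrCA subrr addr0.
  by rewrite rmorph_int; case: eqP.
case: eqP => _; first exact: esym (mul1r (frac_x b)).
apply: etrans _ (esym (mul0r (frac_x b))).
by apply/eqP; apply: etrans (frac_U_eq0 _ _) _; exact: eqxx.
Qed.

Lemma frac_x_neq0 a : frac_x a != 0.
Proof. by rewrite frac_U_eq0 oner_eq0. Qed.

Lemma frac_x_inv a : (frac_x a)^-1 = frac_U 1 (- delta_mx 0 a).
Proof.
apply: (mulrI (ore_frac_skew_field (frac_x_neq0 a))).
apply: etrans (mulrV (ore_frac_skew_field (frac_x_neq0 a))) _.
apply: etrans _ (esym (frac_U_M _ _ _ _)).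
by rewrite (rmorph1 (shift _)) mulr1 subrr; exact: esym frac_U_1.
Qed.

Lemma refl_shift_delta g a :
  refl_shift g (delta_mx 0 a) = (-1) ^+ refl_neg g a *: delta_mx 0 (refl_idx g a).
Proof.
apply/rowP => b; rewrite !mxE /= mxE eqxx /=.
have -> : (refl_idx g^-1%g b == a) = (b == refl_idx g a).
  apply/eqP/eqP => [<-|->]; first by rewrite -refl_idxM mulVg refl_idx1.
  by rewrite -refl_idxM mulgV refl_idx1.
by case: eqP => [->|_]; [rewrite -refl_idxM mulgV refl_idx1|rewrite !mulr0].
Qed.

Lemma frac_refl_x g a : frac_refl g (frac_x a) =
  if refl_neg g a then (frac_x (refl_idx g a))^-1 else frac_x (refl_idx g a).
Proof.
rewrite frac_reflU rmorph1 refl_shift_delta frac_x_inv.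
by case: refl_neg; rewrite ?scaleN1r ?scale1r.
Qed.

Lemma frac_refl_t g a : frac_refl g (frac_t a) = (-1) ^+ refl_neg g a * frac_t (refl_idx g a).
Proof.
rewrite frac_reflU refl_shift0 reflX /refl_img (unsplitK (inl _)).
case: refl_neg; last by rewrite !mul1r.
rewrite !mulN1r rmorphN -[- _]sub0r frac_U_B.
have /eqP -> : frac_U 0 0 == 0 by rewrite frac_U_eq0.
by rewrite sub0r.
Qed.

Lemma frac_refl_c g c : frac_refl g (frac_c c) = frac_c c.
Proof. by rewrite frac_reflU refl_shift0 refl_param. Qed.

End SkewFractions.

Lemma mpoly_ring_ind (R : comNzRingType) (d : nat) (P : {mpoly R[d]} -> Prop) :
  P 0 -> (forall p q, P p -> P q -> P (p + q)) -> (forall p q, P p -> P q -> P (p * q)) ->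
  (forall c, P c%:MP_[d]) -> (forall i, P 'X_i) -> forall p, P p.
Proof.
move=> P0 PD PM PC PX p; rewrite (mpolyE p); apply: (big_ind P P0 PD) => w _.
rewrite -mul_mpolyC; apply: (PM) => //; rewrite mpolyXE_id.
have P1 : P 1 by rewrite -mpolyC1.
by apply: (big_ind P P1 PM) => i _; move: (w i); elim=> [|j IH] //; rewrite exprS; apply: (PM).
Qed.

Lemma skew_fracMr (E : unitRingType) (E_skew : skew_field E) (a b c : E) :
  b != 0 -> c != 0 -> a / b = (a * c) / (b * c).
Proof. by move=> b0 c0; rewrite (skew_invM E_skew) // -mulrA mulVKr //; apply: E_skew. Qed.

Lemma skew_fracMl (E : unitRingType) (E_skew : skew_field E) (a b c : E) :
  b != 0 -> c != 0 -> b^-1 * a = (c * b)^-1 * (c * a).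
Proof.
by move=> b0 c0; rewrite (skew_invM E_skew) // mulrA mulrVK //; apply: E_skew.
Qed.

Section PolynomialDenominators.
Context {k : fieldType} {N : nat} {n_ : 'I_N -> nat} {m : nat}.
Local Notation n := (\sum_(s < N) n_ s)%N.
Local Notation L := (ratfun k (n + m)).
Local Notation S := (shift_skew k n_ m).
Local Notation act := (@shift_action k N n_ m).
Local Notation E := (ore_frac (skew_ore act)).
Local Notation fr := (@to_frac k (skew_ore act)).
Implicit Types (v w : 'rV[int]_n) (f : L) (s : S) (p q : {mpoly k[n + m]}).

(** The ring generated by C(z), the t_a, the x_a and their inverses lies in [weyl_field]. Only
    denominators involving t separate it from the whole skew algebra, so it still has E as its
    fractions. *)
Definition frac_ring : E -> Prop := ring_gen (core_gens frac_c frac_x frac_t).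
Local Notation C p := (frac_U (to_ratfun p) 0 : E).

Let CM p q : C (p * q) = C p * C q.
Proof.
apply: etrans _ (esym (frac_U_M _ _ _ _)); apply: congr2; last exact: esym (addr0 _).
by rewrite (shift0 (to_ratfun q)); exact: rmorphM.
Qed.
Let CB p q : C (p - q) = C p - C q.
Proof. by apply: etrans _ (frac_U_B _ _ _); apply: congr2 => //; exact: rmorphB. Qed.
Let C1 : C 1 = 1.
Proof. by rewrite (rmorph1 to_ratfun); exact: frac_U_1. Qed.
Lemma frac_ring_poly p : frac_ring (C p).
Proof.
have gen0 : frac_ring 0 by exact: ring_gen_0.
have genB p' q' : frac_ring (C p') -> frac_ring (C q') -> frac_ring (C (p' - q')).
  move=> Hp Hq; rewrite (CB p' q').
  exact: ring_gen_B Hp Hq.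
have gen_0 : frac_ring (C 0) by rewrite -(subrr 1); apply: genB; rewrite C1; apply: ring_gen_1.
have genD p' q' : frac_ring (C p') -> frac_ring (C q') -> frac_ring (C (p' + q')).
  move=> Hp Hq; have -> : p' + q' = p' - (0 - q') by rewrite sub0r opprK.
  exact: genB Hp (genB _ _ gen_0 Hq).
have genM p' q' : frac_ring (C p') -> frac_ring (C q') -> frac_ring (C (p' * q')).
  move=> Hp Hq; rewrite (CM p' q').
  exact: ring_gen_M Hp Hq.
move: p; apply: (mpoly_ring_ind gen_0 genD genM) => [c|i].
  apply: ring_gen_base; apply: Or31; left; exists c%:A.
  apply: (congr1 (fun f => frac_U f 0)); apply: etrans _ (esym (param_alg c)).
  by rewrite -[c%:MP]mulr1 mul_mpolyC linearZ /= rmorph1.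
apply: ring_gen_base; case: (splitP i) => [a ia|l il].
  have -> : i = lshift m a by exact: val_inj.
  by apply: Or33; exact: (ex_intro _ a (erefl (frac_t a))).
have -> : i = rshift n l by exact: val_inj.
apply: Or31; left; exists (to_ratfun 'X_l).
apply: (congr1 (fun f => frac_U f 0)).
by rewrite param_to_ratfun param_mpolyX.
Qed.

Lemma frac_ring_shift v : frac_ring (frac_U 1 v).
Proof.
have gen0 : frac_ring (frac_U 1 0) by rewrite frac_U_1; apply: ring_gen_1.
have genD v' w : frac_ring (frac_U 1 v') -> frac_ring (frac_U 1 w) -> frac_ring (frac_U 1 (v' + w)).
  move=> Hv Hw; have e : frac_U 1 v' * frac_U 1 w = frac_U 1 (v' + w) :> E.
    apply: etrans (frac_U_M _ _ _ _) _; apply: (congr1 (fun f => frac_U f (v' + w))).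
    by rewrite (rmorph1 (shift _)) mulr1.
  by rewrite -e; exact: ring_gen_M Hv Hw.
rewrite (row_sum_delta v); apply: (big_ind (fun v => frac_ring (frac_U 1 v)) gen0 genD) => a _.
have gx : frac_ring (frac_U 1 (delta_mx 0 a)).
  by apply: ring_gen_base; apply: Or31; right; exact: (ex_intro _ a (erefl (frac_x a))).
have gxi : frac_ring (frac_U 1 (- delta_mx 0 a)).
  by apply: ring_gen_base; apply: Or32; exact: (ex_intro _ a (esym (frac_x_inv a))).
rewrite -[v 0 a]intz scaler_int; case: (v 0 a) => i; rewrite ?NegzE ?mulrNz -pmulrn -?mulNrn.
  by elim: i => [|i IH]; [exact: gen0|rewrite mulrS; exact: genD gx IH].
by elim: i => [|i IH]; [exact: gxi|rewrite mulrS; exact: genD gxi IH].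
Qed.

Lemma frac_ring_U p v : frac_ring (frac_U (to_ratfun p) v).
Proof.
have e : C p * frac_U 1 v = frac_U (to_ratfun p) v.
  apply: etrans (frac_U_M _ _ _ _) _; apply: congr2; last exact: add0r.
  by rewrite (rmorph1 (shift _)) mulr1.
by rewrite -e; exact: ring_gen_M (frac_ring_poly p) (frac_ring_shift v).
Qed.

Let num_den f : f * to_ratfun (denom f) = to_ratfun (numer f).
Proof.
have d0 : to_ratfun (denom f) != 0 by rewrite to_ratfun_eq0 denom_neq0.
exact: (canLR (mulfVK d0) (numer_div_denom f)).
Qed.

Let den_M p q (e : E) : frac_ring (e * C p) -> frac_ring (e * C (p * q)).
Proof. by move=> H; rewrite (CM p q) mulrA; exact: ring_gen_M H (frac_ring_poly q). Qed.
Let M_den p q (e : E) : frac_ring (C q * e) -> frac_ring (C (p * q) * e).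
Proof. by move=> H; rewrite (CM p q) -mulrA; exact: ring_gen_M (frac_ring_poly p) H. Qed.

(** Polynomials in t and z commute, so one denominator per term suffices and the product of these
    clears the whole sum. *)
Lemma frac_ring_denom_right s : exists p, p != 0 /\ frac_ring (fr s * C p).
Proof.
move: s; apply: skew_elim => [|s s' [p [p0 IH]] [q [q0 IH']]|f v].
- exists 1; split; first exact: oner_neq0.
  by rewrite (rmorph0 fr) (mul0r (C 1)); exact: ring_gen_0.
- exists (p * q); split; first exact: mulf_neq0.
  have -> : fr (s + s') * C (p * q) = fr s * C (p * q) + fr s' * C (p * q).
    by apply: etrans (congr1 ( *%R^~ _) (rmorphD fr s s')) _; exact: mulrDl.
  apply: ring_gen_D; first exact: den_M IH.
  by rewrite (mulrC p); exact: den_M IH'.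
(* A polynomial crosses the lattice element v by being shifted by v, so the denominator of f is
   first shifted back by -v. *)
exists (mpoly_subst (shift_img (- v)) (denom f)); split.
  by rewrite (raddf_eq0 _ (@shift_inj _ _ _ _ (- v))) denom_neq0.
suff e : fr (skewU f v) * C (mpoly_subst (shift_img (- v)) (denom f)) =
    frac_U (to_ratfun (numer f)) v by rewrite e; exact: frac_ring_U.
apply: etrans (frac_U_M _ _ _ _) _; apply: congr2; last exact: addr0.
apply: etrans (num_den f); apply: (congr1 ( *%R f)).
have -> : to_ratfun (mpoly_subst (shift_img (- v)) (denom f)) = shift (- v) (to_ratfun (denom f)).
  exact: esym (ratfun_map_to_ratfun _ _).
by have := shiftD v (- v) (to_ratfun (denom f)); rewrite subrr shift0 => /esym.
Qed.

Lemma frac_ring_denom_left s : exists p, p != 0 /\ frac_ring (C p * fr s).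
Proof.
move: s; apply: skew_elim => [|s s' [p [p0 IH]] [q [q0 IH']]|f v].
- exists 1; split; first exact: oner_neq0.
  by rewrite (rmorph0 fr) (mulr0 (C 1)); exact: ring_gen_0.
- exists (p * q); split; first exact: mulf_neq0.
  have -> : C (p * q) * fr (s + s') = C (p * q) * fr s + C (p * q) * fr s'.
    by apply: etrans (congr1 ( *%R _) (rmorphD fr s s')) _; exact: mulrDr.
  apply: ring_gen_D; last exact: M_den IH'.
  by rewrite (mulrC p); exact: M_den IH.
exists (denom f); split; first exact: denom_neq0.
suff e : C (denom f) * fr (skewU f v) = frac_U (to_ratfun (numer f)) v.
  by rewrite e; exact: frac_ring_U.
apply: etrans (frac_U_M _ _ _ _) _; apply: congr2; last exact: add0r.
by rewrite (shift0 f) mulrC num_den.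
Qed.

Let C_neq0 p : p != 0 -> C p != 0.
Proof. by move=> p0; rewrite frac_U_eq0 to_ratfun_eq0. Qed.
Let E_skew := @ore_frac_skew_field k (skew_ore act).

Lemma frac_ring_frac_right (e : E) :
  exists a b, [/\ frac_ring a, frac_ring b, b != 0 & e = a / b].
Proof.
have [x [y [x0 ->]]] := frac_right e; have fx0 : fr x != 0 by rewrite to_frac_eq0.
have [p [p0 Hp]] := frac_ring_denom_right y; have [q [q0 Hq]] := frac_ring_denom_right x.
have pq0 : C (p * q) != 0 by apply: C_neq0; exact: mulf_neq0.
exists (fr y * C (p * q)), (fr x * C (p * q)); split.
- exact: den_M Hp.
- by rewrite (mulrC p); exact: den_M Hq.
- exact: (skew_mulf_neq0 E_skew fx0 pq0).
exact: (@skew_fracMr E E_skew (fr y) (fr x) (C (p * q)) fx0 pq0).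
Qed.

Lemma frac_ring_frac_left (e : E) :
  exists a b, [/\ frac_ring a, frac_ring b, b != 0 & e = b^-1 * a].
Proof.
have [x [y [x0 ->]]] := frac_left e; have fx0 : fr x != 0 by rewrite to_frac_eq0.
have [p [p0 Hp]] := frac_ring_denom_left y; have [q [q0 Hq]] := frac_ring_denom_left x.
have pq0 : C (p * q) != 0 by apply: C_neq0; exact: mulf_neq0.
exists (C (p * q) * fr y), (C (p * q) * fr x); split.
- by rewrite (mulrC p); exact: M_den Hp.
- exact: M_den Hq.
- exact: (skew_mulf_neq0 E_skew pq0 fx0).
exact: (@skew_fracMl E E_skew (fr y) (fr x) (C (p * q)) fx0 pq0).
Qed.

End PolynomialDenominators.

(** * Fractions of Galois algebras *)

Section WeylRatfunMorphism.
Context {k : fieldType} {n m : nat} {E : algType k}.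
Variable phi : {rmorphism weyl (ratfun k m) n -> E}.

(** The map is [phi] itself, seen over C instead of C(z). The hypothesis on scalars is kept as an
    argument so that linearity over C can be inferred. *)
Definition weyl_ratfun_mor
    of (forall c : k, phi (c%:A : ratfun k m)%:A = c%:A) : weyl_ratfun k n m -> E := phi.

Variable phi_alg : forall c : k, phi (c%:A : ratfun k m)%:A = c%:A.
Local Notation f := (weyl_ratfun_mor phi_alg).

Fact weyl_ratfun_mor_zmod_morphism : zmod_morphism f.
Proof. exact: (raddfB phi). Qed.
Fact weyl_ratfun_mor_monoid_morphism : monoid_morphism f.
Proof. by split; [exact: (rmorph1 phi)|exact: (rmorphM phi)]. Qed.
Fact weyl_ratfun_mor_scalable : scalable f.
Proof.
move=> c u; have e : phi ((c%:A : ratfun k m)%:A * u) = c%:A * phi u.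
  by apply: etrans (rmorphM phi _ _) _; rewrite phi_alg.
apply: etrans (esym (congr1 phi (mulr_algl (c%:A : ratfun k m) (u : weyl (ratfun k m) n)))) _.
exact: etrans e (mulr_algl _ _).
Qed.
HB.instance Definition _ := GRing.isZmodMorphism.Build _ _ f weyl_ratfun_mor_zmod_morphism.
HB.instance Definition _ := GRing.isMonoidMorphism.Build _ _ f
  weyl_ratfun_mor_monoid_morphism.
HB.instance Definition _ := GRing.isScalable.Build k _ _ _ f weyl_ratfun_mor_scalable.
End WeylRatfunMorphism.

Lemma ratfun_char0 (k : fieldType) d : [pchar k] =i pred0 -> [pchar ratfun k d] =i pred0.
Proof.
move=> k0; apply: (pcharf0P (ratfun k d)).2 => i.
by rewrite -(rmorph_nat (in_alg (ratfun k d))) fmorph_eq0 (pcharf0P k).1.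
Qed.

Section CommonDenominators.
Variables (E : unitRingType) (L : fieldType) (U : nzRingType).
Variables (C : {rmorphism L -> E}) (i : {rmorphism U -> E}) (Gamma : L -> Prop).
Hypothesis E_skew : skew_field E.
Hypothesis Gamma1 : Gamma 1.
Hypothesis GammaM : forall f f', Gamma f -> Gamma f' -> Gamma (f * f').
Hypothesis Gamma_U : forall f, Gamma f -> exists u, C f = i u.

Let inv_split (f d : L) : f != 0 -> d != 0 ->
  f^-1 = d * (f * d)^-1 /\ d^-1 = f * (f * d)^-1.
Proof.
move=> f0 d0; split; first by rewrite invfM mulrCA mulfV ?mulr1.
by rewrite invfM mulrA mulfV ?mul1r.
Qed.

Let frac_r e := exists u d, [/\ Gamma d, d != 0 & e = i u * C d^-1].
Let frac_l e := exists u d, [/\ Gamma d, d != 0 & e = C d^-1 * i u].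

Let frac_rD e e' : frac_r e -> frac_r e' -> frac_r (e + e').
Proof.
move=> [u [d [Gd d0 ->]]] [u' [d' [Gd' d'0 ->]]].
have [[v dv] [v' dv']] := (Gamma_U Gd, Gamma_U Gd').
exists (u * v' + u' * v), (d * d'); split; [exact: GammaM|exact: mulf_neq0|].
have [-> ->] := inv_split d0 d'0.
by rewrite (rmorphM C d') (rmorphM C d) dv dv' rmorphD !rmorphM mulrDl !mulrA.
Qed.
Let frac_lD e e' : frac_l e -> frac_l e' -> frac_l (e + e').
Proof.
move=> [u [d [Gd d0 ->]]] [u' [d' [Gd' d'0 ->]]].
have [[v dv] [v' dv']] := (Gamma_U Gd, Gamma_U Gd').
exists (v' * u + v * u'), (d * d'); split; [exact: GammaM|exact: mulf_neq0|].
have [-> ->] := inv_split d0 d'0.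
rewrite (mulrC d') (mulrC d _^-1) (rmorphM C _ d') (rmorphM C _ d) dv dv'.
by rewrite rmorphD !rmorphM mulrDr !mulrA.
Qed.

(** Numerators in Gamma are absorbed into U, which contains Gamma, and denominators in Gamma are
    multiplied together, since they commute. *)
Lemma common_denom_right (r : seq (L * U)) :
    {in r, forall fu, exists a b, [/\ Gamma a, Gamma b, b != 0 & fu.1 = a / b]} ->
  exists u d, [/\ Gamma d, d != 0 & \sum_(fu <- r) i fu.2 * C fu.1 = i u / C d].
Proof.
move=> rG; suff [u [d [Gd d0 e]]] : frac_r (\sum_(fu <- r) i fu.2 * C fu.1).
  by exists u, d; rewrite e fmorphV.
elim: r rG => [|[f u] r IH] rG.
  by exists 0, 1; rewrite big_nil rmorph0 mul0r oner_neq0.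
rewrite big_cons; apply: frac_rD; last by apply: IH => fu fur; apply: rG; rewrite in_cons fur orbT.
have [a [b [/Gamma_U[v av] Gb b0 /= ->]]] := rG _ (mem_head _ _).
by exists (u * v), b; rewrite !rmorphM av mulrA.
Qed.

Lemma common_denom_left (r : seq (L * U)) :
    {in r, forall fu, exists a b, [/\ Gamma a, Gamma b, b != 0 & fu.1 = a / b]} ->
  exists u d, [/\ Gamma d, d != 0 & \sum_(fu <- r) C fu.1 * i fu.2 = (C d)^-1 * i u].
Proof.
move=> rG; suff [u [d [Gd d0 e]]] : frac_l (\sum_(fu <- r) C fu.1 * i fu.2).
  by exists u, d; rewrite e fmorphV.
elim: r rG => [|[f u] r IH] rG.
  by exists 0, 1; rewrite big_nil rmorph0 mulr0 oner_neq0.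
rewrite big_cons; apply: frac_lD; last by apply: IH => fu fur; apply: rG; rewrite in_cons fur orbT.
have [a [b [/Gamma_U[v av] Gb b0 /= ->]]] := rG _ (mem_head _ _).
by exists (v * u), b; rewrite mulrC !rmorphM av mulrA.
Qed.

Let Ai e := exists u, e = i u.
Let BG e := exists2 d, Gamma d & e = C d.
Let AiM a b : Ai a -> Ai b -> Ai (a * b).
Proof. by move=> [u ->] [v ->]; exists (u * v); rewrite rmorphM. Qed.
Let BG_Ai b : BG b -> Ai b. Proof. by move=> [d /Gamma_U[u du] ->]; exists u. Qed.
Let BG_C b c : BG b -> BG c -> GRing.comm b c.
Proof. by move=> [d _ ->] [d' _ ->]; rewrite /GRing.comm -!rmorphM mulrC. Qed.

Lemma gamma_frac_right u d u' d' : Gamma d -> d != 0 -> Gamma d' -> d' != 0 -> i u' != 0 ->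
  exists v w, i w != 0 /\ (i u / C d) / (i u' / C d') = i v / i w.
Proof.
move=> Gd d0 Gd' d'0 u'0.
have [||||||_ [_ [[v ->] [w ->] w0 ->]]] := local_frac_right E_skew AiM BG_Ai BG_C
  (a1 := i u) (b1 := C d) (a2 := i u') (b2 := C d') _ _ _ _ _ _ u'0.
- by exists u.
- by exists d.
- by rewrite fmorph_eq0.
- by exists u'.
- by exists d'.
- by rewrite fmorph_eq0.
by exists v, w.
Qed.

Lemma gamma_frac_left u d u' d' : Gamma d -> d != 0 -> Gamma d' -> d' != 0 -> i u' != 0 ->
  exists v w, i w != 0 /\ ((C d')^-1 * i u')^-1 * ((C d)^-1 * i u) = (i w)^-1 * i v.
Proof.
move=> Gd d0 Gd' d'0 u'0.
have [||||||_ [_ [[v ->] [w ->] w0 ->]]] := local_frac_left E_skew AiM BG_Ai BG_C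
  (a1 := i u) (b1 := C d) (a2 := i u') (b2 := C d') _ _ _ _ _ _ u'0.
- by exists u.
- by exists d.
- by rewrite fmorph_eq0.
- by exists u'.
- by exists d'.
- by rewrite fmorph_eq0.
by exists v, w.
Qed.
End CommonDenominators.

Section GaloisFractions.
Context {k : fieldType} {N : nat} {n_ : 'I_N -> nat} {m : nat}.
Local Notation n := (\sum_(s < N) n_ s)%N.
Local Notation L := (ratfun k (n + m)).
Local Notation S := (shift_skew k n_ m).
Local Notation act := (@shift_action k N n_ m).
Local Notation E := (ore_frac (skew_ore act)).
Local Notation fr := (@to_frac k (skew_ore act)).
Local Notation W := {dffun forall s : 'I_N, signed_perm (n_ s)}.
Variables (cl : 'I_N -> classical_type) (U : algType k) (j : {lrmorphism U -> S}).
Variable Gamma : L -> Prop.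
Local Notation G := (reflection_group n_ cl).
Hypothesis k0 : [pchar k] =i pred0.
Hypothesis Gamma_poly : polynomial_subalg Gamma.
Hypothesis U_galois : galois_algebra (reflection_group n_ cl) refl refl_shift Gamma j.
Implicit Types (f d : L) (u v : U) (s : S).

Let frC f : E := frac_U f 0.
Let frC_zmod_morphism : zmod_morphism frC.
Proof. by move=> f f'; exact: frac_U_B. Qed.
Let frC_monoid_morphism : monoid_morphism frC.
Proof.
split=> [|f f']; first exact: frac_U_1.
apply: esym; apply: etrans (frac_U_M _ _ _ _) _; apply: congr2; last exact: addr0.
by rewrite (shift0 f').
Qed.
HB.instance Definition _ := GRing.isZmodMorphism.Build _ _ frC frC_zmod_morphism.
HB.instance Definition _ := GRing.isMonoidMorphism.Build _ _ frC frC_monoid_morphism.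

Definition galois_frac_mor : U -> E := fr \o j.
HB.instance Definition _ := GRing.LRMorphism.on galois_frac_mor.
Local Notation frU := galois_frac_mor.

Lemma galois_frac_mor_inj : injective frU.
Proof. by move=> u v /to_frac_inj e; exact: (galois_inj U_galois e). Qed.

Lemma galois_frac_mor_fixed u g : g \in G -> frac_refl g (frU u) = frU u.
Proof.
move=> gG; apply: etrans (frac_map_to_frac _ _) _; apply: (congr1 fr).
exact: galois_fixed U_galois u g gG.
Qed.

Let Gamma1 : Gamma 1.
Proof. by case: Gamma_poly => d [phi [_ GP]]; apply/GP; exists 1; rewrite rmorph1. Qed.
Let GammaM f f' : Gamma f -> Gamma f' -> Gamma (f * f').
Proof.
case: Gamma_poly => d [phi [_ GP]] /GP[p ->] /GP[q ->].
by apply/GP; exists (p * q); rewrite rmorphM.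
Qed.
(** Gamma is among the generators of the image of U. *)
Let Gamma_U f : Gamma f -> exists u, frC f = frU u.
Proof.
move=> fG; have [gens gensP] := galois_fingen U_galois.
have [u uE] := (gensP (skewC f)).2 (subalg_gen_base (or_introl (ex_intro2 _ _ f fG erefl))).
by exists u; exact: (congr1 fr uE).
Qed.


Let E_skew := @ore_frac_skew_field k (skew_ore act).

Let fixed_gamma f : fixed_field G refl f ->
  exists a b, [/\ Gamma a, Gamma b, b != 0 & f = a / b].
Proof. exact: (galois_frac U_galois f).1. Qed.

Let fixed_frac_r s : skew_fixed (act := act) G refl refl_shift s ->
  exists u d, [/\ Gamma d, d != 0 & fr s = frU u / frC d].
Proof.
move=> /(galois_UK U_galois s)[r [rK ->]].
have [fu fur|u [d [Gd d0 e]]] := common_denom_right (C := frC) (i := frU) Gamma1 GammaM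
    Gamma_U (r := r); first by apply: fixed_gamma; apply: rK.
exists u, d; split; [exact: Gd|exact: d0|apply: etrans e].
apply: etrans (rmorph_sum fr _ _ _) _; apply: eq_bigr => fu _.
exact: (rmorphM fr).
Qed.

Let fixed_frac_l s : skew_fixed (act := act) G refl refl_shift s ->
  exists u d, [/\ Gamma d, d != 0 & fr s = (frC d)^-1 * frU u].
Proof.
move=> /(galois_KU U_galois s)[r [rK ->]].
have [fu fur|u [d [Gd d0 e]]] := common_denom_left (C := frC) (i := frU) Gamma1 GammaM
    Gamma_U (r := r); first by apply: fixed_gamma; apply: rK.
exists u, d; split; [exact: Gd|exact: d0|apply: etrans e].
apply: etrans (rmorph_sum fr _ _ _) _; apply: eq_bigr => fu _.
exact: (rmorphM fr).
Qed.

(** The image of the skew algebra is the second ring to which the trace argument is applied; it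
    contains the t_a and is stable under G. *)
Let range (e : E) := exists s, e = fr s.

Let skew_fixed_fr s : (forall g, g \in G -> frac_refl g (fr s) = fr s) ->
  skew_fixed (act := act) G refl refl_shift s.
Proof.
move=> sG g gG; apply: (to_frac_inj (A := skew_ore act)).
exact: etrans (esym (frac_map_to_frac _ _)) (sG g gG).
Qed.

Let sig g : {rmorphism E -> E} := frac_refl g.

Let range1 : range 1. Proof. exact: (ex_intro _ 1 (esym (rmorph1 fr))). Qed.
Let rangeB a b : range a -> range b -> range (a - b).
Proof. by move=> [s ->] [s' ->]; exact: (ex_intro _ (s - s') (esym (rmorphB fr s s'))). Qed.
Let rangeM a b : range a -> range b -> range (a * b).
Proof. by move=> [s ->] [s' ->]; exact: (ex_intro _ (s * s') (esym (rmorphM fr s s'))). Qed.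
Let range_t a : range (frac_t a). Proof. exact: (ex_intro _ _ erefl). Qed.
Let range_sig g (e : E) : g \in G -> range e -> range (sig g e).
Proof. by move=> _ [s ->]; exists (skew_refl g s); exact: frac_map_to_frac. Qed.

Let trace_right := @fixed_fraction_right _ E N n_ (@frac_c k N n_ m) cl (@frac_x k N n_ m)
  (@frac_t k N n_ m) sig E_skew (ratfun_char0 m k0) (@frac_tt k N n_ m) (@frac_tx k N n_ m)
  (@frac_x_neq0 k N n_ m) (@frac_refl1 k N n_ m) (@frac_refl_comp k N n_ m)
  (@frac_refl_t k N n_ m) range range1 rangeB rangeM range_t range_sig.
Let trace_left := @fixed_fraction_left _ E N n_ (@frac_c k N n_ m) cl (@frac_x k N n_ m)
  (@frac_t k N n_ m) sig E_skew (ratfun_char0 m k0) (@frac_tt k N n_ m) (@frac_tx k N n_ m)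
  (@frac_x_neq0 k N n_ m) (@frac_refl1 k N n_ m) (@frac_refl_comp k N n_ m)
  (@frac_refl_t k N n_ m) range range1 rangeB rangeM range_t range_sig.

Let frU_neq0_right u d : frU u / frC d != 0 -> frU u != 0.
Proof. by move=> ud0; apply/eqP => u0; move: ud0; rewrite u0 (mul0r (frC d)^-1) eqxx. Qed.
Let frU_neq0_left u d : (frC d)^-1 * frU u != 0 -> frU u != 0.
Proof. by move=> ud0; apply/eqP => u0; move: ud0; rewrite u0 (mulr0 (frC d)^-1) eqxx. Qed.

(** The trace argument turns [q] into a quotient of fixed elements of the skew algebra. As UK is the
    whole fixed subalgebra and K consists of fractions of Gamma, each of them is an element of U
    over one of Gamma. *)
Lemma galois_fractions_right q : (forall g, g \in G -> frac_refl g q = q) ->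
  exists u v, frU v != 0 /\ q = frU u / frU v.
Proof.
move=> qG; have [x [y [x0 qE]]] := frac_right q.
have fx0 : fr x != 0 by rewrite to_frac_eq0.
have [a [b [[s aE] [s' bE] b0 qab ab]]] :=
  trace_right qG (ex_intro _ y erefl) (ex_intro _ x erefl) fx0 qE.
have [u [d [Gd d0 e]]] := fixed_frac_r (skew_fixed_fr (s := s)
  (fun g gG => etrans (congr1 (frac_refl g) (esym aE)) (etrans (ab g gG).1 aE))).
have [u' [d' [Gd' d'0 e']]] := fixed_frac_r (skew_fixed_fr (s := s')
  (fun g gG => etrans (congr1 (frac_refl g) (esym bE)) (etrans (ab g gG).2 bE))).
have u'0 : frU u' != 0 by apply: (frU_neq0_right (d := d')); rewrite -e' -bE.
have [v [w [w0 E1]]] := gamma_frac_right (C := frC) (i := frU) E_skew Gamma_U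
  u Gd d0 Gd' d'0 u'0.
exists v, w; split; first exact: w0.
by rewrite qab aE bE e e'; exact: E1.
Qed.

Lemma galois_fractions_left q : (forall g, g \in G -> frac_refl g q = q) ->
  exists u v, frU v != 0 /\ q = (frU v)^-1 * frU u.
Proof.
move=> qG; have [x [y [x0 qE]]] := frac_left q.
have fx0 : fr x != 0 by rewrite to_frac_eq0.
have [a [b [[s aE] [s' bE] b0 qab ab]]] :=
  trace_left qG (ex_intro _ y erefl) (ex_intro _ x erefl) fx0 qE.
have [u [d [Gd d0 e]]] := fixed_frac_l (skew_fixed_fr (s := s)
  (fun g gG => etrans (congr1 (frac_refl g) (esym aE)) (etrans (ab g gG).1 aE))).
have [u' [d' [Gd' d'0 e']]] := fixed_frac_l (skew_fixed_fr (s := s')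
  (fun g gG => etrans (congr1 (frac_refl g) (esym bE)) (etrans (ab g gG).2 bE))).
have u'0 : frU u' != 0 by apply: (frU_neq0_left (d := d')); rewrite -e' -bE.
have [v [w [w0 E1]]] := gamma_frac_left (C := frC) (i := frU) E_skew Gamma_U
  u Gd d0 Gd' d'0 u'0.
exists v, w; split; first exact: w0.
by rewrite qab aE bE e e'; exact: E1.
Qed.

End GaloisFractions.

Theorem linear_galois_fractions (k : fieldType) (N m : nat) (n_ : 'I_N -> nat)
    (cl : 'I_N -> classical_type) (U : algType k)
    (j : {lrmorphism U -> shift_skew k n_ m}) :
  [pchar k] =i pred0 -> linear_galois_algebra cl j ->
  exists (F : unitAlgType k) (iU : {lrmorphism U -> F})
      (iA : {lrmorphism weyl_ratfun k (\sum_(s < N) n_ s) m -> F}),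
    skew_field_of_fractions iU /\ skew_field_of_fractions iA.
Proof.
move=> k0 [Gamma [Gamma_poly U_galois]].
pose E : unitAlgType k := ore_frac (skew_ore (@shift_action k N n_ m)).
have E_skew : skew_field E by exact: ore_frac_skew_field.
pose G := reflection_group n_ cl.
pose sig (g : {dffun forall s : 'I_N, signed_perm (n_ s)}) : {lrmorphism E -> E} := frac_refl g.
have [phi [phi_c phi_fixed phi_r phi_l]] := @weyl_fixed_fractions _ E N n_ (@frac_c k N n_ m) cl
  (@frac_x k N n_ m) (@frac_t k N n_ m) (fun g => sig g : {rmorphism E -> E}) E_skew
  (ratfun_char0 m k0) (@frac_c_comm k N n_ m) (@frac_cx k N n_ m) (@frac_ct k N n_ m)
  (@frac_xx k N n_ m) (@frac_tt k N n_ m) (@frac_tx k N n_ m) (@frac_x_neq0 k N n_ m)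
  (@frac_refl1 k N n_ m) (@frac_refl_comp k N n_ m) (@frac_refl_c k N n_ m)
  (@frac_refl_x k N n_ m) (@frac_refl_t k N n_ m).
have phi_alg (c : k) : phi (c%:A : ratfun k m)%:A = c%:A.
  by apply: etrans (phi_c _) _; exact: frac_c_alg.
pose iA := weyl_ratfun_mor phi_alg.
pose iU := @galois_frac_mor k N n_ m U j.
have iA_fixed u g : g \in G -> sig g (iA u) = iA u by exact: phi_fixed.
have iU_fixed u g : g \in G -> sig g (iU u) = iU u.
  exact: (galois_frac_mor_fixed U_galois).
exists (fixed_alg (fun g => g \in G) sig), (fixed_corestr (f := iU) iU_fixed),
  (fixed_corestr (f := iA) iA_fixed); split.
  exact: (fixed_skew_field_of_fractions iU_fixed E_skew (galois_frac_mor_inj U_galois)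
    (galois_fractions_right k0 Gamma_poly U_galois) (galois_fractions_left k0 Gamma_poly U_galois)).
apply: (fixed_skew_field_of_fractions iA_fixed E_skew).
- exact: (weyl_map_inj (ratfun_char0 m k0) (phi := phi)).
- by move=> q qG; exact: (phi_r q qG (frac_ring_frac_right q)).
- by move=> q qG; exact: (phi_l q qG (frac_ring_frac_left q)).
Qed.

Theorem theorem6 (R : realType) (N m : nat) (n_ : 'I_N -> nat)
    (cl : 'I_N -> classical_type) (U : algType R[i])
    (j : {lrmorphism U -> shift_skew R[i] n_ m}) :
  (1 <= N)%N -> (forall s, (1 <= n_ s)%N) ->
  linear_galois_algebra cl j ->
  exists (FU FA : unitAlgType R[i]) (iU : {lrmorphism U -> FU})
      (iA : {lrmorphism weyl_ratfun R[i] (\sum_(s < N) n_ s) m -> FA}),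
    [/\ skew_field_of_fractions iU, skew_field_of_fractions iA &
        exists phi : {lrmorphism FU -> FA}, bijective phi].
Proof.
move=> _ _ /(linear_galois_fractions (@pchar_num _))[F [iU [iA [FU FA]]]].
(* Both algebras have the same E^G as skew field of fractions, so the isomorphism is the
   identity. *)
by exists F, F, iU, iA; split=> //; exists idfun; exists idfun.
Qed.
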